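(* Let $\omega$ be a non-quasianalytic weight function and $T\in\mathcal{O}'_{C,\omega}(\mathbb{R}^N)$. Then $T\star S\in\mathcal{S}'_\omega(\mathbb{R}^N)$ for every $S\in\mathcal{S}'_\omega(\mathbb{R}^N)$. Moreover, the linear operator $\mathcal{C}_T:\mathcal{S}'_\omega(\mathbb{R}^N)\to\mathcal{S}'_\omega(\mathbb{R}^N)$ defined by $\mathcal{C}_T(S):=T\star S$ is continuous.
   Context: $\mathbb{N}=\{1,2,\dots\}$, $\mathbb{N}_0=\mathbb{N}\cup\{0\}$. A non-quasianalytic weight function is a continuous increasing (i.e. non-decreasing) function $\omega:[0,\infty)\to[0,\infty)$ such that: ($\alpha$) there is $K\ge1$ with $\omega(2t)\le K(1+\omega(t))$ for all $t\ge0$; ($\beta$) $\int_1^\infty\frac{\omega(t)}{1+t^2}\,dt<\infty$; ($\gamma$) there are $a\in\mathbb{R}$, $b>0$ with $\omega(t)\ge a+b\log(1+t)$ for all $t\ge0$; ($\delta$) $\varphi_\omega(t):=\omega(e^t)$ is convex. It is assumed (without loss of generality) that $\omega$ vanishes on $[0,1]$. For $x\in\mathbb{R}^N$, $\omega(x):=\omega(|x|)$. The Young conjugate is $\varphi^*_\omega(s):=\sup_{t\ge0}\{st-\varphi_\omega(t)\}$, $s\ge0$ (with $\exp(-\infty)=0$, $\exp(+\infty)=+\infty$, $0\cdot\infty=0$ if the supremum is $+\infty$). $\mathcal{S}_\omega(\mathbb{R}^N)$ is the set of all $f\in L^1(\mathbb{R}^N)$ with $f,\hat f\in C^\infty(\mathbb{R}^N)$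 and $\|\exp(\lambda\omega)\partial^\alpha f\|_\infty<\infty$, $\|\exp(\lambda\omega)\partial^\alpha\hat f\|_\infty<\infty$ for all $\lambda>0$, $\alpha\in\mathbb{N}_0^N$; it is a Fréchet space whose topology is generated by the norms $q_{m,m}(f)=\sup_{\alpha}\sup_x|\partial^\alpha f(x)|\exp\left(m\omega(x)-m\varphi^*_\omega\left(\frac{|\alpha|}{m}\right)\right)$, $m\in\mathbb{N}$. $\mathcal{S}'_\omega(\mathbb{R}^N)$ is its dual with the strong topology. For $m\in\mathbb{N}$, $n\in\mathbb{Z}$, $\mathcal{O}^m_{n,\omega}(\mathbb{R}^N)$ is the space of all $f\in C^\infty(\mathbb{R}^N)$ with $r_{m,n}(f):=\sup_{\alpha}\sup_{x}|\partial^\alpha f(x)|\exp\left(-n\omega(x)-m\varphi^*_\omega\left(\frac{|\alpha|}{m}\right)\right)<\infty$, normed by $r_{m,n}$. $\mathcal{O}_{C,\omega}(\mathbb{R}^N):=\bigcup_{n=1}^\infty\bigcap_{m=1}^\infty\mathcal{O}^m_{n,\omega}(\mathbb{R}^N)$ with the locally convex topology of $\mathrm{ind}_n\,\mathrm{proj}_m\,\mathcal{O}^m_{n,\omega}(\mathbb{R}^N)$; $\mathcal{O}'_{C,\omega}(\mathbb{R}^N)$ is its strong dual. The inclusion $\mathcal{S}_\omega(\mathbb{R}^N)\hookrightarrow\mathcal{O}_{C,\omega}(\mathbb{R}^N)$ is continuous with dense range (known), so $\mathcal{O}'_{C,\omega}(\mathbb{R}^N)\subset\mathcal{S}'_\omega(\mathbb{R}^N)$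 by restriction. For $T\in\mathcal{S}'_\omega(\mathbb{R}^N)$ and $f\in\mathcal{S}_\omega(\mathbb{R}^N)$, $(T\star f)(x):=\langle T_y,f(x-y)\rangle$. With $\check f(x):=f(-x)$, $\check T$ is defined by $\langle\check T,f\rangle:=\langle T,\check f\rangle$. For $T\in\mathcal{O}'_{C,\omega}(\mathbb{R}^N)$ and $S\in\mathcal{S}'_\omega(\mathbb{R}^N)$, the convolution $T\star S$ is defined by $\langle T\star S,f\rangle:=\langle S,\check T\star f\rangle$ for $f\in\mathcal{S}_\omega(\mathbb{R}^N)$ (where $\check T\star f\in\mathcal{S}_\omega(\mathbb{R}^N)$). *)

(* Defs.v *)
From HB Require Import structures.
From mathcomp Require Import all_boot all_order all_algebra.
From mathcomp Require Import all_classical all_reals all_analysis.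
From mathcomp Require Import measurable_realfun complex.

Set Implicit Arguments.
Unset Strict Implicit.
Unset Printing Implicit Defensive.
Import Order.TTheory GRing.Theory Num.Theory.
Import numFieldNormedType.Exports.
Local Open Scope classical_set_scope.
Local Open Scope ring_scope.
Local Open Scope complex_scope.

Section Dual.
Context {K : numFieldType} (E : preTopologicalLmodType K).

(* Von Neumann bounded sets: those absorbed by every neighbourhood of 0. *)
Definition vn_bounded (B : set E) : Prop :=
  forall U : set E, nbhs (0 : E) U ->
  exists2 r : K, 0 < r &
    forall a : K, r <= `|a| -> B `<=` [set a *: x | x in U].

Definition is_dual : {pred (E -> K^o)} :=
  mem [set u : E -> K^o | linear u /\ continuous u].

Record dual := Dual { dual_fun :> E -> K^o; _ : dual_fun \in is_dual }.
HB.instance Definition _ := [isSub for dual_fun].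
HB.instance Definition _ := [Choice of dual by <:].

Lemma is_dual_submod_closed : submod_closed is_dual.
Proof.
split=> [|a u v].
  rewrite !inE; split=> [b x y|x]; first by rewrite scaler0 addr0.
  exact: cvg_cst.
rewrite !inE => -[ul uc] [vl vc]; split=> [b x y|x].
  change (a *: u (b *: x + y) + v (b *: x + y) =
    b *: (a *: u x + v x) + (a *: u y + v y)).
  rewrite ul vl !scalerDr !scalerA (mulrC a b) -!addrA; congr (_ + _).
  by rewrite addrCA.
by apply: (@cvgD _ K^o); [apply: cvgZr; exact: uc|exact: vc].
Qed.
HB.instance Definition _ :=
  GRing.isSubmodClosed.Build K (E -> K^o) is_dual is_dual_submod_closed.
HB.instance Definition _ := [SubChoice_isSubLmodule of dual by <:].

(* Strong topology: uniform convergence on the bounded subsets of E. *)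
HB.instance Definition _ := Topological.copy dual
  (initial_topology (dual_fun : dual -> {family vn_bounded, E -> K^o})).

End Dual.
Arguments is_dual {K} {E}.

Section LebesgueTuple.
Context {R : realType}.
Local Notation T n := (n.-tuple (measurableTypeR R)).

Definition tuple_glue n (p : measurableTypeR R * T n) : T n.+1 :=
  [tuple of p.1 :: p.2].

Section step.
Variables (n : nat) (m : {sigma_finite_measure set (T n) -> \bar R}).

Let measurable_glue : measurable_fun setT (@tuple_glue n).
Proof. exact: measurable_cons. Qed.

Definition lebesgue_step : set (T n.+1) -> \bar R :=
  pushforward (@lebesgue_measure R \x m)%E (@tuple_glue n).

Let lebesgue_step0 : lebesgue_step set0 = 0%E.
Proof. exact: measure0. Qed.

Let lebesgue_step_ge0 A : (0 <= lebesgue_step A)%E.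
Proof. exact: measure_ge0. Qed.

Let lebesgue_step_sigma_additive : semi_sigma_additive lebesgue_step.
Proof. exact: measure_semi_sigma_additive. Qed.

HB.instance Definition _ := isMeasure.Build _ _ _ lebesgue_step
  lebesgue_step0 lebesgue_step_ge0 lebesgue_step_sigma_additive.

Let lebesgue_step_sigma_finite : sigma_finite setT lebesgue_step.
Proof.
have /sigma_finiteP[F [FT Fnd Ffin]] :=
  sigma_finiteT (@lebesgue_measure R : {sigma_finite_measure set _ -> \bar R}).
have /sigma_finiteP[G [GT Gnd Gfin]] := sigma_finiteT m.
pose split (t : T n.+1) : measurableTypeR R * T n :=
  (thead t, [tuple of behead t]).
have msplit : measurable_fun setT split.
  apply: measurable_fun_pair => //=; first exact: (@measurable_tnth _ _ _ ord0).
  exact: measurable_behead.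
exists (fun k => split @^-1` (F k `*` G k)).
  apply/esym/seteqP; split=> // t _.
  have [k1 _ F1] : (\bigcup_k F k) (thead t) by rewrite -FT.
  have [k2 _ G2] : (\bigcup_k G k) [tuple of behead t] by rewrite -GT.
  exists (maxn k1 k2) => //; split.
    by move: F1; exact/subsetPset/Fnd/leq_maxl.
  by move: G2; exact/subsetPset/Gnd/leq_maxr.
move=> k; have [mF Foo] := Ffin k; have [mG Goo] := Gfin k; split.
  by rewrite -[X in measurable X]setTI; apply: msplit => //; exact: measurableX.
rewrite /lebesgue_step /pushforward -comp_preimage.
rewrite (_ : split \o @tuple_glue n = id); last first.
  apply/funext => -[x t] /=; rewrite /split /tuple_glue /=; congr pair.
  exact/val_inj.
by rewrite preimage_id product_measure1E// lte_mul_pinfty// ge0_fin_numE.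
Qed.

HB.instance Definition _ := Measure_isSigmaFinite.Build _ _ _
  lebesgue_step lebesgue_step_sigma_finite.
End step.

Fixpoint lebesgue_tuple (n : nat) :
    {sigma_finite_measure set (T n) -> \bar R} :=
  match n with
  | 0 => dirac ([tuple] : T 0)
  | n.+1 => lebesgue_step (lebesgue_tuple n)
  end.
End LebesgueTuple.

Section Functions.
Context {R : realType} {N : nat}.
Local Notation RN := 'rV[R]_N.
Implicit Types (f : RN -> R[i]^o) (g : RN -> R).

(* The library norm on 'rV[R]_N is the sup norm. *)
Definition euclid_norm (x : RN) : R := Num.sqrt (\sum_i x 0 i ^+ 2).

(* partials [:: i1; ...; ik] g is d_i1 (... (d_ik g)). *)
Definition partials (s : seq 'I_N) g : RN -> R :=
  foldr (fun i h x => 'D_(delta_mx 0 i) h x) g s.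

(* All iterated partial derivatives exist and are continuous. Complex-valued
   functions are treated componentwise, since R[i]^o is a normed module over
   R[i] and not over R. *)
Definition smooth_real g : Prop :=
  forall s, continuous (partials s g) /\
    forall x i, derivable (partials s g) x (delta_mx 0 i).

Definition smooth f : Prop :=
  smooth_real (@complex.Re R \o f) /\ smooth_real (@complex.Im R \o f).

Definition multi_index := {ffun 'I_N -> nat}.

Definition mi_order (a : multi_index) : nat := (\sum_i a i)%N.

Definition mi_seq (a : multi_index) : seq 'I_N :=
  flatten [seq nseq (a i) i | i <- enum 'I_N].

Definition mderiv (a : multi_index) f (x : RN) : R[i] :=
  partials (mi_seq a) (@complex.Re R \o f) x +i*
  partials (mi_seq a) (@complex.Im R \o f) x.

Definition row_of_tuple (t : N.-tuple (measurableTypeR R)) : RN :=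
  \row_i tnth t i.

Definition L1 f : Prop :=
  (lebesgue_tuple N).-integrable setT
    (EFin \o (@complex.Re R \o f \o row_of_tuple)) /\
  (lebesgue_tuple N).-integrable setT
    (EFin \o (@complex.Im R \o f \o row_of_tuple)).

Definition cintegral f : R[i] :=
  (\int[lebesgue_tuple N]_t complex.Re (f (row_of_tuple t))) +i*
  (\int[lebesgue_tuple N]_t complex.Im (f (row_of_tuple t))).

Definition dotrv (x y : RN) : R := \sum_i x 0 i * y 0 i.

(* e^{i t} *)
Definition cis (t : R) : R[i] := cos t +i* sin t.

Definition fourier f : RN -> R[i]^o :=
  fun xi => cintegral (fun x => f x * cis (- dotrv x xi)).

Lemma smooth_real_comb (a b : R) g h (s : seq 'I_N) :
  smooth_real g -> smooth_real h ->
  partials s (a *: g + b *: h) = a *: partials s g + b *: partials s h.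
Proof.
move=> sg sh; elim: s => [//|i s IHs] /=; rewrite -/(partials _ _) IHs.
apply/funext => x; have [_ dg] := sg s; have [_ dh] := sh s.
have da := @derivableZ _ _ _ _ a _ _ (dg x i).
have db := @derivableZ _ _ _ _ b _ _ (dh x i).
by rewrite (deriveD da db) (deriveZ _ (dg x i)) (deriveZ _ (dh x i)).
Qed.

Lemma smooth_realD (a b : R) g h :
  smooth_real g -> smooth_real h -> smooth_real (a *: g + b *: h).
Proof.
move=> sg sh s; rewrite smooth_real_comb//; have [cg dg] := sg s.
have [ch dh] := sh s; split=> [x|x i].
  change {for x, continuous (fun y => a * partials s g y + b * partials s h y)}.
  apply: continuousD; apply: continuousM; do ?exact: cst_continuous.
    exact: cg.
  exact: ch.
by apply: derivableD; apply: derivableZ; [exact: dg|exact: dh].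
Qed.

Lemma partials0 s : partials s (0 : RN -> R) = 0.
Proof.
elim: s => [//|i s IHs] /=; rewrite -/(partials _ _) IHs.
by apply/funext => x; rewrite derive_cst.
Qed.

Lemma smooth_real0 : smooth_real 0.
Proof.
move=> s; rewrite partials0; split=> [x|x i]; first exact: cst_continuous.
exact: derivable_cst.
Qed.

Lemma Re_comb (c : R[i]) f f' : @complex.Re R \o (c *: f + f') =
  1 *: (complex.Re c *: (@complex.Re R \o f) +
        (- complex.Im c) *: (@complex.Im R \o f)) + 1 *: (@complex.Re R \o f').
Proof.
apply/funext => x; rewrite !scale1r.
change (complex.Re (c * f x + f' x) = complex.Re c * complex.Re (f x) +
  (- complex.Im c) * complex.Im (f x) + complex.Re (f' x)).
by case: c (f x) (f' x) => [a b] [u v] [w z] /=; rewrite mulNr.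
Qed.

Lemma Im_comb (c : R[i]) f f' : @complex.Im R \o (c *: f + f') =
  1 *: (complex.Re c *: (@complex.Im R \o f) +
        complex.Im c *: (@complex.Re R \o f)) + 1 *: (@complex.Im R \o f').
Proof.
apply/funext => x; rewrite !scale1r.
change (complex.Im (c * f x + f' x) = complex.Re c * complex.Im (f x) +
  complex.Im c * complex.Re (f x) + complex.Im (f' x)).
by case: c (f x) (f' x) => [a b] [u v] [w z] /=.
Qed.

Lemma smooth0 : smooth 0.
Proof. by split; exact: smooth_real0. Qed.

Lemma smooth_comb (c : R[i]) f f' :
  smooth f -> smooth f' -> smooth (c *: f + f').
Proof.
move=> [fr fi] [fr' fi']; split; rewrite (Re_comb, Im_comb).
  by apply: smooth_realD => //; exact: smooth_realD.
by apply: smooth_realD => //; exact: smooth_realD.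
Qed.

Lemma mderiv_comb a (c : R[i]) f f' x : smooth f -> smooth f' ->
  mderiv a (c *: f + f') x = c * mderiv a f x + mderiv a f' x.
Proof.
move=> [fr fi] [fr' fi']; rewrite /mderiv Re_comb Im_comb.
have sR : smooth_real (complex.Re c *: (@complex.Re R \o f) +
  (- complex.Im c) *: (@complex.Im R \o f)) by exact: smooth_realD.
have sI : smooth_real (complex.Re c *: (@complex.Im R \o f) +
  complex.Im c *: (@complex.Re R \o f)) by exact: smooth_realD.
rewrite !smooth_real_comb// !scale1r.
set u := partials _ _; set v := partials _ (_ \o f).
set w := partials _ _; set z := partials _ _.
rewrite /mderiv -/u -/v -/w -/z.
change ((complex.Re c * u x + - complex.Im c * v x + w x) +i*
  (complex.Re c * v x + complex.Im c * u x + z x) =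
  c * (u x +i* v x) + (w x +i* z x)).
by case: c {sR sI} => a' b' /=; rewrite mulNr.
Qed.

Lemma mderiv0 a x : mderiv a 0 x = 0.
Proof.
rewrite /mderiv (_ : @complex.Re R \o 0 = 0)// (_ : @complex.Im R \o 0 = 0)//.
by rewrite partials0.
Qed.

Lemma L1_0 : L1 0.
Proof. by split; exact: integrable0. Qed.

Let integrable_comb (a b : R) (u v : N.-tuple (measurableTypeR R) -> R) :
  (lebesgue_tuple N).-integrable setT (EFin \o u) ->
  (lebesgue_tuple N).-integrable setT (EFin \o v) ->
  (lebesgue_tuple N).-integrable setT (EFin \o (a *: u + b *: v)).
Proof.
move=> iu iv; have /= := integrableD measurableT
  (integrableZl measurableT a iu) (integrableZl measurableT b iv).
by apply: eq_integrable => // t _; rewrite /= EFinD !EFinM.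
Qed.

Let Rintegral_comb (a b : R) (u v : N.-tuple (measurableTypeR R) -> R) :
  (lebesgue_tuple N).-integrable setT (EFin \o u) ->
  (lebesgue_tuple N).-integrable setT (EFin \o v) ->
  \int[lebesgue_tuple N]_t (a *: u + b *: v) t =
  a * (\int[lebesgue_tuple N]_t u t) + b * (\int[lebesgue_tuple N]_t v t).
Proof.
move=> iu iv.
rewrite -(RintegralZl a measurableT iu) -(RintegralZl b measurableT iv).
rewrite -RintegralD//.
  exact: (integrableZl measurableT a iu).
exact: (integrableZl measurableT b iv).
Qed.

Lemma L1_comb (c : R[i]) f f' : L1 f -> L1 f' -> L1 (c *: f + f').
Proof.
move=> [fr fi] [fr' fi']; split.
  rewrite Re_comb; apply: (integrable_comb 1 1) fr'.
  exact: (integrable_comb (complex.Re c) (- complex.Im c) fr fi).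
rewrite Im_comb; apply: (integrable_comb 1 1) fi'.
exact: (integrable_comb (complex.Re c) (complex.Im c) fi fr).
Qed.

Lemma cintegral_comb (c : R[i]) f f' : L1 f -> L1 f' ->
  cintegral (c *: f + f') = c * cintegral f + cintegral f'.
Proof.
move=> [fr fi] [fr' fi']; rewrite /cintegral.
have := Re_comb c f f'; have := Im_comb c f f'.
move=> /(congr1 (fun u => u \o row_of_tuple)) EI.
move=> /(congr1 (fun u => u \o row_of_tuple)) ER.
have iR := integrable_comb (complex.Re c) (- complex.Im c) fr fi.
have iI := integrable_comb (complex.Re c) (complex.Im c) fi fr.
have := Rintegral_comb 1 1 iR fr'; have := Rintegral_comb 1 1 iI fi'.
have -> := Rintegral_comb (complex.Re c) (complex.Im c) fi fr.
have -> := Rintegral_comb (complex.Re c) (- complex.Im c) fr fi.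
rewrite !mul1r => hI hR.
move: hR hI; rewrite -[X in Rintegral _ _ X = _ -> _]ER.
rewrite -[X in _ -> Rintegral _ _ X = _ -> _]EI => hR hI.
rewrite [X in X +i* _]hR [X in _ +i* X]hI.
by case: c {EI ER hI hR iR iI} => a b /=; rewrite mulNr.
Qed.

Let measurable_phase xi : measurable_fun setT
  (fun t : N.-tuple (measurableTypeR R) => - dotrv (row_of_tuple t) xi).
Proof.
apply: measurable_funN; apply: measurable_sum => i.
apply: measurable_funM; last exact: measurable_cst.
rewrite (_ : (fun _ => _) = fun t => tnth t i); first exact: measurable_tnth.
by apply/funext => t; rewrite mxE.
Qed.

Let integrable_mul_bounded (u v : N.-tuple (measurableTypeR R) -> R) :
  measurable_fun setT v -> (forall t, `|v t| <= 1) ->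
  (lebesgue_tuple N).-integrable setT (EFin \o u) ->
  (lebesgue_tuple N).-integrable setT (EFin \o (u \* v)).
Proof.
move=> mv bv iu; have /= := @integrableMl _ _ _ _ _ measurableT _ _ iu mv.
have bb : [bounded v x | x in setT].
  exists 1; split; first exact: num_real.
  by move=> M M1 t _ /=; apply: le_trans (bv t) (ltW M1).
by move=> /(_ bb); apply: eq_integrable => // t _; rewrite /= EFinM.
Qed.

Lemma L1_phase xi f : L1 f -> L1 (fun x => f x * cis (- dotrv x xi)).
Proof.
move=> [fr fi].
have mc : measurable_fun setT (fun t : N.-tuple (measurableTypeR R) =>
    cos (- dotrv (row_of_tuple t) xi)).
  apply: (@measurableT_comp _ _ _ _ _ _ (@cos R)) (measurable_phase xi).
  by apply: continuous_measurable_fun; exact: continuous_cos.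
have ms : measurable_fun setT (fun t : N.-tuple (measurableTypeR R) =>
    sin (- dotrv (row_of_tuple t) xi)).
  apply: (@measurableT_comp _ _ _ _ _ _ (@sin R)) (measurable_phase xi).
  by apply: continuous_measurable_fun; exact: continuous_sin.
have bc t : `|cos (- dotrv (row_of_tuple t) xi)| <= 1 :> R.
  by rewrite ler_norml cos_geN1 cos_le1.
have bs t : `|sin (- dotrv (row_of_tuple t) xi)| <= 1 :> R.
  by rewrite ler_norml sin_geN1 sin_le1.
have /= i1 := integrable_mul_bounded mc bc fr.
have /= i2 := integrable_mul_bounded ms bs fr.
have /= i3 := integrable_mul_bounded mc bc fi.
have /= i4 := integrable_mul_bounded ms bs fi.
split.
  have := integrable_comb 1 (-1) i1 i4; apply: eq_integrable => // t _.
  rewrite scale1r scaleN1r; set r := row_of_tuple t.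
  change ((complex.Re (f r) * cos (- dotrv r xi) -
           complex.Im (f r) * sin (- dotrv r xi))%:E =
          (complex.Re (f r * cis (- dotrv r xi)))%:E).
  by rewrite /cis; case: (f r).
have := integrable_comb 1 1 i2 i3; apply: eq_integrable => // t _.
rewrite !scale1r; set r := row_of_tuple t.
change ((complex.Re (f r) * sin (- dotrv r xi) +
         complex.Im (f r) * cos (- dotrv r xi))%:E =
        (complex.Im (f r * cis (- dotrv r xi)))%:E).
by rewrite /cis; case: (f r).
Qed.

Lemma fourier_comb (c : R[i]) f f' : L1 f -> L1 f' ->
  fourier (c *: f + f') = c *: fourier f + fourier f'.
Proof.
move=> lf lf'; apply/funext => xi; rewrite /fourier.
have := cintegral_comb c (L1_phase xi lf) (L1_phase xi lf').
move=> E; rewrite -[RHS]E; congr cintegral; apply/funext => x.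
change ((c * f x + f' x) * cis (- dotrv x xi) =
  c * (f x * cis (- dotrv x xi)) + f' x * cis (- dotrv x xi)).
by rewrite mulrDl mulrA.
Qed.

Lemma fourier0 : fourier 0 = 0.
Proof. by have := fourier_comb (-1) L1_0 L1_0; rewrite !scaleN1r !addNr. Qed.

End Functions.
Arguments multi_index N : clear implicits.

Record nqa_weight (R : realType) := NqaWeight {
  weight :> R -> R;
  weight_ge0 : forall t, 0 <= t -> 0 <= weight t;
  weight_nondecreasing : forall s t, 0 <= s -> s <= t -> weight s <= weight t;
  weight_continuous : {within `[0, +oo[, continuous weight};
  weight_alpha : exists2 K : R, 1 <= K &
    forall t, 0 <= t -> weight (2 * t) <= K * (1 + weight t);
  weight_beta :
    (\int[lebesgue_measure]_(t in `[1%R, +oo[)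
       (weight t / (1 + t ^+ 2))%:E < +oo)%E;
  weight_gamma : exists a b : R, 0 < b /\
    forall t, 0 <= t -> a + b * ln (1 + t) <= weight t;
  weight_delta : convex_function (setT : set R^o) (fun t => weight (expR t));
  weight_01 : forall t, 0 <= t <= 1 -> weight t = 0
}.

Section Spaces.
Context {R : realType} (omega : nqa_weight R) (N : nat).
Local Notation RN := 'rV[R]_N.
Local Notation F := (RN -> R[i]^o).
Implicit Types (f : F) (a : multi_index N).

Definition young_conj (s : R) : \bar R :=
  ereal_sup [set (s * t - omega (expR t))%:E | t in [set t : R | 0 <= t]].

Definition weightN (x : RN) : R := omega (euclid_norm x).

Definition young_weight (k : int) (m : nat) a (x : RN) : \bar R :=
  (expeR ((k%:~R * weightN x)%:E -
          m%:R%:E * young_conj ((mi_order a)%:R / m%:R)))%E.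

(* The common shape of the norms: q_{m,m} has k = m and r_{m,n} has k = -n. *)
Definition weighted_sup (k : int) (m : nat) f : \bar R :=
  ereal_sup [set ((Normc.normc (mderiv p.1 f p.2))%:E *
                  young_weight k m p.1 p.2)%E
    | p in [set: multi_index N * RN]].

Definition q_norm (m : nat) f : \bar R := weighted_sup m%:Z m f.
Definition r_norm (m : nat) (n : int) f : \bar R := weighted_sup (- n) m f.

(* Common balls for the first k of the norms p_1, p_2, ... *)
Definition multiball (p : nat -> F -> \bar R) (k : nat) (e : R) : set F :=
  [set f | forall m, (0 < m <= k)%N -> (p m f < e%:E)%E].

Definition weighted_bounded f : Prop :=
  forall (l : R) a, 0 < l -> exists C : R, forall x,
    expR (l * weightN x) * Normc.normc (mderiv a f x) <= C.

Definition in_S : {pred F} := mem [set f : F |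
  [/\ L1 f, smooth f, smooth (fourier f),
      weighted_bounded f & weighted_bounded (fourier f)]].

(* The projective limit over m of the spaces O^m_{n,omega}. *)
Definition in_OCn (n : nat) f : Prop :=
  smooth f /\ forall m, (0 < m)%N -> (r_norm m n f < +oo)%E.

Definition in_OC : {pred F} := mem [set f : F |
  exists2 n, (0 < n)%N & in_OCn n f].

Lemma weighted_bounded_comb (c : R[i]) f f' : smooth f -> smooth f' ->
  weighted_bounded f -> weighted_bounded f' -> weighted_bounded (c *: f + f').
Proof.
move=> sf sf' bf bf' l a l0; have [C HC] := bf l a l0.
have [C' HC'] := bf' l a l0; exists (Normc.normc c * C + C') => x.
rewrite mderiv_comb//; apply: le_trans
  (_ : Normc.normc c * (expR (l * weightN x) * Normc.normc (mderiv a f x)) +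
       expR (l * weightN x) * Normc.normc (mderiv a f' x) <= _).
  rewrite mulrCA -mulrDr ler_wpM2l ?expR_ge0// -Normc.normcM.
  exact: le_normcD.
apply: lerD => //; apply: ler_wpM2l => //.
by case: (c) => u v; rewrite sqrtr_ge0.
Qed.

Lemma in_S_submod_closed : submod_closed in_S.
Proof.
split=> [|c f f'].
  rewrite inE; split; rewrite ?fourier0.
  - exact: L1_0.
  - exact: smooth0.
  - exact: smooth0.
  - by move=> l a l0; exists 0 => x; rewrite mderiv0 Normc.normc0 mulr0.
  - by move=> l a l0; exists 0 => x; rewrite mderiv0 Normc.normc0 mulr0.
rewrite !inE => -[f1 f2 f3 f4 f5] [g1 g2 g3 g4 g5].
split; rewrite ?fourier_comb//.
- exact: L1_comb.
- exact: smooth_comb.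
- exact: smooth_comb.
- exact: weighted_bounded_comb.
- exact: weighted_bounded_comb.
Qed.

Lemma weighted_sup_lty k m f : (weighted_sup k m f < +oo)%E <->
  exists C : R, forall a x,
    ((Normc.normc (mderiv a f x))%:E * young_weight k m a x <= C%:E)%E.
Proof.
split=> [fin|[C HC]]; last first.
  apply: le_lt_trans (ltry C); apply: ub_ereal_sup => _ [[a x] _ <-] /=.
  exact: HC.
have ub a x : ((Normc.normc (mderiv a f x))%:E * young_weight k m a x <=
    weighted_sup k m f)%E by apply: ereal_sup_ubound; exists (a, x).
case E : (weighted_sup k m f) fin ub => [r| |] // _ ub; first by exists r.
by exists 0 => a x; apply: le_trans (ub a x) _; rewrite leNye.
Qed.

Lemma r_norm_comb m n (c : R[i]) f f' : smooth f -> smooth f' ->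
  (r_norm m n f < +oo)%E -> (r_norm m n f' < +oo)%E ->
  (r_norm m n (c *: f + f')%R < +oo)%E.
Proof.
move=> sf sf' /weighted_sup_lty[C HC] /weighted_sup_lty[C' HC'].
apply/weighted_sup_lty; exists (Normc.normc c * C + C') => a x.
have w0 : (0 <= young_weight (- n) m a x)%E by exact: expeR_ge0.
have n0 (z : R[i]) : 0 <= Normc.normc z by case: z => u v; rewrite sqrtr_ge0.
rewrite mderiv_comb//; apply: (@le_trans _ _ ((Normc.normc c)%:E *
    ((Normc.normc (mderiv a f x))%:E * young_weight (- n) m a x) +
    (Normc.normc (mderiv a f' x))%:E * young_weight (- n) m a x)%E).
  rewrite muleA -EFinM -ge0_muleDl ?lee_fin ?mulr_ge0//.
  by rewrite lee_wpmul2r// -EFinD lee_fin -Normc.normcM; exact: le_normcD.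
by rewrite EFinD EFinM leeD// lee_wpmul2l// lee_fin.
Qed.

Lemma in_OCn_le n n' f : (n <= n')%N -> in_OCn n f -> in_OCn n' f.
Proof.
move=> nn' [sf rf]; split=> // m m0; apply: le_lt_trans (rf m m0).
apply: ge_ereal_sup => _ [[a x] _ <-] /=.
apply: (@le_trans _ _ ((Normc.normc (mderiv a f x))%:E *
    young_weight (- n%:Z) m a x)%E);
  last by apply: ereal_sup_ubound; exists (a, x).
apply: lee_wpmul2l.
  by rewrite lee_fin; case: (mderiv a f x) => u v; rewrite sqrtr_ge0.
rewrite lee_expeR leeD2r// lee_fin ler_wpM2r//.
  exact/weight_ge0/sqrtr_ge0.
by rewrite ler_int lerN2 lez_nat.
Qed.

Lemma in_OC_submod_closed : submod_closed in_OC.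
Proof.
split=> [|c f f'].
  rewrite inE; exists 1%N => //; split=> [|m m0]; first exact: smooth0.
  apply/weighted_sup_lty; exists 0 => a x.
  by rewrite mderiv0 Normc.normc0 mul0e.
rewrite !inE => -[n n0 fn] [n' n0' fn']; exists (maxn n n').
  by rewrite leq_max n0.
have [sf rf] := in_OCn_le (leq_maxl n n') fn.
have [sf' rf'] := in_OCn_le (leq_maxr n n') fn'.
split=> [|m m0]; first exact: smooth_comb.
by apply: r_norm_comb; [| |exact: rf|exact: rf'].
Qed.

HB.instance Definition _ :=
  GRing.isSubmodClosed.Build R[i] F in_S in_S_submod_closed.
HB.instance Definition _ :=
  GRing.isSubmodClosed.Build R[i] F in_OC in_OC_submod_closed.

Record Sw := MkSw { Sw_fun :> F; _ : Sw_fun \in in_S }.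
HB.instance Definition _ := [isSub for Sw_fun].
HB.instance Definition _ := [Choice of Sw by <:].
HB.instance Definition _ := [SubChoice_isSubLmodule of Sw by <:].

Record OC := MkOC { OC_fun :> F; _ : OC_fun \in in_OC }.
HB.instance Definition _ := [isSub for OC_fun].
HB.instance Definition _ := [Choice of OC by <:].
HB.instance Definition _ := [SubChoice_isSubLmodule of OC by <:].

(* The topology generated by the norms q_{m,m}, m >= 1. *)
Definition Sw_open (U : set Sw) : Prop :=
  forall f : Sw, U f -> exists k (e : R), 0 < e /\
    forall g : Sw, multiball q_norm k e (g - f) -> U g.

Lemma multiball_le p k k' e e' :
  (k <= k')%N -> e' <= e -> multiball p k' e' `<=` multiball p k e.
Proof.
move=> kk ee f H m /andP[m0 mk].
by apply: (lt_le_trans (H m _)); rewrite ?lee_fin// m0 (leq_trans mk).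
Qed.

Let Sw_openT : Sw_open setT.
Proof. by move=> f _; exists 0%N, 1; split. Qed.

Let Sw_openI : setI_closed Sw_open.
Proof.
move=> U V oU oV f [/oU[k [e [e0 He]]] /oV[k' [e' [e0' He']]]].
exists (maxn k k'), (Num.min e e'); split; first by rewrite lt_min e0.
move=> g H; split.
  by apply: He; apply: multiball_le H; rewrite ?leq_maxl// ge_min lexx.
by apply: He'; apply: multiball_le H; rewrite ?leq_maxr// ge_min lexx orbT.
Qed.

Let Sw_open_bigcup (I : Type) (U : I -> set Sw) :
  (forall i, Sw_open (U i)) -> Sw_open (\bigcup_i U i).
Proof.
move=> oU f [i _ /oU[k [e [e0 He]]]]; exists k, e; split=> // g /He Ug.
by exists i.
Qed.

HB.instance Definition _ :=
  isOpenTopological.Build Sw Sw_openT Sw_openI Sw_open_bigcup.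

Definition absconvex (V : set OC) : Prop :=
  forall (a b : R[i]) (f g : OC),
    `|a| + `|b| <= 1 -> V f -> V g -> V (a *: f + b *: g).

(* Locally convex inductive limit: a basis of neighbourhoods of 0 is given by
   the absolutely convex sets whose trace on each step n >= 1 is a
   neighbourhood of 0 in proj_m O^m_{n,omega}. *)
Definition OC_nbhs0 (V : set OC) : Prop :=
  absconvex V /\ forall n, (0 < n)%N -> exists k (e : R), 0 < e /\
    forall g : OC, in_OCn n g -> multiball (fun m => r_norm m n) k e g -> V g.

Definition OC_open (U : set OC) : Prop :=
  forall f : OC, U f -> exists2 V, OC_nbhs0 V & forall g : OC, V g -> U (f + g).

Let OC_openT : OC_open setT.
Proof.
move=> f _; exists setT => //; split=> // n _.
by exists 0%N, 1; split.
Qed.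

Let OC_openI : setI_closed OC_open.
Proof.
move=> U U' oU oU' f [/oU[V [cV nV] HV] /oU'[V' [cV' nV'] HV']].
exists (V `&` V'); last by move=> g [/HV Ug /HV' Ug'].
split=> [a b u v ab [Vu Vu'] [Vv Vv']|n n0].
  by split; [exact: cV|exact: cV'].
have [k [e [e0 He]]] := nV n n0; have [k' [e' [e0' He']]] := nV' n n0.
exists (maxn k k'), (Num.min e e'); split; first by rewrite lt_min e0.
move=> g gn H; split.
  by apply: He => //; apply: multiball_le H; rewrite ?leq_maxl// ge_min lexx.
apply: He' => //.
by apply: multiball_le H; rewrite ?leq_maxr// ge_min lexx orbT.
Qed.

Let OC_open_bigcup (I : Type) (U : I -> set OC) :
  (forall i, OC_open (U i)) -> OC_open (\bigcup_i U i).
Proof.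
move=> oU f [i _ /oU[V nV HV]]; exists V => // g /HV Ug.
by exists i.
Qed.

HB.instance Definition _ :=
  isOpenTopological.Build OC OC_openT OC_openI OC_open_bigcup.

Implicit Types (T : OC -> R[i]^o) (S : Sw -> R[i]^o).

(* <T, g> and <S, g> for a function g; for linear functionals the value is 0
   if g is not in the space on which the functional is defined. *)
Definition OC_pairing T (g : F) : R[i] := T (insubd (0 : OC) g).
Definition Sw_pairing S (g : F) : R[i] := S (insubd (0 : Sw) g).

(* The image of T in S'_omega under the inclusion of S_omega in O_{C,omega}. *)
Definition OC_restrict T : Sw -> R[i]^o := fun f : Sw => OC_pairing T f.

Definition star S (f : F) : F := fun x => Sw_pairing S (fun y => f (x - y)).

Definition reflect_dual S : Sw -> R[i]^o :=
  fun f : Sw => Sw_pairing S (fun x => f (- x)).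

Definition convolution T S : Sw -> R[i]^o :=
  fun f : Sw => Sw_pairing S (star (reflect_dual (OC_restrict T)) f).

End Spaces.

(* Main.v *)
(* Write G m k = exp (- m phi^* (k / m)) and W for the weight on R^N. The key step is
   that a function belongs to S_omega exactly if all its derivatives satisfy
   |d^a f| exp (m W) G m |a| <= C_m, with C_m independent of a. From the decay of f
   and of its Fourier transform, a Poisson mean bounds |d^a f| G m |a|, and
   interpolation between this bound and the decay of f (Taylor polynomials along
   the half lines on which W increases) gives the weighted bound. Conversely, the
   Fourier transform inherits its decay through integration by parts, because
   phi^** = phi.

   The function to which S is applied is (check T * f)(x) = <T, f(x + .)>. Its
   derivatives are obtained by differentiating f, and continuity of T on one step of
   the inductive limit, together with W (x) <= L (1 + W (x + y) + W (y)), bounds the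
   norms of check T * f by those of f. So f |-> check T * f is a continuous
   endomorphism of S_omega, and the operator S |-> T * S is its transpose, which is
   continuous for the strong topology because bounded sets are mapped to bounded
   sets. *)
From HB Require Import structures.
From mathcomp Require Import all_boot all_order all_algebra.
From mathcomp Require Import all_classical all_reals all_analysis.
From mathcomp Require Import measurable_realfun complex.
From mathcomp Require Import ring lra zify.
Require Import Defs.

Set Implicit Arguments.
Unset Strict Implicit.
Unset Printing Implicit Defensive.
Import Order.TTheory GRing.Theory Num.Theory.
Import numFieldNormedType.Exports.
Local Open Scope classical_set_scope.
Local Open Scope ring_scope.

(** * The weight and its Young conjugate *)

(** The definition of S_omega bounds every derivative with a constant of its own, while the norms
    need one constant for all orders. The Fourier side supplies this uniformity, because a monomial
    of degree k times [G m k] is at most [exp (m W)]. Interpolation must then keep its constants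
    exponential, not factorial, in the order: by condition (alpha), [G m k] absorbs [A ^ k] at the
    price of a larger index [m]. Estimates may enlarge the index freely, since every index is
    available.

    Condition (gamma) admits weights as small as a logarithm, for which the Young conjugate takes
    the value infinity and [G m k] is 0. Bounds are therefore products with [G], and the case 0 is
    split off wherever a division is needed.

    Transforms are handled as cosine integrals with a phase, and derivatives of integrals and of
    functionals through remainders of order [h ^ 2]. *)

Section WeightFunction.
Context {R : realType} (omega : nqa_weight R).

(** Iterates condition (alpha) up to a power of 2 above [A]. The constant is a natural number so
    that it can multiply the index of a norm. *)
Lemma weight_dilation (A : R) : 1 <= A ->
  exists2 L : nat, (0 < L)%N &
    forall t, 0 <= t -> omega (A * t) <= L%:R * (1 + omega t).
Proof.
move=> A1; have [K K1 HK] := weight_alpha omega.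
have pow n : exists2 L : R, 0 <= L &
    forall t, 0 <= t -> omega (2 ^+ n * t) <= L * (1 + omega t).
  elim: n => [|n [L L0 HL]].
    exists 1 => // t t0; rewrite expr0 !mul1r lerDr//.
  exists (K * (1 + L)) => [|t t0]; first by rewrite mulr_ge0 ?addr_ge0// (le_trans _ K1).
  rewrite exprS -mulrA; apply: le_trans (HK _ _) _; first by rewrite mulr_ge0// exprn_ge0.
  rewrite -mulrA ler_wpM2l ?(le_trans _ K1)//.
  rewrite mulrDl mul1r lerD//; last exact: HL.
  by rewrite lerDl weight_ge0.
have [L L0 HL] := pow (Num.truncn A).+1.
exists (Num.truncn L).+1 => // t t0.
have h : A * t <= 2 ^+ (Num.truncn A).+1 * t.
  apply: ler_wpM2r => //; apply: le_trans (ltW (truncnS_gt A)) _.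
  by rewrite -natrX ler_nat ltnW// ltn_expl.
apply: le_trans (weight_nondecreasing _ _ h) _; first by rewrite mulr_ge0// (le_trans _ A1).
apply: le_trans (HL _ t0) _; apply: ler_wpM2r; first by rewrite addr_ge0// weight_ge0.
exact: ltW (truncnS_gt L).
Qed.

Lemma weight_log_lb : exists a b : R, 0 < b /\
  forall t, 0 <= t -> a + b * t <= omega (expR t).
Proof.
have [a [b [b0 H]]] := weight_gamma omega; exists a, b; split => // t t0.
apply: le_trans (H _ (expR_ge0 t)); rewrite lerD2l ler_wpM2l ?(ltW b0)//.
rewrite -{1}(expRK t) ler_ln ?posrE ?expR_gt0 ?addr_gt0 ?expR_gt0//.
by rewrite lerDr.
Qed.

(* [exp (- m phi^* (k / m))], written without extended reals. *)
Definition decay (m k : nat) : R :=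
  inf [set expR (m%:R * omega (expR t) - k%:R * t) | t in [set t : R | 0 <= t]].

Let dset m k := [set expR (m%:R * omega (expR t) - k%:R * t) | t in [set t : R | 0 <= t]].

Let dset_inf m k : has_inf (dset m k).
Proof.
split; first by exists (expR (m%:R * omega (expR 0) - k%:R * 0)); exists 0 => /=.
by exists 0 => _ [t _ <-]; exact: expR_ge0.
Qed.

Lemma decay_le m k t : 0 <= t -> decay m k <= expR (m%:R * omega (expR t) - k%:R * t).
Proof. by move=> t0; apply: ge_inf; [case: (dset_inf m k)|exists t]. Qed.

Lemma le_decay m k c :
  (forall t, 0 <= t -> c <= expR (m%:R * omega (expR t) - k%:R * t)) -> c <= decay m k.
Proof.
move=> H; apply: lb_le_inf; first by case: (dset_inf m k).
by move=> _ [t t0 <-]; exact: H.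
Qed.

Lemma decay_ge0 m k : 0 <= decay m k.
Proof. by apply: le_decay => t _; exact: expR_ge0. Qed.

Lemma omega1 : omega 1 = 0.
Proof. by apply: weight_01; rewrite ler01 lexx. Qed.

Lemma decay_le1 m k : decay m k <= 1.
Proof.
by have := decay_le m k (lexx 0); rewrite expR0 omega1 !mulr0 subr0 expR0.
Qed.

Let omega_expR_ge0 t : 0 <= omega (expR t).
Proof. exact/weight_ge0/expR_ge0. Qed.

Lemma decay_mono m m' k : (m <= m')%N -> decay m k <= decay m' k.
Proof.
move=> mm; apply: le_decay => t t0; apply: le_trans (decay_le m k t0) _.
by rewrite ler_expR lerD2r ler_wpM2r// ler_nat.
Qed.

Lemma decay_m0 m : decay m 0 = 1.
Proof.
apply/eqP; rewrite eq_le decay_le1; apply: le_decay => t t0.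
by rewrite mul0r subr0 -expR0 ler_expR mulr_ge0.
Qed.

(** The infimum for [j + k] is tested at the larger of the two points: there both powers gain, and
    the weight at the smaller point is nonnegative. *)
Lemma decayD_le m j k : decay m (j + k) <= decay m j * decay m k.
Proof.
have H t t' : 0 <= t -> 0 <= t' -> decay m (j + k) <=
   expR (m%:R * omega (expR t) - j%:R * t) * expR (m%:R * omega (expR t') - k%:R * t').
  move=> t0 t'0; rewrite -expRD.
  case: (leP t t') => tt.
    apply: le_trans (decay_le _ _ t'0) _; rewrite ler_expR natrD mulrDl.
    have : j%:R * t <= j%:R * t' by rewrite ler_wpM2l.
    have : 0 <= m%:R * omega (expR t) by rewrite mulr_ge0.
    lra.
  apply: le_trans (decay_le _ _ t0) _; rewrite ler_expR natrD mulrDl.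
  have : k%:R * t' <= k%:R * t by rewrite ler_wpM2l// ltW.
  have : 0 <= m%:R * omega (expR t') by rewrite mulr_ge0.
  lra.
have step t' : 0 <= t' ->
    decay m (j + k) <= decay m j * expR (m%:R * omega (expR t') - k%:R * t').
  move=> t'0; rewrite -ler_pdivrMr ?expR_gt0//; apply: le_decay => t t0.
  by rewrite ler_pdivrMr ?expR_gt0//; exact: H.
(* [decay m j] is 0 when the conjugate is infinite, and then it cannot be divided out. *)
have [j0|j0] := eqVneq (decay m j) 0.
  by have := step 0 (lexx 0); rewrite j0 !mul0r.
have dj : 0 < decay m j by rewrite lt_neqAle eq_sym j0 decay_ge0.
rewrite -ler_pdivrMl//; apply: le_decay => t' t'0.
by rewrite ler_pdivrMl//; exact: step.
Qed.

(** Both infima are tested at the same point, where the exponents add up. This is the converse of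
    [decayD_le] at the price of a doubled index. *)
Lemma decayM_le m j k : decay m j * decay m k <= decay (m * 2) (j + k).
Proof.
apply: le_decay => t t0.
apply: le_trans (ler_pM (decay_ge0 _ _) (decay_ge0 _ _) (decay_le m j t0) (decay_le m k t0)) _.
by rewrite -expRD ler_expR natrM natrD; lra.
Qed.

(** Shifting the point of the infimum by [ln A] produces the factor [A ^- k] and replaces
    [omega (e^t)] by [omega (A e^t)], which (alpha) controls. Constants that are exponential in the
    order of differentiation are absorbed in this way. *)
Lemma decay_geometric (A : R) m : 1 <= A ->
  exists2 m' : nat, (m <= m')%N & exists2 C : R, 0 < C &
    forall k, A ^+ k * decay m k <= C * decay m' k.
Proof.
move=> A1; have [L L0 HL] := weight_dilation A1.
exists (m * L)%N; first by rewrite leq_pmulr.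
exists (expR (m * L)%:R); first exact: expR_gt0.
move=> k; rewrite -ler_pdivrMl ?expR_gt0//; apply: le_decay => t t0.
rewrite ler_pdivrMl ?expR_gt0// -expRD.
have A0 : 0 < A by apply: lt_le_trans A1.
have lA : 0 <= ln A by rewrite ln_ge0.
have := decay_le m k (addr_ge0 lA t0).
rewrite [expR (ln A + t)]expRD lnK ?posrE// => h.
apply: le_trans (ler_wpM2l (exprn_ge0 _ (ltW A0)) h) _.
rewrite -{1}(@lnK _ A) ?posrE// -expRM_natl -expRD ler_expR.
have := ler_wpM2l (ler0n R m) (HL (expR t) (expR_ge0 _)).
rewrite natrM; lra.
Qed.

(** By (gamma), [m omega (e^t)] outgrows [k t] once [m b > k]; for smaller [m] the conjugate may be
    infinite. *)
Lemma decay_gt0 k : exists2 m : nat, (0 < m)%N & 0 < decay m k.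
Proof.
have [a [b [b0 H]]] := weight_log_lb.
have [m mk] : exists m : nat, k%:R / b < m%:R.
  by exists (Num.truncn (k%:R / b)).+1; exact: truncnS_gt.
exists m.
  by rewrite -(ltr_nat R); apply: le_lt_trans mk; rewrite divr_ge0// ltW.
apply: (lt_le_trans (expR_gt0 (m%:R * a))); apply: le_decay => t t0.
rewrite ler_expR.
have := ler_wpM2l (ler0n R m) (H t t0).
have : k%:R * t <= m%:R * b * t by rewrite ler_wpM2r// -ler_pdivrMr// ltW.
lra.
Qed.

(** The slopes of consecutive chords increase. The product form avoids quotients and includes
    [u = v]. *)
Lemma convex_secant (f : R -> R) :
    convex_function (setT : set R^o) f ->
  forall t u v : R, t < u -> u <= v -> (f u - f t) * (v - u) <= (f v - f u) * (u - t).
Proof.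
move=> cf t u v tu uv.
have tv : 0 < v - t by rewrite subr_gt0 (lt_le_trans tu).
pose p := (v - u) / (v - t).
have p01 : 0 <= p <= 1.
  by rewrite divr_ge0 ?subr_ge0 ?(ltW tu)// ?(le_trans (ltW tu) uv)//= ler_pdivrMr// mul1r lerD2l lerN2 ltW.
have p0 : 0 <= p by case/andP: p01.
have p1 : p <= 1 by case/andP: p01.
have := cf (Itv01 p0 p1) t v; rewrite !inE => /(_ Logic.I Logic.I).
rewrite /conv /= /unstable.onem => h.
have e : p *: (t : R^o) + (1 - p) *: (v : R^o) = u.
  rewrite /GRing.scale /= /p; field; lra.
have {h} h : f u <= p * f t + (1 - p) * f v by rewrite -{1}e.
have := ler_wpM2r (ltW tv) h.
have -> : (p * f t + (1 - p) * f v) * (v - t) = (v - u) * f t + (u - t) * f v.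
  rewrite /p; field; lra.
nra.
Qed.

(* The exponent [k = floor (m s)] for the slope [s] of a chord of the convex
   function [phi] starting at [ln t] nearly attains [phi^** = phi]; the slack
   [e^k] covers the chord itself. *)
Lemma decay_biconj (m : nat) (t : R) : 0 <= t ->
  exists k : nat, expR (m%:R * omega (expR t) - t) <= expR (k%:R * (t + 1)) * decay m k.
Proof.
move=> t0; pose phi t := omega (expR t).
pose s := phi (t + 1) - phi t.
have phi_mono x y : x <= y -> phi x <= phi y.
  by move=> xy; apply: weight_nondecreasing; rewrite ?expR_ge0// ler_expR.
have s0 : 0 <= m%:R * s by rewrite mulr_ge0// subr_ge0 phi_mono// lerDl.
exists (Num.truncn (m%:R * s)); set k := Num.truncn _.
have k1 : k%:R <= m%:R * s by rewrite truncn_le.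
have k2 : m%:R * s < k%:R + 1 by rewrite natr1; exact: truncnS_gt.
rewrite -ler_pdivrMl ?expR_gt0//; apply: le_decay => r r0.
rewrite ler_pdivrMl ?expR_gt0// -expRD ler_expR -/(phi _) -/(phi r).
have cphi := convex_secant (weight_delta omega).
have k0 : 0 <= k%:R :> R by [].
have m0 : 0 <= m%:R :> R by [].
have [rt|tr] := leP r t.
  have : s * (t - r) >= phi t - phi r.
    have [->|rt'] := eqVneq r t; first by lra.
    have := cphi r t (t + 1); rewrite lt_neqAle rt' rt lerDl ler01 => /(_ isT isT).
    rewrite -/(phi t) -/(phi r) -/(phi (t+1)) -/s; lra.
  move=> /(ler_wpM2l m0) h1.
  have h2 : (m%:R * s) * (t - r) <= (k%:R + 1) * (t - r).
    by apply: ler_wpM2r; [lra|exact: ltW].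
  have : 0 <= k%:R * 1 :> R by lra.
  rewrite -/(phi t); lra.
have [rt|tr1] := leP r (t + 1).
  have h1 : m%:R * phi t <= m%:R * phi r by rewrite ler_wpM2l// phi_mono// ltW.
  have h2 : 0 <= k%:R * (t + 1 - r) by rewrite mulr_ge0//; lra.
  rewrite -/(phi t); lra.
have h : s * (r - t) <= phi r - phi t.
  have := cphi t (t + 1) r; rewrite ltrDl ltr01 (ltW tr1) => /(_ isT isT).
  rewrite -/(phi t) -/(phi r) -/(phi (t+1)) -/s addrAC subrr add0r mulr1 => h.
  by rewrite /s in h *; lra.
have h1 := ler_wpM2l m0 h.
have h2 : k%:R * (r - t) <= m%:R * s * (r - t) by rewrite ler_wpM2r//; lra.
have h3 : 0 <= k%:R * 1 :> R by lra.
rewrite -/(phi t); lra.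
Qed.

End WeightFunction.

Section YoungWeight.
Context {R : realType} (omega : nqa_weight R).

Lemma decayE (m k : nat) : (0 < m)%N ->
  (decay omega m k)%:E = expeR (- (m%:R%:E * young_conj omega (k%:R / m%:R)))%E.
Proof.
move=> m0; have m0' : (0 : R) < m%:R by rewrite ltr0n.
have yc t : 0 <= t ->
    ((k%:R / m%:R * t - omega (expR t))%:E <= young_conj omega (k%:R / m%:R))%E.
  by move=> t0; apply: ereal_sup_ubound; exists t.
have ub : 0 < decay omega m k ->
    (young_conj omega (k%:R / m%:R) <= (- ln (decay omega m k) / m%:R)%:E)%E.
  move=> d0; apply: ge_ereal_sup => _ [t t0 <-]; rewrite lee_fin ler_pdivlMr//.
  have := decay_le omega m k t0; rewrite -ler_ln ?posrE ?expR_gt0// expRK.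
  have -> : (k%:R / m%:R * t - omega (expR t)) * m%:R = k%:R * t - m%:R * omega (expR t).
    by field; rewrite gt_eqF.
  lra.
case: (young_conj _ _) yc ub => [r| |] yc ub.
- rewrite -EFinM -EFinN /=; congr (_%:E); apply/eqP; rewrite eq_le; apply/andP; split.
    have [d0|d0] := leP (decay omega m k) 0; first exact: le_trans d0 (expR_ge0 _).
    have := ub d0; rewrite lee_fin ler_pdivlMr// => h.
    by rewrite -[leLHS]lnK ?posrE// ler_expR; lra.
  apply: le_decay => t t0; rewrite ler_expR.
  have := yc t t0; rewrite lee_fin => /(ler_wpM2l (ltW m0')).
  rewrite mulrBr mulrA mulrCA divff ?mulr1 ?gt_eqF//; lra.
(* Infinite conjugate: the right-hand side is 0, and so is [decay], since by [ub] a positive value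
   would bound the conjugate. *)
- rewrite gt0_muley ?lte_fin//=; congr (_%:E).
  have [d0|d0] := leP (decay omega m k) 0.
    by apply/eqP; rewrite eq_le d0 decay_ge0.
  by have := ub d0; rewrite leye_eq.
- by have := yc 0 (lexx 0); rewrite leeNy_eq.
Qed.

Lemma young_weightE N (k : int) (m : nat) (a : multi_index N) x : (0 < m)%N ->
  young_weight omega k m a x =
  (expR (k%:~R * weightN omega x) * decay omega m (mi_order a))%:E.
Proof.
by move=> m0; rewrite /young_weight expeRD [in RHS]EFinM decayE.
Qed.

End YoungWeight.

(** * Smooth functions of several variables *)

Section DirectionalDerivatives.
Context {R : realType} {V : normedModType R}.
Implicit Types (u : V -> R) (x v w : V).

(** Remainders of order [h ^ 2] pass through an integral or a continuous functional as mere norm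
    bounds. Cosine transforms and the functions [average T f] are differentiated in this way,
    without a theorem on differentiation under the integral. *)
Lemma is_derive_quadratic u x v (l C : R) :
  (forall h : R, `|h| <= 1 -> `|u (h *: v + x) - u x - h * l| <= C * h ^+ 2) ->
  is_derive x v u l.
Proof.
move=> H.
have C0 : 0 <= C.
  by have := H 1; rewrite normr1 expr1n mulr1 => /(_ (lexx _)); apply: le_trans.
have cv : (fun h => h^-1 *: ((u \o shift x) (h *: v) - u x)) @ 0^' --> l.
  apply/cvgrPdist_le => e e0.
  have d0 : 0 < Num.min 1 (e / (C + 1)) by rewrite lt_min ltr01 divr_gt0// ltr_wpDl.
  near=> h.
  have h0 : h != 0 by near: h; exact: nbhs_dnbhs_neq.
  have hd : `|h| < Num.min 1 (e / (C + 1)) by near: h; apply: dnbhs0_lt.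
  have [h1 he] : `|h| <= 1 /\ `|h| <= e / (C + 1).
    by move: hd; rewrite lt_min => /andP[/ltW ? /ltW ?].
  have := H h h1; rewrite /= /shift /=.
  set D := u _ => HD.
  have -> : l - h^-1 *: (D - u x) = - (h^-1 * (D - u x - h * l)).
    rewrite /GRing.scale /=; field; exact: h0.
  rewrite normrN normrM normfV ler_pdivrMl ?normr_gt0//; apply: le_trans HD _.
  rewrite -[h ^+ 2]real_normK ?num_real// expr2 mulrA [leRHS]mulrC ler_wpM2r//.
  have : (C + 1) * `|h| <= e by rewrite mulrC -ler_pdivlMr// ltr_wpDl.
  have : 0 <= `|h| by [].
  lra.
split; first by apply/cvg_ex; exists l.
by apply/cvg_lim.
Unshelve. all: by end_near. Qed.

Lemma is_derive_line u x v (t : R) l :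
  is_derive (x + t *: v) v u l -> is_derive t 1 (fun s : R => u (x + s *: v)) l.
Proof.
have E : (fun h : R => h^-1 *: (((fun s : R => u (x + s *: v)) \o shift t) (h *: 1) -
           (fun s : R => u (x + s *: v)) t)) =
         (fun h => h^-1 *: ((u \o shift (x + t *: v)) (h *: v) - u (x + t *: v))).
  apply/funext => h /=; congr (_ *: (u _ - _)).
  rewrite [h%:A]mulr1 scalerDl addrCA//.
by move=> [d dv]; split; rewrite /derivable /derive E.
Qed.

Lemma mean_value u v x (l : V -> R) (s : R) : 0 <= s ->
  (forall y, is_derive y v u (l y)) ->
  exists2 c, 0 <= c <= s & u (x + s *: v) - u x = s * l (x + c *: v).
Proof.
move=> s0 du.
have d (t : R) : is_derive t (1 : R) (fun s : R => u (x + s *: v)) (l (x + t *: v)).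
  exact: is_derive_line.
have [|c] := @MVT_segment R (fun s : R => u (x + s *: v)) (fun t => l (x + t *: v)) 0 s s0.
  by apply: derivable_within_continuous => t _; case: (d t).
rewrite in_itv /= => c0; rewrite scale0r addr0 subr0 => ->.
  by exists c => //; rewrite mulrC.
Qed.

Lemma continuous_small (f : V -> R) x : {for x, continuous f} ->
  forall e, 0 < e -> exists2 d, 0 < d & forall y, `|y - x| < d -> `|f y - f x| < e.
Proof.
move=> /cvgrPdist_lt cf e /cf /nbhs_normP[d /= d0 Hd]; exists d => // y yx.
by rewrite distrC; apply: Hd; rewrite /= /ball_ distrC.
Qed.

(* Schwarz's theorem: both mixed derivatives are limits of the second
   difference quotient [(u (x + s v + s w) - u (x + s v) - u (x + s w) + u x) / s^2]. *)
Lemma mixed_derivatives u v w (uv uw uvw uwv : V -> R) x :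
  (forall y, is_derive y v u (uv y)) -> (forall y, is_derive y w u (uw y)) ->
  (forall y, is_derive y w uv (uvw y)) -> (forall y, is_derive y v uw (uwv y)) ->
  {for x, continuous uvw} -> {for x, continuous uwv} -> uvw x = uwv x.
Proof.
move=> dv dw dvw dwv cvw cwv.
pose D s := u (x + s *: v + s *: w) - u (x + s *: v) - u (x + s *: w) + u x.
have one (a b : V) (ua uab : V -> R) s : 0 < s ->
    (forall y, is_derive y a u (ua y)) -> (forall y, is_derive y b ua (uab y)) ->
    exists p q, [/\ 0 <= p <= s, 0 <= q <= s &
      u (x + s *: a + s *: b) - u (x + s *: a) - u (x + s *: b) + u x =
      s * (s * uab (x + p *: a + q *: b))].
  move=> s0 da dab.
  have dF y : is_derive y a (fun y => u (y + s *: b) - u y) (ua (y + s *: b) - ua y).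
    have dsh : is_derive y a (fun y => u (y + s *: b)) (ua (y + s *: b)).
      have [d1 d2] := da (y + s *: b).
      have E : (fun h : R => h^-1 *: (((fun y => u (y + s *: b)) \o shift y) (h *: a) -
           u (y + s *: b))) =
         (fun h => h^-1 *: ((u \o shift (y + s *: b)) (h *: a) - u (y + s *: b))).
        by apply/funext => h /=; rewrite addrA.
      by split; rewrite /derivable /derive E.
    exact: is_deriveB.
  have [p p0 Hp] := mean_value x (ltW s0) dF.
  have [q q0 Hq] := mean_value (x + p *: a) (ltW s0) dab.
  exists p, q; split => //.
  rewrite -Hq -Hp; ring.
apply/eqP; rewrite -subr_eq0 -normr_le0; apply/ler_addgt0Pl => e e0; rewrite addr0.
have e2 : 0 < e / 2 by rewrite divr_gt0.
have [d1 d10 H1] := continuous_small cvw e2.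
have [d2 d20 H2] := continuous_small cwv e2.
pose d := Num.min d1 d2; have d0 : 0 < d by rewrite lt_min d10.
pose s := d / (`|v| + `|w| + 1).
have vw0 : 0 < `|v| + `|w| + 1 by rewrite ltr_wpDl// addr_ge0.
have s0 : 0 < s by rewrite divr_gt0.
have sd p q : 0 <= p <= s -> 0 <= q <= s -> p * `|v| + q * `|w| < d.
  move=> /andP[p0 ps] /andP[q0 qs].
  have : s * (`|v| + `|w| + 1) = d by rewrite /s mulfVK// gt_eqF.
  have := ler_wpM2r (normr_ge0 v) ps; have := ler_wpM2r (normr_ge0 w) qs; lra.
have [p [q [p0 q0 E1]]] := one v w uv uvw s s0 dv dvw.
have [q' [p' [q0' p0' E2]]] := one w v uw uwv s s0 dw dwv.
have E : uvw (x + p *: v + q *: w) = uwv (x + q' *: w + p' *: v).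
  have := E2; rewrite [x + s *: w + s *: v]addrAC => E2'.
  have : s * (s * uvw (x + p *: v + q *: w)) = s * (s * uwv (x + q' *: w + p' *: v)).
    by rewrite -E1 -E2'; ring.
  by move=> /(mulfI (lt0r_neq0 s0)) /(mulfI (lt0r_neq0 s0)).
have near (p'' q'' : R) (a b : V) : 0 <= p'' -> 0 <= q'' ->
    `|x + p'' *: a + q'' *: b - x| <= p'' * `|a| + q'' * `|b|.
  move=> ? ?; rewrite -[x + _ + _]addrA [x + _]addrC addrK.
  by apply: le_trans (ler_normD _ _) _; rewrite !normrZ !ger0_norm.
have h1 : `|uvw (x + p *: v + q *: w) - uvw x| < e / 2.
  apply: H1; case/andP: (p0) => ? _; case/andP: (q0) => ? _.
  apply: le_lt_trans (near _ _ _ _ _ _) _ => //.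
  by apply: (lt_le_trans (sd _ _ p0 q0)); rewrite ge_min lexx.
have h2 : `|uwv (x + q' *: w + p' *: v) - uwv x| < e / 2.
  apply: H2; case/andP: (p0') => ? _; case/andP: (q0') => ? _.
  apply: le_lt_trans (near _ _ _ _ _ _) _ => //.
  by rewrite addrC; apply: (lt_le_trans (sd _ _ p0' q0')); rewrite ge_min lexx orbT.
have -> : uvw x - uwv x = (uwv (x + q' *: w + p' *: v) - uwv x) -
                          (uvw (x + p *: v + q *: w) - uvw x).
  rewrite -E; ring.
apply: le_trans (ler_normB _ _) _; rewrite [leRHS](splitr e); lra.
Qed.

End DirectionalDerivatives.

Section SmoothFunctions.
Context {R : realType} {N : nat}.
Local Notation RN := 'rV[R]_N.
Local Notation e_ i := (delta_mx 0 i : RN).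
Implicit Types (u : RN -> R) (x z : RN) (s : seq 'I_N).

(** The displacement is split into its coordinates, and the mean value theorem is applied to one of
    them at a time. *)
Lemma lipschitz_partials u (d : 'I_N -> RN -> R) (B : R) :
  (forall i x, is_derive x (e_ i) u (d i x)) -> (forall i x, `|d i x| <= B) ->
  forall x z, `|u (x + z) - u x| <= B * \sum_i `|z 0 i|.
Proof.
move=> du dB x z; rewrite {1}[z]row_sum_delta.
have step y i (t : R) : `|u (y + t *: e_ i) - u y| <= B * `|t|.
  have [t0|t0] := leP 0 t.
    have [c _ ->] := mean_value y t0 (du i).
    by rewrite normrM (ger0_norm t0) mulrC ler_wpM2r.
  have t0' : 0 <= - t by rewrite oppr_ge0 ltW.
  have [c _] := mean_value (y + t *: e_ i) t0' (du i).
  rewrite scaleNr addrK distrC => ->.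
  by rewrite normrM normrN mulrC ler_wpM2r.
elim: (index_enum _) => [|i r IHr]; first by rewrite !big_nil addr0 subrr normr0 mulr0.
rewrite !big_cons mulrDr.
have -> : u (x + (z 0 i *: e_ i + \sum_(j <- r) z 0 j *: e_ j)) - u x =
   (u (x + \sum_(j <- r) z 0 j *: e_ j + z 0 i *: e_ i) - u (x + \sum_(j <- r) z 0 j *: e_ j))
   + (u (x + \sum_(j <- r) z 0 j *: e_ j) - u x).
  by rewrite [z 0 i *: _ + _]addrC addrA [RHS]addrA subrK.
by apply: le_trans (ler_normD _ _) _; apply: lerD.
Qed.

Lemma coord_le_norm (x : RN) i : `|x 0 i| <= `|x|.
Proof. by rewrite [leRHS]mx_normrE; exact: (le_bigmax 0 (fun ij : 'I_1 * 'I_N => `|x ij.1 ij.2|) (0, i)). Qed.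

Lemma lipschitz_continuous u B :
  (forall x z, `|u (x + z) - u x| <= B * \sum_i `|z 0 i|) -> continuous u.
Proof.
move=> H x; apply/(@cvgrPdist_le _ _ _ (nbhs x)) => e e0.
pose C := `|B| * N%:R + 1.
have C0 : 0 < C by rewrite ltr_wpDl// mulr_ge0.
have d0 : 0 < e / C by rewrite divr_gt0.
near=> y.
have yx : `|y - x| < e / C by rewrite distrC; near: y; exact: cvgr_dist_lt.
have := H x (y - x); rewrite [x + _]addrC subrK distrC => h; apply: le_trans h _.
have : B * \sum_i `|(y - x) 0 i| <= `|B| * (\sum_(i < N) `|y - x|).
  apply: (@le_trans _ _ (`|B| * \sum_i `|(y - x) 0 i|)).
    by rewrite ler_wpM2r ?sumr_ge0// ler_norm.
  by rewrite ler_wpM2l//; apply: ler_sum => i _; exact: coord_le_norm.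
rewrite sumr_const card_ord => h; apply: le_trans h _.
have : `|y - x| * C <= e by rewrite -ler_pdivlMr// ltW.
rewrite /C -[_ *+ N]mulr_natr; have : 0 <= `|y - x| by []. lra.
Unshelve. all: by end_near. Qed.

(** The partial derivatives of a member are bounded members, so every member is Lipschitz, hence
    continuous. It serves twice: the derivatives of a cosine transform are indexed by a phase and a
    monomial, those of [average T f] by elements of S_omega. *)
Lemma smooth_family (A : Type) (F : A -> RN -> R) (D : 'I_N -> A -> A) (B : A -> R) :
  (forall a i x, is_derive x (e_ i) (F a) (F (D i a) x)) ->
  (forall a x, `|F a x| <= B a) ->
  forall a, smooth_real (F a) /\ forall s, partials s (F a) = F (foldr D a s).
Proof.
move=> dF bF a.
have P s : partials s (F a) = F (foldr D a s).
  elim: s => //= i s IHs; rewrite -/(partials _ _) IHs.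
  by apply/funext => x; case: (dF (foldr D a s) i x).
split=> // s; rewrite P; set b := foldr D a s; split; last first.
  by move=> x i; case: (dF b i x).
apply: (@lipschitz_continuous _ (\sum_i B (D i b))).
apply: (@lipschitz_partials _ (fun i => F (D i b))) => // i x.
apply: le_trans (bF _ x) _; rewrite (bigD1 i)//= lerDl sumr_ge0// => j _.
exact: le_trans (normr_ge0 _) (bF _ x).
Qed.

Lemma partials_cat s s' u : partials (s ++ s') u = partials s (partials s' u).
Proof. by rewrite /partials foldr_cat. Qed.

Lemma smooth_partials s u : smooth_real u -> smooth_real (partials s u).
Proof. by move=> su s'; rewrite -partials_cat; exact: su. Qed.

Lemma smooth_continuous u : smooth_real u -> continuous u.
Proof. by move=> /(_ [::])[]. Qed.

Lemma smooth_is_derive s u x i : smooth_real u ->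
  is_derive x (e_ i) (partials s u) (partials (i :: s) u x).
Proof. by move=> /(_ s)[_ /(_ x i)]; exact: derivableP. Qed.

Lemma partials_swap i j s u : smooth_real u ->
  partials (i :: j :: s) u = partials (j :: i :: s) u.
Proof.
move=> su; apply/funext => x.
apply: (@mixed_derivatives _ _ (partials s u) (e_ j) (e_ i) (partials (j :: s) u)
  (partials (i :: s) u)); do ?by move=> y; exact: smooth_is_derive.
- by have [c _] := su [:: i, j & s]; exact: c.
- by have [c _] := su [:: j, i & s]; exact: c.
Qed.

Lemma partials_perm s s' u : smooth_real u -> perm_eq s s' -> partials s u = partials s' u.
Proof.
move=> su; elim: s s' => [|i s IHs] s'; first by move=> /perm_size/esym/size0nil->.
move=> p; have : i \in s' by rewrite -(perm_mem p) mem_head.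
move=> /splitPr ps; case: ps p => s1 s2 p.
have {}p : perm_eq s (s1 ++ s2).
  by move: p; rewrite -cat1s -[i :: s2]cat1s perm_sym perm_catCA perm_sym perm_cat2l.
rewrite /= -/(partials _ _) (IHs _ p) => {p IHs}.
rewrite -[LHS]/(partials (i :: (s1 ++ s2)) u).
elim: s1 => // j s1 IHs1.
by rewrite partials_swap//; exact: (congr1 (fun g => partials [:: j] g) IHs1).
Qed.

(** Lists of directions support induction, multi-indices occur in the norms; by Schwarz's theorem a
    derivative along a list depends only on these counts. *)
Definition count_index s : multi_index N := [ffun i => count_mem i s].

Lemma perm_mi_seq s : perm_eq s (mi_seq (count_index s)).
Proof.
apply/allP => i _ /=; rewrite /mi_seq count_flatten -map_comp.
rewrite (eq_map (g := fun j => (j == i) * count_mem i s)%N); last first.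
  by move=> j /=; rewrite count_nseq ffunE /=; have [->|] := eqVneq j i.
rewrite sumnE big_map big_enum /= (bigD1 i)//= eqxx mul1n big1 ?addn0// => j /negbTE ->.
by rewrite mul0n.
Qed.

Lemma size_mi_seq (a : multi_index N) : size (mi_seq a) = mi_order a.
Proof.
rewrite /mi_seq size_flatten /shape -map_comp sumnE big_map big_enum /=.
by apply: eq_bigr => i _; rewrite size_nseq.
Qed.

Lemma mi_order_count_index s : mi_order (count_index s) = size s.
Proof. by rewrite -size_mi_seq -(perm_size (perm_mi_seq s)). Qed.

Lemma partials_count_index s u : smooth_real u ->
  partials s u = partials (mi_seq (count_index s)) u.
Proof. by move=> su; apply: partials_perm => //; exact: perm_mi_seq. Qed.

End SmoothFunctions.

(** * Interpolation of derivatives on a half line *)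

Section TaylorInterpolation.
Context {R : realType}.
Implicit Types (g : nat -> R -> R) (p q : {poly R}).

(** Both [q - r] and [q + r] vanish at 0 and have a nonnegative derivative. This replaces the
    integral form of the Taylor remainder. *)
Lemma derivative_domination (r q r' q' : R -> R) :
  (forall t, is_derive t (1 : R) r (r' t)) -> (forall t, is_derive t (1 : R) q (q' t)) ->
  r 0 = 0 -> q 0 = 0 -> (forall t, 0 <= t -> `|r' t| <= q' t) ->
  forall t, 0 <= t -> `|r t| <= q t.
Proof.
move=> dr dq r0 q0 H t t0.
have ge0 (f f' : R -> R) : (forall t, is_derive t (1 : R) f (f' t)) -> f 0 = 0 ->
    (forall t, 0 <= t -> 0 <= f' t) -> 0 <= f t.
  move=> df f0 pf; have [c /andP[c0 _]] := mean_value 0 t0 df.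
  rewrite add0r [t *: _]mulr1 f0 subr0 => ->; apply: mulr_ge0 => //.
  by apply: pf; rewrite add0r [c *: _]mulr1.
have h1 : 0 <= (q \- r) t.
  apply: (ge0 _ (q' \- r')).
    by rewrite /= r0 q0 subr0.
  by move=> s s0 /=; rewrite subr_ge0; exact: le_trans (ler_norm _) (H s s0).
have h2 : 0 <= (q \+ r) t.
  apply: (ge0 _ (q' \+ r')).
    by rewrite /= r0 q0 addr0.
  move=> s s0 /=; have := H s s0; rewrite ler_norml => /andP[? _]; lra.
rewrite ler_norml; move: h1 h2 => /=; lra.
Qed.

Lemma is_derive_divided_power n (t : R) :
  is_derive t (1 : R) (fun t : R => t ^+ n.+1 / n.+1`!%:R) (t ^+ n / n`!%:R).
Proof.
have d : is_derive t (1 : R) (fun t : R => n.+1`!%:R^-1 *: (id t) ^+ n.+1)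
    (n.+1`!%:R^-1 *: ((n.+1%:R * t ^+ n) *: (1 : R))).
  have dX := @is_deriveX R R id n.+1 t 1 1 (is_derive_id _ _).
  have := @is_deriveZ _ _ _ ((id : R -> R) ^+ n.+1) (n.+1`!%:R^-1) t 1 _ dX.
  by rewrite exprfctE.
have -> : (fun t : R => t ^+ n.+1 / n.+1`!%:R) = (fun t : R => n.+1`!%:R^-1 *: (id t) ^+ n.+1).
  by apply/funext => s; rewrite mulrC.
have -> // : t ^+ n / n`!%:R = n.+1`!%:R^-1 *: ((n.+1%:R * t ^+ n) *: (1 : R)).
rewrite /GRing.scale /= factS natrM; field.
by rewrite pnatr_eq0 -lt0n fact_gt0 -[1]/1%:R -natrD pnatr_eq0.
Qed.

Lemma is_derive_taylor_sum n (c : nat -> R) (t : R) :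
  is_derive t (1 : R) (fun t : R => \sum_(k < n.+1) c k * (t ^+ k / k`!%:R))
    (\sum_(k < n) c k.+1 * (t ^+ k / k`!%:R)).
Proof.
have -> : (fun t : R => \sum_(k < n.+1) c k * (t ^+ k / k`!%:R)) =
   (fun=> c 0%N) + \sum_(k < n) (fun t : R => c k.+1 *: (t ^+ k.+1 / k.+1`!%:R)).
  apply/funext => s; rewrite big_ord_recl /= expr0 fact0 invr1 !mulr1.
  by rewrite [RHS]/(_ + _) /= fct_sumE.
have d : is_derive t (1 : R) ((fun=> c 0%N) + \sum_(k < n) (fun t : R => c k.+1 *: (t ^+ k.+1 / k.+1`!%:R)))
   (0 + \sum_(k < n) c k.+1 *: (t ^+ k / k`!%:R)).
  apply: is_deriveD.
  by apply: is_derive_sum => k; apply: is_deriveZ; exact: is_derive_divided_power.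
by move: d; rewrite add0r.
Qed.

Lemma taylor_bound n g (M : R) :
  (forall k t, is_derive t (1 : R) (g k) (g k.+1 t)) ->
  (forall t, 0 <= t -> `|g n t| <= M) ->
  forall t, 0 <= t ->
    `|g 0%N t - \sum_(k < n) g k 0 * (t ^+ k / k`!%:R)| <= M * (t ^+ n / n`!%:R).
Proof.
elim: n g => [|n IHn] g dg bg t t0.
  by rewrite big_ord0 subr0 expr0 fact0 invr1 !mulr1; exact: bg.
have := IHn (fun k => g k.+1) (fun k => dg k.+1) bg => {}IHn.
apply: (@derivative_domination
  (fun t => g 0%N t - \sum_(k < n.+1) g k 0 * (t ^+ k / k`!%:R))
  (fun t => M * (t ^+ n.+1 / n.+1`!%:R))
  (fun t => g 1%N t - \sum_(k < n) g k.+1 0 * (t ^+ k / k`!%:R))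
  (fun t => M * (t ^+ n / n`!%:R))) => //.
- by move=> s; apply: is_deriveB; exact: (is_derive_taylor_sum _ (fun k => g k 0)).
- by move=> s; apply: is_deriveZ; exact: is_derive_divided_power.
- rewrite big_ord_recl big1 ?addr0 ?expr0 ?fact0 ?invr1 ?mulr1 ?subrr//.
  by move=> i _; rewrite expr0n /= mul0r mulr0.
- by rewrite expr0n /= mul0r mulr0.
Qed.

Definition coef_bounded p (M : R) := forall i, `|p`_i| <= M.

Lemma coef_bounded_lin p M (a b : R) : coef_bounded p M ->
  coef_bounded ((a *: 'X - b%:P) * p) ((`|a| + `|b|) * M).
Proof.
move=> H i; have M0 : 0 <= M := le_trans (normr_ge0 _) (H 0%N).
rewrite mulrBl -scalerAl coefB coefZ coefXM coefCM.
apply: le_trans (ler_normB _ _) _; rewrite !normrM mulrDl.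
apply: lerD; apply: ler_wpM2l => //.
by case: eqP => _; rewrite ?normr0.
Qed.

Lemma coef_bounded_prod (I : Type) (r : seq I) (P : pred I) (a b : I -> R) :
  coef_bounded (\prod_(i <- r | P i) (a i *: 'X - (b i)%:P))
    (\prod_(i <- r | P i) (`|a i| + `|b i|)).
Proof.
elim: r => [|i r IHr].
  by rewrite !big_nil => -[|i]; rewrite coef1 /= ?normr1 ?normr0.
by rewrite !big_cons; case: ifP => // _; exact: coef_bounded_lin.
Qed.

Lemma prod_shift_fact a k : (\prod_(l < k) (a + l).+1 * a`! = (a + k)`!)%N.
Proof.
elim: k => [|k IHk]; first by rewrite big_ord0 mul1n addn0.
by rewrite big_ord_recr /= mulnAC IHk addnS factS mulnC.
Qed.

Lemma prod_dist_fact n (j : 'I_n.+1) :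
  \prod_(l < n.+1 | l != j) `|j%:R - l%:R : R| = (j`! * (n - j)`!)%:R.
Proof.
have jn : (j <= n)%N by rewrite -ltnS.
rewrite (eq_bigl (fun l : 'I_n.+1 => (l != j :> nat))); last by move=> l; rewrite -val_eqE.
rewrite -(big_mkord (fun l => l != j :> nat) (fun l => `|j%:R - l%:R : R|)).
rewrite (@big_cat_nat _ _ _ j)//=; last by rewrite ltnW// ltnS.
rewrite [X in _ * X]big_ltn_cond ?ltnS// eqxx /= natrM; congr (_ * _).
  rewrite big_nat_cond (eq_bigl (fun i => (0 <= i < j)%N)); last first.
    by move=> i; rewrite andbC; case: ltngtP; rewrite ?andbF.
  rewrite -big_nat big_mkord -[in RHS](add0n j) -(prod_shift_fact 0) fact0 muln1 natr_prod.
  rewrite (reindex_inj rev_ord_inj)/=; apply: eq_bigr => i _.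
  rewrite add0n natrB// ger0_norm; first by rewrite opprB addrCA subrr addr0.
  by rewrite opprB addrCA subrr addr0.
rewrite big_nat_cond (eq_bigl (fun i => (j < i < n.+1)%N)); last first.
  by move=> i; case: ltngtP; rewrite ?andbT ?andbF.
rewrite -big_nat -{1}(add0n j.+1) big_addn subSS big_mkord.
rewrite -(add0n (n - j)%N) -(prod_shift_fact 0) fact0 muln1 natr_prod.
apply: eq_bigr => i _; rewrite distrC -natrB; last by rewrite (leq_trans (leqnSn _)) ?leq_addl.
rewrite ger0_norm// addnS subSn ?leq_addl// addnK -[(0 + i)%N]/(i : nat)//.
Qed.

(** Lagrange interpolation at the nodes [j / (n + 1)], [j <= n]. The coefficients of the j-th basis
    polynomial are at most [(n + 1) C(2 n + 1, n + 1) C(n, j)]. Summing over [j] and bounding each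
    factor by a power of 2 gives [2 ^ (4 n + 2) <= 16 ^ (n + 1)]; only exponential growth in [n]
    matters. *)
Lemma lagrange_coef n p (B : R) : (size p <= n.+1)%N ->
  (forall j : 'I_n.+1, `|p.[j%:R / n.+1%:R]| <= B) ->
  coef_bounded p (16 ^+ n.+1 * B).
Proof.
move=> sp pB; have B0 : 0 <= B := le_trans (normr_ge0 _) (pB ord0).
pose x (j : 'I_n.+1) : R := j%:R / n.+1%:R.
have nn0 : n.+1%:R != 0 :> R by rewrite pnatr_eq0.
pose d (j : 'I_n.+1) : R := \prod_(l < n.+1 | l != j) (j%:R - l%:R).
(* Every factor is multiplied by [n + 1], so that the normalisation [d j] is a product of
   integers. *)
pose L j := (d j)^-1 *: \prod_(l < n.+1 | l != j) (n.+1%:R *: 'X - (l%:R)%:P) : {poly R}.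
have d0 j : d j != 0.
  rewrite prodf_seq_neq0; apply/allP => l _; apply/implyP => lj.
  by rewrite subr_eq0 eqr_nat eq_sym.
have Lx j k : (L j).[x k] = (j == k)%:R.
  rewrite /L hornerZ horner_prod.
  under eq_bigr => l _ do rewrite hornerD hornerN hornerZ hornerX hornerC /x mulrC mulfVK//.
  have [->|jk] := eqVneq j k; first by rewrite mulVf.
  by rewrite (bigD1 k) /= 1?eq_sym// subrr mul0r mulr0.
have sL j : (size (L j) <= n.+1)%N.
  apply: leq_trans (size_scale_leq _ _) _.
  apply: leq_trans (size_prod_leq _ _) _.
  rewrite (_ : #|_| = n); last by rewrite cardC1 card_ord.
  have -> : (\sum_(l < n.+1 | l != j) size (n.+1%:R *: 'X - (l%:R)%:P : {poly R})%R = \sum_(l < n.+1 | l != j) 2)%N.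
    apply: eq_bigr => l _; rewrite size_polyDl size_scale ?size_polyX// size_polyN.
    by rewrite (leq_ltn_trans (size_polyC_leq1 _)).
  rewrite sum_nat_const (_ : #|_| = n); last by rewrite cardC1 card_ord.
  by rewrite muln2 -addnn subSn ?leq_addr// addnK.
have pE : p = \sum_j p.[x j] *: L j.
  apply/eqP; rewrite -subr_eq0; apply/eqP.
  apply: (@roots_geq_poly_eq0 _ _ [seq x j | j <- enum 'I_n.+1]).
  - apply/allP => _ /mapP[j _ ->]; rewrite /root hornerD hornerN horner_sum (bigD1 j)//=.
    rewrite hornerZ Lx eqxx mulr1 big1 ?addr0 ?subrr// => k kj.
    by rewrite hornerZ Lx (negbTE kj) mulr0.
  - rewrite map_inj_uniq ?enum_uniq// => j k.
    move=> /(divIf nn0)/eqP; rewrite eqr_nat => /eqP; exact: val_inj.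
  - rewrite size_map size_enum_ord; apply: leq_trans (size_polyD _ _) _.
    rewrite geq_max sp size_polyN; apply: leq_trans (size_sum _ _ _) _.
    by apply/bigmax_leqP => j _; exact: leq_trans (size_scale_leq _ _) (sL j).
have bL j : coef_bounded (L j) ((n.+1 * 'C((n + n).+1, n.+1) * 'C(n, j))%:R).
  move=> i; rewrite coefZ normrM normfV normr_prod prod_dist_fact.
  have f0 : 0 < (j`! * (n - j)`!)%:R :> R by rewrite ltr0n muln_gt0 !fact_gt0.
  rewrite ler_pdivrMl// -natrM.
  apply: le_trans (coef_bounded_prod _ _ _ _ i) _.
  (* The factor [(n + 1) X - l] contributes [n + 1 + l]. Inserting the missing factor for [l = j],
     which is at least 1, completes the product to [(2 n + 1)! / n!]. *)
  apply: (@le_trans _ _ (\prod_(l < n.+1) (n + l).+1)%:R).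
    rewrite [in leRHS](bigD1 j)//= natrM natr_prod.
    rewrite -[leLHS]mul1r; apply: ler_pM => //; first by apply: prodr_ge0 => l _; rewrite addr_ge0.
      by rewrite ler1n.
    apply: ler_prod => l _; rewrite addr_ge0//= !normr_nat -natrD addSn.
    by [].
  rewrite ler_nat.
  have h := prod_shift_fact n n.+1; rewrite addnS in h.
  have h1 := @bin_fact (n + n).+1 n.+1; rewrite ltnS leq_addl subSS addnK in h1.
  have h2 := @bin_fact n j; rewrite -ltnS ltn_ord in h2.
  rewrite -(leq_pmul2r (fact_gt0 n)) h -(h1 isT).
  have -> : (j`! * (n - j)`! * (n.+1 * 'C((n + n).+1, n.+1) * 'C(n, j)) * n`! =
    'C((n + n).+1, n.+1) * (n.+1 * ('C(n, j) * (j`! * (n - j)`!)) * n`!))%N by ring.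
  by rewrite (h2 isT) factS.
move=> i; rewrite pE coef_sum; apply: le_trans (ler_norm_sum _ _ _) _.
apply: (@le_trans _ _ (\sum_(j < n.+1) B * (n.+1 * 'C((n + n).+1, n.+1) * 'C(n, j))%:R)).
  by apply: ler_sum => j _; rewrite coefZ normrM; apply: ler_pM => //; [exact: pB|exact: bL].
rewrite -mulr_sumr mulrC ler_wpM2r// -natr_sum -natrX ler_nat -big_distrr /=.
have -> : (\sum_(j < n.+1) 'C(n, j) = 2 ^ n)%N.
  have := expnDn 1 1 n; rewrite addn1 => ->.
  by apply: eq_bigr => j _; rewrite !exp1n !muln1.
have b1 : ('C((n + n).+1, n.+1) <= 2 ^ (n + n).+1)%N.
  have := expnDn 1 1 (n + n).+1; rewrite addn1 => ->.
  have kn : (n.+1 < (n + n).+2)%N by rewrite !ltnS leq_addl.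
  by rewrite (bigD1 (Ordinal kn))//= !exp1n !muln1 leq_addr.
have b2 : (n.+1 <= 2 ^ n.+1)%N by rewrite ltnW// ltn_expl.
apply: (leq_trans (leq_mul (leq_mul b2 b1) (leqnn _))).
rewrite -!expnD -[16%N]/(2 ^ 4)%N -expnM leq_exp2l//; lia.
Qed.

(* On [0, d], where [d ^ (2 k) = F (2 k)! / M], the Taylor polynomial of degree
   below [2 k] is at most [2 F], and Lagrange interpolation at equispaced points
   bounds its coefficient of order [k]. The square roots of the classical
   Landau-Kolmogorov inequality are avoided by squaring. *)
Lemma interpolation_halfline k g (F M : R) :
  (forall j t, is_derive t (1 : R) (g j) (g j.+1 t)) -> 0 <= F -> 0 <= M ->
  (forall t, 0 <= t -> `|g 0%N t| <= F) ->
  (forall t, 0 <= t -> `|g (k * 2)%N t| <= M) ->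
  g k 0 ^+ 2 <= 4 * (16 ^+ 4) ^+ k * (F * M).
Proof.
move=> dg F0 M0 bF bM.
(* Order 0 is separate because [d] is a root of order [2 k]. *)
case: k bM => [|k] bM.
  rewrite expr0 mulr1 -real_normK ?num_real// expr2.
  have h : `|g 0%N 0| * `|g 0%N 0| <= F * M by apply: ler_pM => //; [exact: bF|exact: bM].
  have : 0 <= F * M by rewrite mulr_ge0. lra.
set p := k.+1 in bM *; set n := (p * 2)%N in bM.
have n0 : (0 < n)%N by [].
have A0 : 0 < 4 * (16 ^+ 4) ^+ p :> R by rewrite mulr_gt0 ?exprn_gt0.
(* [F] and [M] may vanish, while [d] involves their quotient; they are enlarged slightly and the
   bound passes to the limit. *)
suff H F' M' : F < F' -> M < M' -> g p 0 ^+ 2 <= 4 * (16 ^+ 4) ^+ p * (F' * M').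
  apply/ler_addgt0Pl => e e0; set A := 4 * _ in A0 *.
  pose d := Num.min 1 (e / (A * (F + M + 1))).
  have S0 : 0 < F + M + 1 by lra.
  have d0 : 0 < d by rewrite lt_min ltr01 divr_gt0// mulr_gt0.
  apply: le_trans (H (F + d) (M + d) _ _) _; rewrite ?ltrDl//.
  have d1 : d <= 1 by rewrite ge_min lexx.
  have d2 : A * (F + M + 1) * d <= e.
    by rewrite mulrC -ler_pdivlMr ?mulr_gt0// ge_min lexx orbT.
  have : A * (d * d) <= A * d by rewrite ler_pM2l// ler_piMr// ltW.
  rewrite -/A; lra.
move=> FF MM; have F'0 := le_lt_trans F0 FF; have M'0 := le_lt_trans M0 MM.
have fn0 : 0 < n`!%:R :> R by rewrite ltr0n fact_gt0.
have fp0 : 0 < p`!%:R :> R by rewrite ltr0n fact_gt0.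
pose y := F' * n`!%:R / M'; have y0 : 0 < y by rewrite divr_gt0// mulr_gt0.
pose d := y `^ n%:R^-1.
have d0 : 0 < d by rewrite powR_gt0.
have dn : d ^+ n = y.
  by rewrite -powR_mulrn ?ltW// -powRrM mulVf ?pnatr_eq0 -?lt0n// powRr1// ltW.
pose c (j : nat) := g j 0 * (d ^+ j / j`!%:R).
pose P := \poly_(j < n) c j : {poly R}.
have PB (t : R) : 0 <= t <= 1 -> `|P.[t]| <= F' *+ 2.
  move=> /andP[t0 t1]; rewrite horner_poly.
  have dt0 : 0 <= d * t by rewrite mulr_ge0// ltW.
  have := taylor_bound dg bM dt0.
  rewrite (_ : \sum_(j < n) g j 0 * ((d * t) ^+ j / j`!%:R) = \sum_(j < n) c j * t ^+ j); last first.
    by apply: eq_bigr => j _; rewrite /c exprMn; ring.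
  set S := \sum_(_ < _) _ => h.
  have h1 := bF _ dt0.
  have h2 : M * ((d * t) ^+ n / n`!%:R) <= F'.
    apply: (@le_trans _ _ (M' * (d ^+ n / n`!%:R))).
      apply: ler_pM; rewrite ?(ltW MM)//.
        by rewrite divr_ge0// exprn_ge0.
      rewrite ler_pM2r ?invr_gt0// exprMn ler_piMr ?exprn_ge0 ?(ltW d0)//.
      exact: exprn_ile1.
    rewrite dn /y le_eqVlt; apply/orP; left; apply/eqP; field.
    by rewrite !gt_eqF.
  have -> : S = g 0%N (d * t) - (g 0%N (d * t) - S) by ring.
  apply: le_trans (ler_normB _ _) _; rewrite mulr2n; lra.
have [m nE] : exists m, n = m.+1 by exists n.-1; rewrite prednK.
have := @lagrange_coef m P (F' *+ 2).
rewrite -nE size_poly => /(_ isT) hc.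
have {hc} := hc _ p.
rewrite coef_poly (_ : (p < n)%N) ?muln2 -?addnn ?ltn_addr//; last by rewrite /n muln2 -addnn -ltn_subLR// subnn.
move=> hc.
have {hc} : `|c p| <= 16 ^+ n * (F' *+ 2).
  apply: hc => j; apply: PB; rewrite divr_ge0//= ler_pdivrMr ?ltr0n ?nE// mul1r ler_nat ltnW//.
have dp0 : 0 <= d ^+ p / p`!%:R by rewrite divr_ge0// exprn_ge0// ltW.
rewrite /c normrM (ger0_norm dp0) => hc.
have hsq : (`|g p 0| * (d ^+ p / p`!%:R)) ^+ 2 <= (16 ^+ n * (F' *+ 2)) ^+ 2.
  have r0 : 0 <= 16 ^+ n * (F' *+ 2) by rewrite mulr_ge0// mulrn_wge0// ltW.
  by rewrite ler_sqr ?nnegrE// mulr_ge0.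
rewrite exprMn real_normK ?num_real// expr_div_n -exprM -/n dn in hsq.
(* The binomial coefficient of [p] in [2 p] is at least 1. This makes all factorials disappear from
   the final constant. *)
have fpn : p`!%:R ^+ 2 <= n`!%:R :> R.
  rewrite -natrX ler_nat /n muln2 -addnn.
  have := @bin_fact (p + p) p; rewrite leq_addr addnK => <- //.
  by rewrite -mulnn leq_pmull// bin_gt0 leq_addr.
have : g p 0 ^+ 2 * (n`!%:R / p`!%:R ^+ 2) <= 4 * (16 ^+ 4) ^+ p * (F' * M').
  have := ler_wpM2l (ltW (divr_gt0 M'0 F'0)) hsq.
  have -> : M' / F' * (g p 0 ^+ 2 * (y / p`!%:R ^+ 2)) = g p 0 ^+ 2 * (n`!%:R / p`!%:R ^+ 2).
    by rewrite /y; field; rewrite !gt_eqF.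
  rewrite exprMn -[(16 ^+ n) ^+ 2]exprM.
  have n2 : (n * 2 = 4 * p)%N by rewrite /n mulnC [(p * 2)%N]mulnC mulnA.
  rewrite n2 [16 ^+ (4 * p)]exprM.
  have -> // : M' / F' * ((16 ^+ 4) ^+ p * (F' *+ 2) ^+ 2) = 4 * (16 ^+ 4) ^+ p * (F' * M').
  by field; rewrite gt_eqF.
apply: le_trans; rewrite ler_peMr ?sqr_ge0// ler_pdivlMr ?exprn_gt0// mul1r.
exact: fpn.
Qed.

End TaylorInterpolation.

(** * Integration on R^N *)

Lemma ge0_integrable (d : measure_display) (X : measurableType d) (R : realType)
    (m : {measure set X -> \bar R}) (u : X -> R) :
  measurable_fun setT u -> (forall x, 0 <= u x) ->
  (\int[m]_x (u x)%:E < +oo)%E -> m.-integrable setT (EFin \o u).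
Proof.
move=> mu u0 uoo; apply/integrableP; split; first exact/measurable_EFinP.
apply: le_lt_trans uoo; rewrite le_eqVlt; apply/orP; left; apply/eqP.
by apply: eq_integral => x _; rewrite /= ger0_norm.
Qed.

Section LebesgueTupleTheory.
Context {R : realType}.
Local Notation T n := (n.-tuple (measurableTypeR R)).
Local Notation leb := (@lebesgue_measure R).
Local Notation mu n := (@lebesgue_tuple R n).
Local Open Scope ereal_scope.

Lemma measurable_glue n : measurable_fun setT (@tuple_glue R n).
Proof. exact: measurable_cons. Qed.

Lemma ge0_integral_step n (f : T n.+1 -> \bar R) :
  measurable_fun setT f -> (forall t, 0 <= f t) ->
  \int[mu n.+1]_t f t = \int[leb]_x \int[mu n]_t f (tuple_glue (x, t)).
Proof.
move=> mf f0; rewrite /= /lebesgue_step.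
rewrite (@ge0_integral_pushforward _ _ _ _ _ _ (@measurable_glue n))//.
rewrite preimage_setT fubini_tonelli1//; last by move=> x; exact: f0.
by apply: measurableT_comp => //; exact: measurable_glue.
Qed.

Lemma integral_step n (f : T n.+1 -> \bar R) : (mu n.+1).-integrable setT f ->
  \int[mu n.+1]_t f t = \int[leb]_x \int[mu n]_t f (tuple_glue (x, t)).
Proof.
move=> intf; have mf := measurable_int _ intf.
have intg : (leb \x mu n).-integrable setT (f \o @tuple_glue R n).
  apply/integrableP; split.
    by apply: measurableT_comp => //; exact: measurable_glue.
  have /integrableP[_] := intf; rewrite /= /lebesgue_step.
  rewrite (@ge0_integral_pushforward _ _ _ _ _ _ (@measurable_glue n))//.
  by apply: measurableT_comp.
rewrite /= /lebesgue_step (@integral_pushforward _ _ _ _ _ _ (@measurable_glue n))//.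
by rewrite preimage_setT -integral12_prod_meas1.
Qed.

Lemma integral_tuple0 (f : T 0 -> \bar R) : \int[mu 0]_t f t = f [tuple].
Proof.
have E (t : T 0) : t = [tuple] by exact: tuple0.
have -> : f = cst (f [tuple]) by apply/funext => t; rewrite (E t).
by rewrite integral_cst//= diracT mule1.
Qed.

Lemma measurable_affine (a b : R) :
  measurable_fun setT (fun x : measurableTypeR R => (a * x + b)%R : measurableTypeR R).
Proof. by apply: measurable_funD => //; exact: measurable_funM. Qed.

(** Lebesgue measure coincides with [a] times its image under the affine map, because the two agree
    on half-open intervals. *)
Lemma ge0_integral_affine1 (a b : R) (f : R -> \bar R) : (0 < a)%R ->
  measurable_fun setT f -> (forall x, 0 <= f x) ->
  \int[leb]_x f x = a%:E * \int[leb]_x f (a * x + b)%R.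
Proof.
move=> a0 mf f0; have a0' : (0 <= a)%R := ltW a0.
pose phi (x : measurableTypeR R) : measurableTypeR R := (a * x + b)%R.
have mphi : measurable_fun setT phi by exact: measurable_affine.
have E A : measurable A -> leb A = mscale (NngNum a0') (pushforward leb phi) A.
  apply: (@lebesgue_measure_unique R (mscale (NngNum a0') (pushforward leb phi))).
  move=> _ [[c d]] _ <-; rewrite /mscale /= /pushforward.
  change (leb `]c, d] = a%:E * leb (phi @^-1` `]c, d]%classic)).
  have -> : phi @^-1` `]c, d] = `]((c - b) / a)%R, ((d - b) / a)%R]%classic.
    apply/seteqP; split => x /=; rewrite !in_itv /phi /=.
      by rewrite ltr_pdivrMr// ler_pdivlMr// => /andP[? ?]; apply/andP; split; lra.
    by rewrite ltr_pdivrMr// ler_pdivlMr// => /andP[? ?]; apply/andP; split; lra.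
  rewrite !lebesgue_measure_itv /= !lte_fin ltr_pM2r ?invr_gt0// ltrD2r.
  case: ifPn => _; last by rewrite mule0.
  rewrite -!EFinB -EFinM; congr (_%:E); field; exact: lt0r_neq0.
apply: eq_trans; first by apply: eq_measure_integral => A mA _; exact: (E mphi).
rewrite ge0_integral_mscale//= (@ge0_integral_pushforward _ _ _ _ _ _ mphi)//.
Qed.

(** The translation is a sequence over [nat], so that in the induction on the dimension its tail is
    simply [b i.+1]. *)
Definition tuple_affine n (a : R) (b : nat -> R) (t : T n) : T n :=
  [tuple (a * tnth t i + b i)%R | i < n].

Lemma measurable_tuple_affine n a b : measurable_fun setT (@tuple_affine n a b).
Proof.
apply/measurable_fun_tnthP => i.
rewrite (_ : _ \o _ = fun t => (a * tnth t i + b i)%R); last first.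
  by apply/funext => t /=; rewrite tnth_mktuple.
apply: measurable_funD => //; apply: measurable_funM => //; exact: measurable_tnth.
Qed.

Lemma tuple_affine_glue n a b x t :
  tuple_affine a b (tuple_glue (x, t)) =
  tuple_glue ((a * x + b 0%N)%R, tuple_affine a (fun i => b i.+1) t) :> T n.+1.
Proof.
apply: eq_from_tnth => i; rewrite tnth_mktuple.
case: (unliftP ord0 i) => [j ->|->].
  rewrite !tnthS tnth_mktuple.
  by congr (_ * _ + _)%R.
by rewrite !tnth0.
Qed.

Lemma ge0_integral_affine n (a : R) b (f : T n -> \bar R) : (0 < a)%R ->
  measurable_fun setT f -> (forall x, 0 <= f x) ->
  \int[mu n]_x f x = (a ^+ n)%:E * \int[mu n]_x f (tuple_affine a b x).
Proof.
move=> a0; elim: n b f => [|n IHn] b f mf f0.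
  by rewrite !integral_tuple0 expr0 mul1e (tuple0 (tuple_affine a b _)).
have mg : measurable_fun setT (fun p : measurableTypeR R * T n => f (tuple_glue p)).
  by apply: measurableT_comp => //; exact: measurable_glue.
rewrite ge0_integral_step// [in RHS]ge0_integral_step//; last first.
  by apply: measurableT_comp => //; exact: measurable_tuple_affine.
rewrite (ge0_integral_affine1 (b 0%N) a0); last 2 first.
- exact: (@measurable_fun_fubini_tonelli_F _ _ _ _ _ _ (fun p => f (tuple_glue p))).
- by move=> x; exact: integral_ge0.
rewrite exprS EFinM -muleA; congr (_ * _).
have an : 0 <= (a ^+ n)%:E by rewrite lee_fin exprn_ge0// ltW.
rewrite -ge0_integralZl//; last 2 first.
- apply: (@measurable_fun_fubini_tonelli_F _ _ _ _ _ _
    (fun p => f (tuple_affine a b (tuple_glue p)))) => //.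
  apply: measurableT_comp => //; apply: measurableT_comp; last exact: measurable_glue.
  exact: measurable_tuple_affine.
- by move=> x _; exact: integral_ge0.
apply: eq_integral => x _; rewrite (IHn (fun i => b i.+1)).
- by congr (_ * _); apply: eq_integral => t _; rewrite tuple_affine_glue.
- by apply: (measurableT_comp mg); exact: measurable_pair1.
- by [].
Qed.

Lemma integrable_affine n (a : R) b (f : T n -> \bar R) : (0 < a)%R ->
  (mu n).-integrable setT f -> (mu n).-integrable setT (f \o tuple_affine a b).
Proof.
move=> a0 /integrableP[mf foo]; apply/integrableP; split.
  by apply: measurableT_comp => //; exact: measurable_tuple_affine.
move: foo; rewrite (ge0_integral_affine b a0)//; last exact: measurableT_comp.
have an : (0 < a ^+ n)%R by rewrite exprn_gt0.
move=> h; rewrite ltey; apply/eqP => E; move: h.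
by rewrite [X in _ * X]E gt0_muley ?lte_fin.
Qed.

Lemma integral_affine n (a : R) b (f : T n -> \bar R) : (0 < a)%R ->
  (mu n).-integrable setT f ->
  \int[mu n]_x f x = (a ^+ n)%:E * \int[mu n]_x f (tuple_affine a b x).
Proof.
move=> a0 intf; have mf := measurable_int _ intf.
have intg := integrable_affine b a0 intf.
rewrite integralE [in RHS]integralE.
rewrite (ge0_integral_affine b a0)//; last exact: measurable_funepos.
rewrite [X in _ - X](ge0_integral_affine b a0)//; last exact: measurable_funeneg.
have P (x : T n) : f^\+ (tuple_affine a b x) = (f \o tuple_affine a b)^\+ x.
  by rewrite !funeposE.
have Q (x : T n) : f^\- (tuple_affine a b x) = (f \o tuple_affine a b)^\- x.
  by rewrite !funenegE.
have -> : \int[mu n]_x f^\+ (tuple_affine a b x) = \int[mu n]_x (f \o tuple_affine a b)^\+ x.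
  by apply: eq_integral => x _; exact: P.
have -> : \int[mu n]_x f^\- (tuple_affine a b x) = \int[mu n]_x (f \o tuple_affine a b)^\- x.
  by apply: eq_integral => x _; exact: Q.
rewrite -muleBr//; apply: fin_num_adde_defl; rewrite fin_numN.
exact: (integrable_fin_num measurableT (integrable_funeneg measurableT intg)).
Qed.

Lemma ge0_integral_prod_coord n (h : R -> R) (c : R) :
  measurable_fun setT h -> (forall x, (0 <= h x)%R) -> \int[leb]_x (h x)%:E = c%:E ->
  \int[mu n]_t (\prod_(i < n) h (tnth t i))%:E = (c ^+ n)%:E.
Proof.
move=> mh h0 hc.
have mp m : measurable_fun setT (fun t : T m => \prod_(i < m) h (tnth t i))%R.
  by apply: measurable_prod => i _; apply: measurableT_comp => //; exact: measurable_tnth.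
elim: n => [|n IHn]; first by rewrite integral_tuple0 big_ord0.
rewrite ge0_integral_step; last 2 first.
- by apply/measurable_EFinP; exact: mp.
- by move=> t; rewrite lee_fin prodr_ge0.
transitivity (\int[leb]_x ((h x)%:E * (c ^+ n)%:E)).
  apply: eq_integral => x _; rewrite -IHn -ge0_integralZl//; last 3 first.
  - by apply/measurable_EFinP; exact: mp.
  - by move=> t _; rewrite lee_fin prodr_ge0.
  - by rewrite lee_fin.
  apply: eq_integral => t _; rewrite -EFinM big_ord_recl tnth0; congr (_ * _)%:E%R.
  by apply: eq_bigr => i _; rewrite tnthS.
have c0 : (0 <= c)%R by rewrite -lee_fin -hc; apply: integral_ge0 => x _; rewrite lee_fin.
rewrite ge0_integralZr//; last 3 first.
- exact/measurable_EFinP.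
- by move=> x _; rewrite lee_fin.
- by rewrite lee_fin exprn_ge0.
by rewrite hc -EFinM exprS.
Qed.

End LebesgueTupleTheory.

(** * Measurability of continuous functions on tuples *)

Section ContinuousMeasurable.
Context {R : realType} {N : nat}.
Local Notation RN := 'rV[R]_N.

(** The measurable sets of tuples are generated by the coordinates, while continuity refers to the
    norm of row vectors. The two meet in countably many boxes with rational centres and half-sides
    [1 / (n + 1)], which exhaust the set where [g > a]. *)
Lemma continuous_measurable_row (g : RN -> R) : continuous g ->
  measurable_fun setT (fun t : N.-tuple (measurableTypeR R) => g (row_of_tuple t)).
Proof.
move=> cg; apply: (measurability _ (RGenOInfty.measurableE R)) => //.
move=> /= _ [_ [a ->] <-]; rewrite setTI.
pose box (p : 'rV[rat]_N * nat) : set RN :=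
  [set y | forall i, `|y 0 i - ratr (p.1 0 i)| < p.2.+1%:R^-1].
pose good p := box p `<=` [set y | a < g y].
have -> : (fun t => g (row_of_tuple t)) @^-1` `]a, +oo[ =
    \bigcup_(p in [set p | good p]) [set t | box p (row_of_tuple t)].
  apply/seteqP; split=> t /=; rewrite in_itv /= andbT; last by move=> [p gp bp]; exact: gp.
  move=> ag; set y := row_of_tuple t in ag *.
  have e0 : 0 < g y - a by rewrite subr_gt0.
  have [d d0 Hd] := continuous_small (cg y) e0.
  have [k kd] : exists k : nat, k.+1%:R^-1 < d / 2.
    have d2 : 0 < d / 2 by rewrite divr_gt0.
    exists (Num.truncn (d / 2)^-1); rewrite invf_plt ?posrE//; exact: truncnS_gt.
  have k0 : 0 < k.+1%:R^-1 :> R by rewrite invr_gt0.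
  set e := k.+1%:R^-1 in kd k0.
  have q i : exists q : rat, `|y 0 i - ratr q| < e.
    have [q] := @rat_in_itvoo R (y 0 i - e) (y 0 i + e) ltac:(lra).
    by rewrite in_itv /= => /andP[? ?]; exists q; rewrite ltr_norml; lra.
  have /choice[f Hf] := q.
  exists (\row_i f i, k) => [z /= Hz|i]; last by rewrite /= mxE; exact: Hf.
  have : `|g z - g y| < g y - a.
    apply: Hd; rewrite [ltLHS]mx_normrE.
    apply: (@le_lt_trans _ _ (e *+ 2)); last by rewrite mulr2n; lra.
    apply: bigmax_le => [|[u i] _ /=]; first by rewrite mulrn_wge0// ltW.
    rewrite (ord1 u).
    have := Hz i; have := Hf i; rewrite /= !mxE -/e => h1 h2.
    have -> : z 0 i - tnth t i = (z 0 i - ratr (f i)) - (tnth t i - ratr (f i)) by ring.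
    apply: le_trans (ler_normB _ _) _; rewrite mulr2n; lra.
  by rewrite ltr_norml => /andP[+ _]; lra.
rewrite bigcup_mkcond; apply: countable_bigcupT_measurable => [|p]; first exact: countableP.
case: ifP => // _.
have -> : [set t | box p (row_of_tuple t)] =
    \bigcap_(i in [set: 'I_N]) [set t : N.-tuple (measurableTypeR R) |
      `|tnth t i - ratr (p.1 0 i)| < p.2.+1%:R^-1].
  apply/seteqP; split=> t /= H i; first by have := H i; rewrite mxE.
  by rewrite mxE; exact: H.
apply: fin_bigcap_measurable => // i _.
have mt : measurable_fun setT (fun t : N.-tuple (measurableTypeR R) =>
    (`|tnth t i - ratr (p.1 0 i)| : measurableTypeR R)).
  apply: (@measurableT_comp _ _ _ _ _ _ (@Num.norm R R)); first exact: normr_measurable.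
  by apply: measurable_funB => //; exact: measurable_tnth.
have := mt measurableT `]-oo, p.2.+1%:R^-1[%classic (measurable_itv _).
by rewrite setTI; congr (measurable _); apply/seteqP; split => t /=; rewrite in_itv.
Qed.

End ContinuousMeasurable.

(** * The transform of exp (- eps |x|): the Poisson kernel *)

Section PoissonKernel.
Context {R : realType}.
Variable eps : R.
Hypothesis eps0 : 0 < eps.
Local Notation leb := (@lebesgue_measure R).
Local Notation T n := (n.-tuple (measurableTypeR R)).
Local Notation mu n := (@lebesgue_tuple R n).

Let damp (x : R) := expR (- eps * `|x|).

Let is_derive_lin (c x : R) : is_derive x (1 : R) (fun x : R => c * x) c.
Proof.
have := @is_deriveZ _ _ _ (id : R -> R) c x 1 1 (is_derive_id _ _).
by rewrite /GRing.scale /= mulr1.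
Qed.

Let is_derive_damped (A B C w x : R) :
  is_derive x (1 : R) (fun x => expR (- eps * x) * (A + B * sin (w * x) + C * cos (w * x)))
   (expR (- eps * x) * (- eps * A + (w * B - eps * C) * cos (w * x) - (eps * B + w * C) * sin (w * x))).
Proof.
have d1 : is_derive x (1 : R) (fun x : R => expR (- eps * x)) (expR (- eps * x) * - eps).
  exact: (@is_derive1_comp _ expR (fun x => - eps * x)).
have d2 : is_derive x (1 : R) (fun x : R => sin (w * x)) (cos (w * x) * w).
  exact: (@is_derive1_comp _ sin (fun x => w * x)).
have d3 : is_derive x (1 : R) (fun x : R => cos (w * x)) (- sin (w * x) * w).
  exact: (@is_derive1_comp _ cos (fun x => w * x)).
have d4 : is_derive x (1 : R) (fun x : R => A + B * sin (w * x) + C * cos (w * x))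
    (0 + B * (cos (w * x) * w) + C * (- sin (w * x) * w)).
  by apply: is_deriveD.
have d5 : is_derive x (1 : R)
    (fun x => expR (- eps * x) * (A + B * sin (w * x) + C * cos (w * x))) _ :=
  is_deriveM d1 d4.
by apply: is_derive_eq d5 _; rewrite /GRing.scale /=; ring.
Qed.

Let damped_cvg0 (A B C w : R) :
  (fun x : R => expR (- eps * x) * (A + B * sin (w * x) + C * cos (w * x))) x @[x --> +oo] --> (0 : R).
Proof.
pose D := `|A| + `|B| + `|C|.
have c0 : expR (- (eps * x)) @[x --> +oo] --> (0 : R).
  apply: (@cvg_comp _ _ _ (fun x => eps * x) (fun x => expR (- x))); last exact: cvgr_expR.
  by apply: gt0_cvgMry => //; exact: cvg_id.
have cD : (fun x => D * expR (- (eps * x))) x @[x --> +oo] --> (0 : R).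
  by rewrite -(mulr0 D); apply: cvgMr.
have cN : (fun x => - (D * expR (- (eps * x)))) x @[x --> +oo] --> (0 : R).
  by rewrite -oppr0; apply: cvgN.
apply: (squeeze_cvgr _ cN cD); near=> x; rewrite -ler_norml mulNr normrM mulrC.
rewrite [`|expR _|]ger0_norm ?expR_ge0// ler_wpM2r ?expR_ge0//.
apply: le_trans (ler_normD _ _) _; apply: lerD; last first.
  by rewrite normrM ler_piMr// ler_norml cos_geN1 cos_le1.
apply: le_trans (ler_normD _ _) _; apply: lerD => //.
by rewrite normrM ler_piMr// ler_norml sin_geN1 sin_le1.
Unshelve. all: by end_near. Qed.

(** The constant [a] keeps the integrand nonnegative, as required by the fundamental theorem on a
    half line that is applied. The pure cosine is recovered by subtracting the case [c = 0] from the
    case [a = c = 1]. *)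
Let integral_damped_half (a c w : R) : 0 <= c <= a ->
  (\int[leb]_(x in `[0%R, +oo[) (expR (- eps * x) * (a + c * cos (w * x)))%:E =
   (a / eps + c * eps / (eps ^+ 2 + w ^+ 2))%:E)%E.
Proof.
move=> /andP[c0 ca].
have ew : eps ^+ 2 + w ^+ 2 != 0 by rewrite gt_eqF// ltr_pwDl ?exprn_gt0// sqr_ge0.
pose q := (eps ^+ 2 + w ^+ 2)^-1.
pose F (x : R) := expR (- eps * x) * (- a / eps + (c * w * q) * sin (w * x) + (- c * eps * q) * cos (w * x)).
have dF (x : R) : is_derive x (1 : R) F (expR (- eps * x) * (a + c * cos (w * x))).
  apply: is_derive_eq (is_derive_damped _ _ _ _ _) _.
  congr (_ * _); rewrite /q; field; rewrite ew gt_eqF//.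
have cf (f : R -> R) (f' : R -> R) : (forall x : R, is_derive x (1 : R) f (f' x)) -> continuous f.
  by move=> df x; apply/differentiable_continuous/derivable1_diffP; case: (df x).
rewrite (@ge0_continuous_FTC2y _ _ F 0 0).
- rewrite /F !mulr0 expR0 sin0 cos0 -EFinB mul1r /q; congr (_%:E); field.
  by rewrite ew gt_eqF.
- move=> x _; rewrite mulr_ge0 ?expR_ge0//.
  have : - 1 <= cos (w * x) := cos_geN1 _.
  by move=> /(ler_wpM2l c0); lra.
- apply: continuous_subspaceT.
  apply: (cf _ (fun x => expR (- eps * x) * (- eps * a + (w * 0 - eps * c) * cos (w * x) - (eps * 0 + w * c) * sin (w * x)))).
  move=> x; have := is_derive_damped a 0 c w x; congr is_derive.
  by apply/funext => y; rewrite mul0r addr0.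
- exact: damped_cvg0.
- by move=> x _; case: (dF x).
- by apply: cvg_at_right_filter; exact: cf dF _.
- by move=> x _; rewrite derive1E; case: (dF x).
Qed.

Let continuous_damp_cos (a c w : R) : continuous (fun x : R => damp x * (a + c * cos (w * x))).
Proof.
move=> x; apply: continuousM.
  apply: (@continuous_comp _ _ _ (fun x : R => - eps * `|x|) expR); last exact: continuous_expR.
  by apply: continuousM; [exact: cst_continuous|exact: norm_continuous].
apply: continuousD; first exact: cst_continuous.
apply: continuousM; first exact: cst_continuous.
apply: (@continuous_comp _ _ _ (fun x : R => w * x) cos); last exact: continuous_cos.
by apply: continuousM; [exact: cst_continuous|].
Qed.

Let integral_damped (a c w : R) : 0 <= c <= a ->
  (\int[leb]_x (damp x * (a + c * cos (w * x)))%:E =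
   (2 * (a / eps + c * eps / (eps ^+ 2 + w ^+ 2)))%:E)%E.
Proof.
move=> ca; rewrite ge0_symfun_integralT; last 3 first.
- move=> x; rewrite mulr_ge0 ?expR_ge0//; case/andP: ca => c0 ca.
  have : - 1 <= cos (w * x) := cos_geN1 _.
  by move=> /(ler_wpM2l c0); lra.
- exact: continuous_damp_cos.
- by move=> x; rewrite /= /damp normrN mulrN cosN.
rewrite -set_itvcy [in RHS]EFinM -(integral_damped_half w ca); congr (_ * _)%E.
apply: eq_integral => x; rewrite inE /= in_itv /= andbT => x0.
by rewrite /damp ger0_norm.
Qed.

Let integrable_damp : leb.-integrable setT (EFin \o damp).
Proof.
have E : damp = fun x => damp x * (1 + 0 * cos (0 * x)).
  by apply/funext => x; rewrite mul0r addr0 mulr1.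
apply: ge0_integrable => [|x|]; last 1 first.
- by rewrite E integral_damped ?lexx ?ler01// ltry.
- apply: continuous_measurable_fun; rewrite E; exact: continuous_damp_cos.
- exact: expR_ge0.
Qed.

Let bounded_integrable d (X : measurableType d) (m : {measure set X -> \bar R}) (u v : X -> R) :
  m.-integrable setT (EFin \o u) -> measurable_fun setT v -> (forall x, `|v x| <= 1) ->
  m.-integrable setT (EFin \o (fun x => u x * v x)).
Proof.
move=> iu mv bv; apply: (le_integrable measurableT _ _ iu).
  apply/measurable_EFinP; apply: measurable_funM => //.
  by apply/measurable_EFinP; exact: measurable_int iu.
by move=> x _ /=; rewrite lee_fin normrM ler_piMr.
Qed.

Let measurable_trig (f : R -> R) (w : R) : continuous f -> measurable_fun setT (fun x => f (w * x)).
Proof.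
move=> cf; apply: continuous_measurable_fun => x.
apply: (@continuous_comp _ _ _ (fun x : R => w * x) f); last exact: cf.
by apply: continuousM; [exact: cst_continuous|].
Qed.

Let cos1 (x : R) : `|cos x| <= 1. Proof. by rewrite ler_norml cos_geN1 cos_le1. Qed.
Let sin1 (x : R) : `|sin x| <= 1. Proof. by rewrite ler_norml sin_geN1 sin_le1. Qed.

Let idcos w : leb.-integrable setT (EFin \o (fun x => damp x * cos (w * x))).
Proof.
exact: (@bounded_integrable _ _ leb damp (fun x => cos (w * x)) integrable_damp
  (@measurable_trig cos w (@continuous_cos R)) (fun x => cos1 _)).
Qed.

Let idsin w : leb.-integrable setT (EFin \o (fun x => damp x * sin (w * x))).
Proof.
exact: (@bounded_integrable _ _ leb damp (fun x => sin (w * x)) integrable_damp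
  (@measurable_trig sin w (@continuous_sin R)) (fun x => sin1 _)).
Qed.

Let integral_damp_cos w :
  (\int[leb]_x (damp x * cos (w * x))%:E = (2 * eps / (eps ^+ 2 + w ^+ 2))%:E)%E.
Proof.
have h : (\int[leb]_x (damp x * (1 + 1 * cos (w * x)))%:E =
    \int[leb]_x (damp x)%:E + \int[leb]_x (damp x * cos (w * x))%:E)%E.
  have /= <- := integralD measurableT integrable_damp (idcos w).
  by apply: eq_integral => x _; rewrite -EFinD mul1r mulrDr mulr1.
have h0 : (\int[leb]_x (damp x)%:E = (2 / eps)%:E)%E.
  rewrite -(mul1r eps^-1) -[1 / eps]addr0 -[X in _ + X](mul0r (eps / (eps ^+ 2 + 0 ^+ 2))) [0 * (_ / _)]mulrA.
  rewrite -integral_damped ?lexx ?ler01//.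
  by apply: eq_integral => x _; rewrite mul0r addr0 mulr1.
have ew : eps ^+ 2 + w ^+ 2 != 0 by rewrite gt_eqF// ltr_pwDl ?exprn_gt0// sqr_ge0.
move: h; rewrite h0 integral_damped ?lexx ?ler01//.
have := integrable_fin_num measurableT (idcos w).
rewrite /comp; case: (\int[leb]_x (damp x * cos (w * x))%:E)%E => // r _ [] h.
by congr (_%:E); move: h; rewrite mulrDr mul1r => /addrI <-; rewrite !mul1r mulrA.
Qed.

Let integral_damp_sin w : (\int[leb]_x (damp x * sin (w * x))%:E = 0)%E.
Proof.
pose f (x : R) := (damp x * sin (w * x))%:E.
pose opp (x : measurableTypeR R) : measurableTypeR R := - x.
have mo : measurable_fun setT opp by exact: measurable_funN.
have h1 : (\int[leb]_x f x = \int[leb]_x f (- x)%R)%E.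
  have E : (\int[leb]_x f x = \int[pushforward leb opp]_x f x)%E.
    by apply: eq_measure_integral => A mA _; rewrite -[LHS]lebesgue_measureN.
  rewrite E (@integral_pushforward _ _ _ _ _ _ mo)//.
    by apply: measurable_int (idsin w).
  apply/integrableP; split.
    by apply: measurableT_comp => //; exact: measurable_int (idsin w).
  have /integrableP[_] := idsin (- w).
  rewrite preimage_setT; apply: le_lt_trans; rewrite le_eqVlt; apply/orP; left; apply/eqP.
  have fo x : (f \o opp) x = (damp x * sin (- w * x))%:E.
    by rewrite /f /opp /= /damp normrN [w * - x]mulrN -(mulNr w).
  by apply: eq_integral => x _; rewrite fo.
have h2 : (\int[leb]_x f (- x)%R = - \int[leb]_x f x)%E.
  rewrite -integralN /=; last first.
    exact: (integrable_add_def measurableT (idsin w)).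
  by apply: eq_integral => x _; rewrite /f /damp normrN mulrN sinN mulrN.
have := integrable_fin_num measurableT (idsin w); move: (h1); rewrite h2 -/(f _) /comp -/f.
case: (\int[leb]_x f x)%E => // r [] h _; congr (_%:E); lra.
Qed.

Definition tuple_damp n (t : T n) := \prod_(i < n) damp (tnth t i).

Definition poisson (w : R) := 2 * eps / (eps ^+ 2 + w ^+ 2).

Lemma integrable_tuple_damp n : (mu n).-integrable setT (EFin \o @tuple_damp n).
Proof.
have md : measurable_fun setT damp.
  by apply/measurable_EFinP; exact: measurable_int integrable_damp.
apply: ge0_integrable => [|t|].
- apply: measurable_prod => i _.
  by apply: measurableT_comp => //; exact: measurable_tnth.
- by apply: prodr_ge0 => i _; exact: expR_ge0.
rewrite (@ge0_integral_prod_coord _ n damp (poisson 0)) ?ltry//.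
  by move=> x; exact: expR_ge0.
by rewrite /poisson -integral_damp_cos; apply: eq_integral => x _; rewrite mul0r cos0 mulr1.
Qed.

(** The cosine and the sine are treated together because the addition formulas couple them in the
    induction on the dimension. *)
Lemma integral_tuple_damp n (w : 'I_n -> R) :
  (\int[mu n]_t (tuple_damp t * cos (\sum_(i < n) w i * tnth t i))%:E =
     (\prod_(i < n) poisson (w i))%:E)%E /\
  (\int[mu n]_t (tuple_damp t * sin (\sum_(i < n) w i * tnth t i))%:E = 0)%E.
Proof.
have mphase m (v : 'I_m -> R) : measurable_fun setT (fun t : T m => \sum_(i < m) v i * tnth t i).
  apply: measurable_sum => i; apply: measurable_funM => //; exact: measurable_tnth.
have icos m (v : 'I_m -> R) : (mu m).-integrable setT
    (EFin \o (fun t => tuple_damp t * cos (\sum_(i < m) v i * tnth t i))).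
  apply: bounded_integrable => //; first exact: integrable_tuple_damp.
  apply: (@measurableT_comp _ _ _ _ _ _ (@cos R)); last exact: mphase.
  by apply: continuous_measurable_fun; exact: continuous_cos.
have isin m (v : 'I_m -> R) : (mu m).-integrable setT
    (EFin \o (fun t => tuple_damp t * sin (\sum_(i < m) v i * tnth t i))).
  apply: bounded_integrable => //; first exact: integrable_tuple_damp.
  apply: (@measurableT_comp _ _ _ _ _ _ (@sin R)); last exact: mphase.
  by apply: continuous_measurable_fun; exact: continuous_sin.
elim: n w => [|n IHn] w.
  by rewrite !integral_tuple0 !big_ord0 /tuple_damp big_ord0 cos0 sin0 mulr1 mulr0.
pose v i := w (lift ord0 i); have [IHc IHs] := IHn v.
have dE x t : tuple_damp (tuple_glue (x, t)) = damp x * @tuple_damp n t.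
  rewrite /tuple_damp big_ord_recl tnth0; congr (_ * _).
  by apply: eq_bigr => i _; rewrite tnthS.
have sE x t : \sum_(i < n.+1) w i * tnth (tuple_glue (x, t)) i =
    w ord0 * x + \sum_(i < n) v i * tnth t i.
  rewrite big_ord_recl tnth0; congr (_ + _).
  by apply: eq_bigr => i _; rewrite tnthS.
have lin (a b : R) : (\int[mu n]_t (a * (tuple_damp t * cos (\sum_(i < n) v i * tnth t i)) +
    b * (tuple_damp t * sin (\sum_(i < n) v i * tnth t i)))%:E =
    a%:E * (\prod_(i < n) poisson (v i))%:E)%E.
  have /= := integralD measurableT (integrableZl measurableT a (icos n v))
    (integrableZl measurableT b (isin n v)).
  rewrite (integralZl measurableT (icos n v)) (integralZl measurableT (isin n v)) IHc IHs.
  by rewrite mule0 adde0 => <-; apply: eq_integral => t _; rewrite EFinD !EFinM.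
rewrite (integral_step (icos _ w)) (integral_step (isin _ w)); split.
  transitivity (\int[leb]_x ((damp x * cos (w ord0 * x))%:E * (\prod_(i < n) poisson (v i))%:E))%E.
    apply: eq_integral => x _; rewrite -(lin _ (- (damp x * sin (w ord0 * x)))).
    apply: eq_integral => t _; congr (_%:E); rewrite dE sE cosD; ring.
  rewrite integralZr//; last exact: idcos.
  by rewrite integral_damp_cos -EFinM big_ord_recl.
transitivity (\int[leb]_x ((damp x * sin (w ord0 * x))%:E * (\prod_(i < n) poisson (v i))%:E))%E.
  apply: eq_integral => x _; rewrite -(lin _ (damp x * cos (w ord0 * x))).
  apply: eq_integral => t _; congr (_%:E); rewrite dE sE sinD; ring.
rewrite integralZr//; last exact: idsin.
by rewrite integral_damp_sin mul0e.
Qed.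

End PoissonKernel.

(** * Second-order remainders along a direction *)

Section SecondOrder.
Context {R : realType} {V : normedModType R}.

Lemma mean_value_signed (u : V -> R) v x (l : V -> R) (h : R) :
  (forall y, is_derive y v u (l y)) ->
  exists2 c, `|c| <= `|h| & u (x + h *: v) - u x = h * l (x + c *: v).
Proof.
move=> du; have [h0|h0] := leP 0 h.
  have [c /andP[c0 ch] ->] := mean_value x h0 du.
  by exists c => //; rewrite !ger0_norm.
have h0' : 0 <= - h by rewrite oppr_ge0 ltW.
have [c /andP[c0 ch]] := mean_value (x + h *: v) h0' du.
rewrite scaleNr addrK -addrA -scalerDl => E.
exists (h + c); first by rewrite (ler0_norm (ltW h0)) ler0_norm; lra.
by rewrite -opprB E mulNr opprK.
Qed.

(** Two applications of the mean value theorem; the factor 1/2 of Taylor's formula is given up. *)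
Lemma second_order_bound (u u1 u2 : V -> R) v x (h B : R) :
  (forall y, is_derive y v u (u1 y)) -> (forall y, is_derive y v u1 (u2 y)) ->
  (forall c, `|c| <= `|h| -> `|u2 (x + c *: v)| <= B) ->
  `|u (x + h *: v) - u x - h * u1 x| <= B * h ^+ 2.
Proof.
move=> d1 d2 bB.
have [c ch ->] := mean_value_signed x h d1.
have [c' cc E] := mean_value_signed x c d2.
rewrite -mulrBr E mulrA !normrM.
have B0 : 0 <= B := le_trans (normr_ge0 _) (bB c' (le_trans cc ch)).
rewrite -[h ^+ 2]real_normK ?num_real// expr2 [leRHS]mulrC.
apply: ler_pM; rewrite ?mulr_ge0//; last by apply: bB; exact: le_trans ch.
by rewrite ler_wpM2l.
Qed.

End SecondOrder.

Section RealContinuity.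
Context {R : realType}.

Lemma fun_cst_continuous (T : topologicalType) (c : R) : continuous (fun _ : T => c).
Proof. by move=> x; exact: cst_continuous. Qed.

Lemma fun_continuousD (T : topologicalType) (f g : T -> R) :
  continuous f -> continuous g -> continuous (fun y => f y + g y).
Proof. by move=> cf cg x; apply: continuousD; [exact: cf|exact: cg]. Qed.

Lemma fun_continuousM (T : topologicalType) (f g : T -> R) :
  continuous f -> continuous g -> continuous (fun y => f y * g y).
Proof. by move=> cf cg x; apply: continuousM; [exact: cf|exact: cg]. Qed.

Lemma fun_continuousZ (T : topologicalType) (c : R) (f : T -> R) :
  continuous f -> continuous (fun y => c * f y).
Proof. by apply: fun_continuousM; exact: fun_cst_continuous. Qed.

Lemma fun_continuousV (T : topologicalType) (f : T -> R) : (forall y, 0 < f y) ->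
  continuous f -> continuous (fun y => (f y)^-1).
Proof. by move=> f0 cf x; apply: continuousV; [rewrite gt_eqF|exact: cf]. Qed.

Lemma fun_continuous_comp (T U : topologicalType) (f : T -> U) (g : U -> R) :
  continuous f -> continuous g -> continuous (fun y => g (f y)).
Proof. by move=> cf cg x; apply: continuous_comp; [exact: cf|exact: cg]. Qed.

Lemma fun_continuous_prod (T : topologicalType) (I : Type) (r : seq I) (f : I -> T -> R) :
  (forall i, continuous (f i)) -> continuous (fun y => \prod_(i <- r) f i y).
Proof.
move=> cf; elim: r => [|i r IHr].
  rewrite (_ : (fun y => _) = fun=> 1); first exact: fun_cst_continuous.
  by apply/funext => z; rewrite big_nil.
rewrite (_ : (fun y => _) = fun y => f i y * \prod_(i <- r) f i y).
  exact: fun_continuousM.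
by apply/funext => z; rewrite big_cons.
Qed.

Lemma fun_continuous_sum (T : topologicalType) (I : Type) (r : seq I) (f : I -> T -> R) :
  (forall i, continuous (f i)) -> continuous (fun y => \sum_(i <- r) f i y).
Proof.
move=> cf; elim: r => [|i r IHr].
  rewrite (_ : (fun y => _) = fun=> 0); first exact: fun_cst_continuous.
  by apply/funext => z; rewrite big_nil.
rewrite (_ : (fun y => _) = fun y => f i y + \sum_(i <- r) f i y).
  exact: fun_continuousD.
by apply/funext => z; rewrite big_cons.
Qed.

Lemma affine_continuous (V : normedModType R) (a : R) (b : V) :
  continuous (fun y : V => a *: y + b).
Proof.
move=> y; apply: (@cvgD _ V _ _ _ (fun y : V => a *: y) (fun=> b)); last exact: cvg_cst.
by apply: cvgZr; exact: cvg_id.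
Qed.

End RealContinuity.

(** * Integrals dominated by a product of Cauchy densities *)

Section RealIntegration.
Context {R : realType} {N : nat}.
Local Notation RN := 'rV[R]_N.
Local Notation e_ i := (delta_mx 0 i : RN).
Local Notation mu := (@lebesgue_tuple R N).
Local Notation row := (@row_of_tuple R N).
Implicit Types (u v : RN -> R) (x xi : RN).

Definition rint u : R := \int[mu]_t u (row t).

(* Integrable on R^N, so that its powers can serve as dominating functions. *)
Definition cauchy x : R := \prod_i (1 + x 0 i ^+ 2)^-1.

Let den_ge1 (a : R) : 1 <= 1 + a ^+ 2. Proof. by rewrite lerDl sqr_ge0. Qed.
Let den_gt0 (a : R) : 0 < 1 + a ^+ 2. Proof. exact: lt_le_trans (den_ge1 a). Qed.

Lemma cauchy_gt0 x : 0 < cauchy x.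
Proof. by apply: prodr_gt0 => i _; rewrite invr_gt0. Qed.

Lemma cauchy_le x i : (1 + x 0 i ^+ 2) * cauchy x <= 1.
Proof.
rewrite /cauchy (bigD1 i)//= mulrA divff ?gt_eqF// mul1r.
apply: prodr_ile1 => j _; rewrite invr_ge0 (ltW (den_gt0 _)) /=.
by rewrite invf_le1.
Qed.

Lemma cauchy_le1 x : cauchy x <= 1.
Proof.
apply: prodr_ile1 => j _; rewrite invr_ge0 (ltW (den_gt0 _)) /=.
by rewrite invf_le1.
Qed.

Lemma cauchy_sqr_coord x i : x 0 i ^+ 2 * cauchy x <= 1.
Proof. by have := cauchy_le x i; have := cauchy_gt0 x; lra. Qed.

Lemma cauchy_coord x i : `|x 0 i| * cauchy x <= 1.
Proof.
apply: le_trans (cauchy_le x i); rewrite ler_wpM2r ?(ltW (cauchy_gt0 _))//.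
rewrite -[x 0 i ^+ 2]real_normK ?num_real//.
have := sqr_ge0 (`|x 0 i| - 1); rewrite sqrrB; have : 0 <= `|x 0 i| by []. lra.
Qed.

(** The constant comes from [1 + a ^ 2 <= 3 (1 + (a + c) ^ 2)] for [|c| <= 1]. *)
Lemma cauchy_translate x i (c : R) : `|c| <= 1 -> cauchy (x + c *: e_ i) <= 3 * cauchy x.
Proof.
move=> c1; rewrite /cauchy (bigD1 i)//= [in leRHS](bigD1 i)//= mulrA.
have -> : \prod_(j < N | j != i) (1 + (x + c *: e_ i) 0 j ^+ 2)^-1 =
          \prod_(j < N | j != i) (1 + x 0 j ^+ 2)^-1.
  by apply: eq_bigr => j /negbTE ji; rewrite !mxE eqxx ji mulr0 addr0.
apply: ler_wpM2r; first by apply: prodr_ge0 => j _; rewrite invr_ge0 ltW.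
rewrite !mxE !eqxx mulr1 ler_pdivlMr// ler_pdivrMl//.
have : c ^+ 2 <= 1 by rewrite -real_normK ?num_real// exprn_ile1.
have := sqr_ge0 (x 0 i + 2 * c); nra.
Qed.

Lemma continuous_coord i : continuous (fun x : RN => x 0 i).
Proof. exact: coord_continuous. Qed.

Lemma continuous_cauchy : continuous cauchy.
Proof.
apply: fun_continuous_prod => i; apply: fun_continuousV => [x|]; first exact: den_gt0.
apply: fun_continuousD; first exact: fun_cst_continuous.
by apply: fun_continuousM; exact: continuous_coord.
Qed.

Lemma continuous_dotrv xi : continuous (fun x => dotrv x xi).
Proof.
apply: fun_continuous_sum => i; apply: fun_continuousM; last exact: fun_cst_continuous.
exact: continuous_coord.
Qed.

Let integral_cauchy1 : (\int[@lebesgue_measure R]_x ((1 + x ^+ 2)^-1)%:E = pi%:E)%E.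
Proof.
have c1 : continuous (fun x : R => (1 + x ^+ 2)^-1) by exact: continuous_oneDsqrV.
rewrite (ge0_symfun_integralT _ c1); last 2 first.
- by move=> x; rewrite invr_ge0 ltW.
- by move=> x; rewrite /= sqrrN.
have := @integral0y_oneDsqr R; rewrite -set_itvcy /oneDsqr => ->.
by rewrite -EFinM mulrC divfK.
Qed.

Let integral_cauchy : (\int[mu]_t (cauchy (row t))%:E = (pi ^+ N)%:E)%E.
Proof.
rewrite -(@ge0_integral_prod_coord R N (fun a : R => (1 + a ^+ 2)^-1) pi).
- by apply: eq_integral => t _; congr (_%:E); apply: eq_bigr => i _; rewrite mxE.
- by apply: continuous_measurable_fun; exact: continuous_oneDsqrV.
- by move=> x; rewrite invr_ge0 ltW.
- exact: integral_cauchy1.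
Qed.

Lemma integrable_cauchy : mu.-integrable setT (fun t => (cauchy (row t))%:E).
Proof.
apply: ge0_integrable => [|t|].
- exact: continuous_measurable_row continuous_cauchy.
- exact/ltW/cauchy_gt0.
- by rewrite integral_cauchy ltry.
Qed.

Lemma rint_cauchy : rint cauchy = pi ^+ N.
Proof. by rewrite /rint /Rintegral integral_cauchy. Qed.

Lemma integrable_dominated u C : continuous u -> (forall x, `|u x| <= C * cauchy x) ->
  mu.-integrable setT (fun t => (u (row t))%:E).
Proof.
move=> cu uC; have iC := integrableZl measurableT C integrable_cauchy.
apply: (le_integrable measurableT _ _ iC).
  by apply/measurable_EFinP; exact: continuous_measurable_row cu.
move=> t _ /=; rewrite lee_fin; apply: le_trans (uC _) _.
exact: ler_norm.
Qed.

Lemma rint_bound u C : continuous u -> (forall x, `|u x| <= C * cauchy x) ->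
  `|rint u| <= C * pi ^+ N.
Proof.
move=> cu uC; have iu := integrable_dominated cu uC.
have iC := integrableZl measurableT C integrable_cauchy.
rewrite -rint_cauchy /rint -RintegralZl//; last exact: integrable_cauchy.
apply: le_trans (le_normr_Rintegral measurableT iu) _.
apply: le_Rintegral => //.
exact: (integrable_abse iu).
Qed.

Lemma rint_comb (a b : R) u v C D : continuous u -> (forall x, `|u x| <= C * cauchy x) ->
  continuous v -> (forall x, `|v x| <= D * cauchy x) ->
  rint (fun x => a * u x + b * v x) = a * rint u + b * rint v.
Proof.
move=> cu uC cv vD; have iu := integrable_dominated cu uC.
have iv := integrable_dominated cv vD.
rewrite /rint RintegralD//=; [|exact: integrableZl iu|exact: integrableZl iv].
by rewrite !RintegralZl.
Qed.

Lemma rint_affine (a : R) (b : RN) u C : 0 < a ->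
  continuous u -> (forall x, `|u x| <= C * cauchy x) ->
  rint u = a ^+ N * rint (fun x => u (a *: x + b)).
Proof.
move=> a0 cu uC; have iu := integrable_dominated cu uC.
pose b' k := if insub k is Some i then b 0 (i : 'I_N) else 0.
have E t : row (tuple_affine a b' t) = a *: row t + b.
  by apply/rowP => i; rewrite !mxE tnth_mktuple /b' valK.
rewrite /rint /Rintegral (integral_affine b' a0 iu).
have := integrable_affine b' a0 iu => iu'.
have -> : (\int[mu]_x (u (row (tuple_affine a b' x)))%:E =
    \int[mu]_x (u (a *: row x + b))%:E)%E.
  by apply: eq_integral => t _; rewrite E.
by rewrite fineM// -?E//; have := integrable_fin_num measurableT iu';
  congr (_ \is a fin_num); apply: eq_integral => t _; rewrite /= E.
Qed.

(** By translation invariance the integral of [u (x + h e_i) - u x] vanishes, and it differs from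
    [h] times the integral of [u1] by a term of order [h ^ 2]. Iterated integrals are avoided at the
    price of a bound on the second derivative. *)
Lemma rint_derivative u u1 u2 C i :
  (forall x, is_derive x (e_ i) u (u1 x)) -> (forall x, is_derive x (e_ i) u1 (u2 x)) ->
  continuous u -> continuous u1 ->
  (forall x, `|u x| <= C * cauchy x) -> (forall x, `|u1 x| <= C * cauchy x) ->
  (forall x, `|u2 x| <= C * cauchy x) -> rint u1 = 0.
Proof.
move=> d1 d2 cu cu1 bu bu1 bu2.
have C0 : 0 <= C.
  by have := le_trans (normr_ge0 _) (bu 0); rewrite pmulr_lge0// cauchy_gt0.
have csh (h : R) : continuous (fun x => u (1 *: x + h *: e_ i)).
  apply: (fun_continuous_comp (f := fun x : RN => 1 *: x + h *: e_ i)) cu.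
  exact: affine_continuous.
have bsh (h : R) x : `|h| <= 1 -> `|u (1 *: x + h *: e_ i)| <= C * 3 * cauchy x.
  move=> h1; rewrite scale1r; apply: le_trans (bu _) _.
  by rewrite -mulrA ler_wpM2l// cauchy_translate.
have key (h : R) : 0 < h <= 1 -> h * `|rint u1| <= C * 3 * h ^+ 2 * pi ^+ N.
  move=> /andP[h0 h1]; have nh : `|h| <= 1 by rewrite (ger0_norm (ltW h0)).
  pose w x := 1 * (1 * u (1 *: x + h *: e_ i) + (- 1) * u x) + (- h) * u1 x.
  have cw1 : continuous (fun x => 1 * u (1 *: x + h *: e_ i) + (- 1) * u x).
    by apply: fun_continuousD; apply: fun_continuousZ => //; exact: csh.
  have cw : continuous w by apply: fun_continuousD; exact: fun_continuousZ.
  have bw1 x : `|1 * u (1 *: x + h *: e_ i) + (- 1) * u x| <= (C * 3 + C) * cauchy x.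
    apply: le_trans (ler_normD _ _) _; rewrite mulrDl mul1r mulN1r normrN.
    by apply: lerD => //; exact: bsh.
  have bw x : `|w x| <= (C * 3 * h ^+ 2) * cauchy x.
    rewrite /w mul1r mul1r mulN1r scale1r mulNr.
    have := second_order_bound (x := x) (h := h) (B := C * 3 * cauchy x) d1 d2.
    rewrite [C * 3 * h ^+ 2 * _]mulrAC; apply => c ch.
    apply: le_trans (bu2 _) _; rewrite -mulrA ler_wpM2l//.
    by apply: cauchy_translate; exact: le_trans ch nh.
  have := rint_bound cw bw.
  rewrite /w (rint_comb 1 (- h) cw1 bw1 cu1 bu1).
  rewrite (rint_comb 1 (- 1) (csh h) (fun x => bsh h x nh) cu bu).
  have := rint_affine (h *: e_ i) ltr01 cu bu; rewrite expr1n mul1r => <-.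
  by rewrite mul1r mulN1r subrr add0r mulNr normrN normrM (ger0_norm (ltW h0)).
apply/eqP; rewrite -normr_le0; apply/ler_addgt0Pl => e e0; rewrite addr0.
pose D := C * 3 * pi ^+ N.
have D0 : 0 <= D by rewrite !mulr_ge0// exprn_ge0// ltW// pi_gt0.
pose h := Num.min 1 (e / (D + 1)).
have h0 : 0 < h by rewrite lt_min ltr01 divr_gt0// ltr_wpDl.
have h1 : h <= 1 by rewrite ge_min lexx.
have h2 : h * (D + 1) <= e by rewrite -ler_pdivlMr ?ltr_wpDl// ge_min lexx orbT.
have := key h; rewrite h0 h1 => /(_ isT).
have -> : C * 3 * h ^+ 2 * pi ^+ N = h * (D * h) by rewrite /D; ring.
rewrite ler_pM2l// => /le_trans; apply; lra.
Qed.

End RealIntegration.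

(** * Cosine transforms *)

Section CosineTransform.
Context {R : realType} {N : nat}.
Local Notation RN := 'rV[R]_N.
Local Notation e_ i := (delta_mx 0 i : RN).
Local Notation mu := (@lebesgue_tuple R N).
Local Notation row := (@row_of_tuple R N).
Implicit Types (u v : RN -> R) (x xi : RN) (th : R) (s : seq 'I_N).

(* The real phase [th] treats the cosine and the sine transforms uniformly. *)
Definition costrans th u : RN -> R := fun xi => rint (fun x => u x * cos (dotrv x xi + th)).

Lemma dotrvDr x xi (h : R) i : dotrv x (xi + h *: e_ i) = dotrv x xi + h * x 0 i.
Proof.
rewrite /dotrv (bigD1 i)//= [in RHS](bigD1 i)//= !mxE !eqxx mulr1.
have -> : \sum_(j < N | j != i) x 0 j * (xi + h *: e_ i) 0 j = \sum_(j < N | j != i) x 0 j * xi 0 j.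
  by apply: eq_bigr => j /negbTE ji; rewrite !mxE eqxx ji mulr0 addr0.
ring.
Qed.

Lemma dotrvC x xi : dotrv x xi = dotrv xi x.
Proof. by apply: eq_bigr => i _; rewrite mulrC. Qed.

Lemma norm_cos_le1 (a : R) : `|cos a| <= 1.
Proof. by rewrite ler_norml cos_geN1 cos_le1. Qed.

Lemma continuous_cos_phase th xi : continuous (fun x : RN => cos (dotrv x xi + th)).
Proof.
apply: (fun_continuous_comp (f := fun x : RN => dotrv x xi + th)); last exact: continuous_cos.
by apply: fun_continuousD; [exact: continuous_dotrv|exact: fun_cst_continuous].
Qed.

(** Differentiating the cosine is written as a phase shift, so that derivatives of a [costrans] are
    again of that form. *)
Lemma cos_second_order (a h : R) : `|cos (a + h) - cos a - h * cos (a + pi / 2)| <= h ^+ 2.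
Proof.
have dc (b y : R) : is_derive y (1 : R) (fun y => cos (y + b)) (cos (y + (b + pi / 2))).
  rewrite addrA cosDpihalf.
  have d1 : is_derive y (1 : R) (fun y : R => y + b) (1 + 0) by exact: is_deriveD.
  have := @is_derive1_comp _ cos (fun y => y + b) y _ _ (is_derive_cos _) d1.
  by rewrite addr0 mulr1.
have := @second_order_bound _ _ (fun y => cos (y + 0)) (fun y => cos (y + (0 + pi / 2)))
  (fun y => cos (y + (0 + pi / 2 + pi / 2))) 1 a h 1 (dc _) (dc _) (fun _ _ => norm_cos_le1 _).
by rewrite !addr0 !add0r mul1r [h *: _]mulr1.
Qed.

Lemma costrans_bound u C th xi : continuous u -> (forall x, `|u x| <= C * cauchy x) ->
  `|costrans th u xi| <= C * pi ^+ N.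
Proof.
move=> cu bu; apply: rint_bound.
  by apply: fun_continuousM => //; exact: continuous_cos_phase.
by move=> x; rewrite normrM; apply: le_trans (bu x); rewrite ler_piMr// norm_cos_le1.
Qed.

(** The remainder under the integral is at most [h ^ 2 x_i ^ 2 |u|]: one factor [cauchy] absorbs
    [x_i ^ 2], the other leaves an integrable bound. *)
Lemma is_derive_costrans u C th i xi : continuous u ->
  (forall x, `|u x| <= C * cauchy x ^+ 2) ->
  is_derive xi (e_ i) (costrans th u) (costrans (th + pi / 2) (fun x => x 0 i * u x) xi).
Proof.
move=> cu bu.
have C0 : 0 <= C.
  by have := le_trans (normr_ge0 _) (bu 0); rewrite pmulr_lge0// exprn_gt0// cauchy_gt0.
have c0 x : 0 <= cauchy x by exact/ltW/cauchy_gt0.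
have bu1 x : `|u x| <= C * cauchy x.
  by apply: le_trans (bu x) _; rewrite expr2 mulrA ler_piMr ?mulr_ge0// cauchy_le1.
have cxu : continuous (fun x : RN => x 0 i * u x).
  by apply: fun_continuousM => //; exact: continuous_coord.
have bxu x : `|x 0 i * u x| <= C * cauchy x.
  rewrite normrM; apply: (@le_trans _ _ (`|x 0 i| * (C * cauchy x ^+ 2))).
    by rewrite ler_wpM2l.
  have := cauchy_coord x i; move/(ler_wpM2l (mulr_ge0 C0 (c0 x))); rewrite mulr1.
  by apply: le_trans; rewrite le_eqVlt; apply/orP; left; apply/eqP; ring.
have cph p x : `|u x * cos (dotrv x xi + p)| <= C * cauchy x.
  by rewrite normrM; apply: le_trans (bu1 x); rewrite ler_piMr// norm_cos_le1.
apply: (@is_derive_quadratic _ _ _ _ _ _ (C * pi ^+ N)) => h _.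
have cu' p eta : continuous (fun x : RN => u x * cos (dotrv x eta + p)).
  by apply: fun_continuousM => //; exact: continuous_cos_phase.
have bu' p eta x : `|u x * cos (dotrv x eta + p)| <= C * cauchy x.
  by rewrite normrM; apply: le_trans (bu1 x); rewrite ler_piMr// norm_cos_le1.
have cxu' p eta : continuous (fun x : RN => x 0 i * u x * cos (dotrv x eta + p)).
  by apply: fun_continuousM => //; exact: continuous_cos_phase.
have bxu' p eta x : `|x 0 i * u x * cos (dotrv x eta + p)| <= C * cauchy x.
  by rewrite normrM; apply: le_trans (bxu x); rewrite ler_piMr// norm_cos_le1.
have E1 := rint_comb 1 (-1) (cu' th (h *: e_ i + xi)) (bu' th (h *: e_ i + xi)) (cu' th xi) (bu' th xi).
pose w x := 1 * (u x * cos (dotrv x (h *: e_ i + xi) + th)) + (-1) * (u x * cos (dotrv x xi + th)).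
have cw : continuous w by apply: fun_continuousD; apply: fun_continuousZ; exact: cu'.
have bw x : `|w x| <= (C + C) * cauchy x.
  by apply: le_trans (ler_normD _ _) _; rewrite mul1r mulN1r normrN mulrDl lerD.
have E2 := rint_comb 1 (- h) cw bw (cxu' (th + pi / 2) xi) (bxu' (th + pi / 2) xi).
have -> : costrans th u (h *: e_ i + xi) - costrans th u xi - h *
    costrans (th + pi / 2) (fun x => x 0 i * u x) xi =
    rint (fun x => 1 * w x + - h * (x 0 i * u x * cos (dotrv x xi + (th + pi / 2)))).
  by rewrite E2 E1 /costrans !mul1r mulN1r mulNr.
have -> : C * pi ^+ N * h ^+ 2 = C * h ^+ 2 * pi ^+ N by ring.
apply: rint_bound => [|x].
  by apply: fun_continuousD; apply: fun_continuousZ => //; exact: cxu'.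
rewrite /w [h *: _ + _]addrC dotrvDr.
have -> : 1 * (1 * (u x * cos (dotrv x xi + h * x 0 i + th)) + -1 * (u x * cos (dotrv x xi + th))) +
    - h * (x 0 i * u x * cos (dotrv x xi + (th + pi / 2))) =
    u x * (cos (dotrv x xi + th + h * x 0 i) - cos (dotrv x xi + th) -
    h * x 0 i * cos (dotrv x xi + th + pi / 2)).
  by rewrite [dotrv x xi + _ + th]addrAC [_ + (th + _)]addrA; ring.
rewrite normrM; apply: (@le_trans _ _ (C * cauchy x ^+ 2 * (h * x 0 i) ^+ 2)).
  by apply: ler_pM => //; exact: cos_second_order.
have := cauchy_sqr_coord x i; move/(ler_wpM2l (mulr_ge0 (mulr_ge0 C0 (sqr_ge0 h)) (c0 x))).
rewrite mulr1; apply: le_trans; rewrite le_eqVlt; apply/orP; left; apply/eqP; ring.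
Qed.

Lemma costrans_derivative u u1 u2 C th i xi :
  (forall x, is_derive x (e_ i) u (u1 x)) -> (forall x, is_derive x (e_ i) u1 (u2 x)) ->
  continuous u -> continuous u1 ->
  (forall x, `|u x| <= C * cauchy x) -> (forall x, `|u1 x| <= C * cauchy x) ->
  (forall x, `|u2 x| <= C * cauchy x) ->
  costrans th u1 xi = - (xi 0 i * costrans (th + pi / 2) u xi).
Proof.
move=> d1 d2 cu cu1 bu bu1 bu2.
pose c p (x : RN) := cos (dotrv x xi + p).
have dc p x : is_derive x (e_ i) (c p) (xi 0 i * c (p + pi / 2) x).
  apply: (@is_derive_quadratic _ _ _ _ _ _ (xi 0 i ^+ 2)) => h _.
  have Ec : dotrv (h *: e_ i + x) xi = dotrv x xi + h * xi 0 i.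
    by rewrite dotrvC addrC dotrvDr dotrvC.
  rewrite /c Ec [dotrv x xi + _ + p]addrAC [dotrv x xi + (p + _)]addrA mulrA.
  by rewrite -exprMn [xi 0 i * h]mulrC; exact: cos_second_order.
have cc p : continuous (c p) by exact: continuous_cos_phase.
have nc p x : `|c p x| <= 1 by exact: norm_cos_le1.
have C0 : 0 <= C.
  by have := le_trans (normr_ge0 _) (bu 0); rewrite pmulr_lge0// cauchy_gt0.
have c0 x : 0 <= cauchy x by exact/ltW/cauchy_gt0.
have dM (f f1 : RN -> R) p : (forall x, is_derive x (e_ i) f (f1 x)) ->
    forall x, is_derive x (e_ i) (fun x => f x * c p x) (f1 x * c p x + xi 0 i * (f x * c (p + pi / 2) x)).
  move=> df x.
  have dm : is_derive x (e_ i) (fun x => f x * c p x) _ := is_deriveM (df x) (dc p x).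
  by apply: is_derive_eq dm _; rewrite /GRing.scale /=; ring.
pose v1 x := 1 * (u1 x * c th x) + xi 0 i * (u x * c (th + pi / 2) x).
pose v2 x := (u2 x * c th x + xi 0 i * (u1 x * c (th + pi / 2) x)) +
  xi 0 i * (u1 x * c (th + pi / 2) x + xi 0 i * (u x * c (th + pi / 2 + pi / 2) x)).
have bM (f : RN -> R) p x : (forall x, `|f x| <= C * cauchy x) -> `|f x * c p x| <= C * cauchy x.
  by move=> bf; rewrite normrM; apply: le_trans (bf x); rewrite ler_piMr.
have cM (f : RN -> R) p : continuous f -> continuous (fun x => f x * c p x).
  by move=> cf; exact: fun_continuousM.
pose a := `|xi 0 i|; have a0 : 0 <= a := normr_ge0 _.
(* Each derivative that falls on the cosine costs a factor [a]; this constant dominates the product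
   and its first two derivatives, as [rint_derivative] requires. *)
pose D := C * (1 + a) ^+ 2.
have le_D (b : R) x : b <= (1 + a) ^+ 2 -> C * cauchy x * b <= D * cauchy x.
  move=> h; have := ler_wpM2l (mulr_ge0 C0 (c0 x)) h; rewrite /D.
  by rewrite [C * _ * cauchy x]mulrAC.
have : rint v1 = 0.
  apply: (@rint_derivative _ _ (fun x => u x * c th x) v1 v2 D i).
  - by move=> x; apply: is_derive_eq (dM _ _ th d1 x) _; rewrite /v1 mul1r.
  - move=> x; have dv1 : is_derive x (e_ i) v1 _ :=
      is_deriveD (is_deriveZ 1 (dM _ _ th d2 x)) (is_deriveZ (xi 0 i) (dM _ _ (th + pi / 2) d1 x)).
    by apply: is_derive_eq dv1 _; rewrite scale1r.
  - exact: cM.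
  - by apply: fun_continuousD; apply: fun_continuousZ; exact: cM.
  - move=> x; apply: le_trans (bM _ _ _ bu) _; rewrite -[X in X <= _]mulr1.
    by apply: le_D; rewrite expr2; nra.
  - move=> x; apply: le_trans (ler_normD _ _) _; rewrite mul1r [`|xi 0 i * _|]normrM -/a.
    have h1 := bM _ th x bu1; have h2 := ler_wpM2l a0 (bM _ (th + pi / 2) x bu).
    apply: le_trans (lerD h1 h2) _; apply: le_trans (le_D (1 + a) x _); first lra.
    by rewrite expr2; nra.
  - move=> x; apply: le_trans (ler_normD _ _) _; rewrite [`|xi 0 i * _|]normrM -/a.
    have h1 := bM _ th x bu2; have h2 := ler_wpM2l a0 (bM _ (th + pi / 2) x bu1).
    have h3 := ler_wpM2l a0 (bM _ (th + pi / 2 + pi / 2) x bu).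
    have h4 := ler_normD (u2 x * c th x) (xi 0 i * (u1 x * c (th + pi / 2) x)).
    have h5 := ler_normD (u1 x * c (th + pi / 2) x) (xi 0 i * (u x * c (th + pi / 2 + pi / 2) x)).
    rewrite [`|xi 0 i * _|]normrM -/a in h4; rewrite [`|xi 0 i * _|]normrM -/a in h5.
    have h6 := bM _ (th + pi / 2) x bu1.
    have h7 := ler_wpM2l a0 (le_trans h5 (lerD h6 h3)).
    apply: le_trans (lerD (le_trans h4 (lerD h1 h2)) h7) _.
    apply: le_trans (le_D (1 + a + a * (1 + a)) x _); first lra.
    by rewrite expr2; nra.
rewrite /v1 (rint_comb _ _ (cM _ _ cu1) (fun x => bM _ _ x bu1) (cM _ _ cu) (fun x => bM _ _ x bu)).
by rewrite mul1r => /eqP; rewrite addr_eq0 => /eqP.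
Qed.

Definition monomial s x := \prod_(i <- s) x 0 i.

Lemma continuous_monomial s : continuous (monomial s).
Proof. by apply: fun_continuous_prod => i; exact: continuous_coord. Qed.

Lemma monomial_cauchy s x : `|monomial s x| * cauchy x ^+ size s <= 1.
Proof.
have c0 : 0 <= cauchy x by exact/ltW/cauchy_gt0.
elim: s => [|i s IHs]; first by rewrite /monomial big_nil normr1 expr0 mulr1.
rewrite /monomial big_cons -/(monomial s x) normrM exprS mulrACA.
by apply: mulr_ile1; rewrite ?mulr_ge0 ?exprn_ge0// cauchy_coord.
Qed.

Definition rapid u := continuous u /\ forall n, exists C, forall x, `|u x| <= C * cauchy x ^+ n.

Lemma rapid_monomial s u : rapid u -> rapid (fun x => monomial s x * u x).
Proof.
move=> [cu ru]; split; first by apply: fun_continuousM => //; exact: continuous_monomial.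
move=> n; have [C HC] := ru (size s + n)%N; exists C => x.
have c0 k : 0 <= cauchy x ^+ k by rewrite exprn_ge0// ltW// cauchy_gt0.
rewrite normrM; apply: (@le_trans _ _ (`|monomial s x| * (C * cauchy x ^+ (size s + n)))).
  by rewrite ler_wpM2l.
have C0 : 0 <= C * cauchy x ^+ n.
  rewrite mulr_ge0// ; have := le_trans (normr_ge0 _) (HC x).
  by rewrite pmulr_lge0// exprn_gt0// cauchy_gt0.
have := ler_wpM2l C0 (monomial_cauchy s x); rewrite mulr1; apply: le_trans.
by rewrite exprD le_eqVlt; apply/orP; left; apply/eqP; ring.
Qed.

Lemma rapid_dominated u : rapid u -> exists C, forall x, `|u x| <= C * cauchy x.
Proof. by move=> [_ /(_ 1%N)[C HC]]; exists C => x; rewrite -[cauchy x]expr1. Qed.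

Lemma smooth_costrans u : rapid u -> forall th, smooth_real (costrans th u) /\
  forall s, exists th', partials s (costrans th u) = costrans th' (fun x => monomial s x * u x).
Proof.
move=> ru th.
pose F (a : R * seq 'I_N) := costrans a.1 (fun x => monomial a.2 x * u x).
pose D i (a : R * seq 'I_N) := (a.1 + pi / 2, i :: a.2).
have /choice[B HB] : forall a : R * seq 'I_N, exists B, forall xi, `|F a xi| <= B.
  move=> a; have ra := rapid_monomial a.2 ru; have [C HC] := rapid_dominated ra.
  by exists (C * pi ^+ N) => xi; apply: costrans_bound => //; case: ra.
have dF a i xi : is_derive xi (e_ i) (F a) (F (D i a) xi).
  have [ca ra] := rapid_monomial a.2 ru; have [C HC] := ra 2%N.
  have := is_derive_costrans a.1 i xi ca HC; rewrite /F /D /=.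
  by congr is_derive; congr (costrans _ _ _); apply/funext => x; rewrite /monomial big_cons mulrA.
have E : costrans th u = F (th, [::]).
  by rewrite /F; congr (costrans _ _); apply/funext => x; rewrite /monomial big_nil mul1r.
have [sF pF] := smooth_family dF HB (th, [::]).
rewrite E; split=> // s; exists (foldr D (th, [::]) s).1.
rewrite pF {1}/F; congr (costrans _ _); apply/funext => x; congr (monomial _ _ * _).
by elim: s => //= i s ->.
Qed.

Definition schwartz u := smooth_real u /\ forall s, rapid (partials s u).

(** Each integration by parts leaves a coordinate, a sign and a phase shift of [pi / 2]; the modulus
    discards the sign. *)
Lemma costrans_partials u s th xi : schwartz u ->
  `|costrans th (partials s u) xi| =
  `|monomial s xi| * `|costrans (th + (size s)%:R * (pi / 2)) u xi|.
Proof.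
move=> su; elim: s th => [|i s IHs] th.
  by rewrite mul0r addr0 /monomial big_nil normr1 mul1r.
have [smu ru] := su.
have [C1 H1] := rapid_dominated (ru s).
have [C2 H2] := rapid_dominated (ru (i :: s)).
have [C3 H3] := rapid_dominated (ru [:: i, i & s]).
pose C := Num.max C1 (Num.max C2 C3).
have le_C (c : R) x : c <= C -> c * cauchy x <= C * cauchy x.
  by move=> h; rewrite ler_wpM2r// ltW// cauchy_gt0.
have -> : costrans th (partials (i :: s) u) xi =
    - (xi 0 i * costrans (th + pi / 2) (partials s u) xi); last first.
  rewrite normrN normrM IHs /monomial big_cons normrM -[RHS]mulrA.
  rewrite (_ : th + (size (i :: s))%:R * (pi / 2) = th + pi / 2 + (size s)%:R * (pi / 2))//.
  by rewrite -[size (i :: s)]addn1 natrD; ring.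
apply: (@costrans_derivative (partials s u) (partials (i :: s) u) (partials [:: i, i & s] u) C).
- by move=> x; exact: smooth_is_derive.
- by move=> x; exact: smooth_is_derive.
- by case: (ru s).
- by case: (ru (i :: s)).
- by move=> x; apply: le_trans (H1 x) (le_C _ _ _); rewrite le_max lexx.
- by move=> x; apply: le_trans (H2 x) (le_C _ _ _); rewrite !le_max lexx orbT.
- by move=> x; apply: le_trans (H3 x) (le_C _ _ _); rewrite !le_max lexx !orbT.
Qed.

End CosineTransform.

(** * A bound on a function from its transform *)

Section FourierBound.
Context {R : realType} {N : nat}.
Local Notation RN := 'rV[R]_N.
Local Notation mu := (@lebesgue_tuple R N).
Local Notation row := (@row_of_tuple R N).
Local Notation TN := (N.-tuple (measurableTypeR R)).
Implicit Types (x y z xi : RN).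
Variables (u : RN -> R) (C J : R).
Hypothesis cu : continuous u.
Hypothesis bu : forall x, `|u x| <= C * cauchy x.
Hypothesis bF : forall th xi, `|costrans th u xi| <= J * cauchy xi.

Let C0 : 0 <= C.
Proof. by have := le_trans (normr_ge0 _) (bu 0); rewrite pmulr_lge0// cauchy_gt0. Qed.

(** Here [p.1] is the frequency and [p.2] the position. Integrating out the position gives the
    damped transform, integrating out the frequency gives [u] times a product of Poisson kernels
    centred at [x]. *)
Let kernel (eps : R) x (p : TN * TN) : R :=
  tuple_damp eps p.1 * (u (row p.2) * cos (dotrv (row p.2) (row p.1) + - dotrv x (row p.1))).

Let measurable_coord i : measurable_fun setT (fun t : TN => row t 0 i).
Proof.
rewrite (_ : (fun _ => _) = fun t => tnth t i); first exact: measurable_tnth.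
by apply/funext => t; rewrite mxE.
Qed.

Let measurable_u_row : measurable_fun setT (fun t : TN => u (row t)).
Proof. exact: continuous_measurable_row. Qed.

Let measurable_kernel eps x : 0 < eps -> measurable_fun setT (kernel eps x).
Proof.
move=> e0; apply: measurable_funM.
  have /measurable_EFinP md := measurable_int _ (integrable_tuple_damp e0 N).
  by apply: (measurableT_comp md); exact: measurable_fst.
apply: measurable_funM; first exact: (measurableT_comp measurable_u_row measurable_snd).
apply: (@measurableT_comp _ _ _ _ _ _ (@cos R)).
  by apply: continuous_measurable_fun; exact: continuous_cos.
apply: measurable_funD; last apply: measurableT_comp => //.
  apply: measurable_sum => i; apply: measurable_funM.
    exact: (measurableT_comp (measurable_coord i) measurable_snd).
  exact: (measurableT_comp (measurable_coord i) measurable_fst).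
apply: measurable_sum => i; apply: measurable_funM => //.
exact: (measurableT_comp (measurable_coord i) measurable_fst).
Qed.

Let damp_ge0 eps (t : TN) : 0 <= tuple_damp eps t.
Proof. by apply: prodr_ge0 => i _; exact: expR_ge0. Qed.

Let damp_le1 eps (t : TN) : 0 < eps -> tuple_damp eps t <= 1.
Proof.
move=> e0; apply: prodr_ile1 => i _; rewrite expR_ge0 /=.
by rewrite -[leRHS]expR0 ler_expR mulNr oppr_le0 mulr_ge0// ltW.
Qed.

Let iu : mu.-integrable setT (fun t => (u (row t))%:E).
Proof. exact: integrable_dominated cu bu. Qed.

Let integrable_kernel eps x : 0 < eps ->
  (mu \x mu)%E.-integrable setT (EFin \o kernel eps x).
Proof.
move=> e0; apply/integrable12ltyP; first by apply/measurable_EFinP; exact: measurable_kernel.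
have id := integrable_tuple_damp e0 N.
have iun := integrable_abse iu.
pose I := (\int[mu]_t `|(u (row t))%:E|)%E.
have I_fin : I \is a fin_num by exact: integrable_fin_num iun.
have I0 : (0 <= I)%E by exact: integral_ge0.
have mk s : measurable_fun setT (fun t => (`|kernel eps x (s, t)|)%:E).
  apply/measurable_EFinP; apply: measurableT_comp => //.
  by apply: (measurableT_comp (measurable_kernel x e0)); exact: measurable_pair1.
apply: (@le_lt_trans _ _ (\int[mu]_s ((tuple_damp eps s)%:E * I))%E).
  apply: ge0_le_integral => //.
  - by move=> s _; exact: integral_ge0.
  - apply: (@measurable_fun_fubini_tonelli_F _ _ _ _ _ _ (fun p => (`|kernel eps x p|)%:E)) => //.
    by apply/measurable_EFinP; apply: measurableT_comp => //; exact: measurable_kernel.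
  - by apply: emeasurable_funM => //; exact: measurable_int id.
  - move=> s _; rewrite -ge0_integralZl//; last 2 first.
    + by apply: measurable_int iun.
    + by rewrite lee_fin.
    apply: ge0_le_integral => //.
    + exact: mk.
    + by apply: emeasurable_funM => //; exact: measurable_int iun.
    + move=> t _; rewrite /= -EFinM lee_fin /kernel /= normrM ger0_norm//.
      by rewrite ler_wpM2l// normrM ler_piMr// norm_cos_le1.
rewrite ge0_integralZr//; last 2 first.
- exact: measurable_int id.
- by move=> s _; rewrite lee_fin.
have := integrable_fin_num measurableT id; move: I_fin.
rewrite /comp; case: I {I0} => // r _; case: (\int[mu]_x0 _)%E => // r' _.
by rewrite -EFinM ltry.
Qed.

Let inner_t eps x (s : TN) :
  (\int[mu]_t (kernel eps x (s, t))%:E =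
   (tuple_damp eps s * costrans (- dotrv x (row s)) u (row s))%:E)%E.
Proof.
have cv : continuous (fun y : RN => u y * cos (dotrv y (row s) + - dotrv x (row s))).
  by apply: fun_continuousM => //; exact: continuous_cos_phase.
have bv (y : RN) : `|u y * cos (dotrv y (row s) + - dotrv x (row s))| <= C * cauchy y.
  by rewrite normrM; apply: le_trans (bu y); rewrite ler_piMr// norm_cos_le1.
have iv := integrable_dominated cv bv.
rewrite EFinM /costrans /rint /Rintegral fineK; last exact: (integrable_fin_num measurableT iv).
by rewrite -(integralZl measurableT iv); apply: eq_integral => t _; rewrite -EFinM.
Qed.

Let inner_s eps x (t : TN) : 0 < eps ->
  (\int[mu]_s (kernel eps x (s, t))%:E =
   (u (row t) * \prod_(i < N) poisson eps (row t 0 i - x 0 i))%:E)%E.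
Proof.
move=> e0; have [E _] := integral_tuple_damp e0 (fun i => row t 0 i - x 0 i).
have mc : measurable_fun setT (fun s : TN => cos (\sum_(i < N) (row t 0 i - x 0 i) * tnth s i)).
  apply: (@measurableT_comp _ _ _ _ _ _ (@cos R)).
    by apply: continuous_measurable_fun; exact: continuous_cos.
  by apply: measurable_sum => i; apply: measurable_funM => //; exact: measurable_tnth.
have id : mu.-integrable setT (EFin \o (fun s : TN =>
    tuple_damp eps s * cos (\sum_(i < N) (row t 0 i - x 0 i) * tnth s i))).
  apply: (le_integrable measurableT _ _ (integrable_tuple_damp e0 N)).
    apply/measurable_EFinP; apply: measurable_funM => //.
    by apply/measurable_EFinP; exact: measurable_int (integrable_tuple_damp e0 N).
  by move=> s _ /=; rewrite lee_fin normrM ler_piMr// norm_cos_le1.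
rewrite EFinM -E -(integralZl measurableT id); apply: eq_integral => s _.
rewrite -EFinM /kernel /=; congr (_%:E).
have -> : dotrv (row t) (row s) + - dotrv x (row s) =
    \sum_(i < N) (row t 0 i - x 0 i) * tnth s i.
  rewrite /dotrv -sumrB; apply: eq_bigr => i _.
  by rewrite [row s 0 i]mxE mulrBl.
ring.
Qed.

(** The substitution [y = eps z + x] turns the product of Poisson kernels into
    [(2 / eps) ^ N cauchy z]; with the Jacobian [eps ^ N] this leaves [2 ^ N]. The right-hand side
    is the integral of [J cauchy], which bounds the damped transform independently of [eps]. *)
Let poisson_mean eps x : 0 < eps ->
  2 ^+ N * `|rint (fun z => u (eps *: z + x) * cauchy z)| <= J * pi ^+ N.
Proof.
move=> e0; have ne : eps != 0 by rewrite gt_eqF.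
pose v y := u y * \prod_(i < N) poisson eps (y 0 i - x 0 i).
have p0 w : 0 <= poisson eps w.
  by rewrite /poisson divr_ge0 ?addr_ge0 ?sqr_ge0// mulr_ge0// ltW.
have pE w : poisson eps (eps * w) = 2 / eps * (1 + w ^+ 2)^-1.
  rewrite /poisson exprMn; field; rewrite ne.
  have w1 : 0 < 1 + w ^+ 2 by rewrite ltr_pwDl// sqr_ge0.
  by rewrite (gt_eqF w1) /= gt_eqF// ltr_pwDl ?exprn_gt0// sqr_ge0.
have ppE z : \prod_(i < N) poisson eps (eps * z 0 i) = (2 / eps) ^+ N * cauchy z.
  rewrite (eq_bigr (fun i => 2 / eps * (1 + z 0 i ^+ 2)^-1)); last by move=> i _; rewrite pE.
  by rewrite big_split /= prodr_const card_ord.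
have cp : continuous (fun y : RN => \prod_(i < N) poisson eps (y 0 i - x 0 i)).
  apply: fun_continuous_prod => i; apply: fun_continuousM; first exact: fun_cst_continuous.
  have cd : continuous (fun y : RN => y 0 i - x 0 i).
    by apply: fun_continuousD; [exact: continuous_coord|exact: fun_cst_continuous].
  apply: fun_continuousV => [y|]; first by rewrite ltr_pwDl ?exprn_gt0// sqr_ge0.
  apply: fun_continuousD; first exact: fun_cst_continuous.
  exact: fun_continuousM.
have cv : continuous v by exact: fun_continuousM.
have bp y : \prod_(i < N) poisson eps (y 0 i - x 0 i) <= (2 / eps) ^+ N.
  have -> : \prod_(i < N) poisson eps (y 0 i - x 0 i) =
            (2 / eps) ^+ N * cauchy (eps^-1 *: (y - x)).
    rewrite -ppE; apply: eq_bigr => i _; congr (poisson _ _).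
    by rewrite !mxE mulrA divff// mul1r.
  by rewrite ler_piMr ?exprn_ge0 ?divr_ge0 ?(ltW e0)// cauchy_le1.
have bv y : `|v y| <= C * (2 / eps) ^+ N * cauchy y.
  rewrite normrM mulrAC [`|\prod_(_ < _) _|]ger0_norm; last exact: prodr_ge0.
  by apply: ler_pM => //; exact: prodr_ge0.
have E1 : (\int[mu]_s (tuple_damp eps s * costrans (- dotrv x (row s)) u (row s))%:E = (rint v)%:E)%E.
  rewrite (eq_integral (fun s => \int[mu]_t (kernel eps x (s, t))%:E)%E); last first.
    by move=> s _; rewrite inner_t.
  rewrite (Fubini (integrable_kernel x e0)).
  rewrite /rint /Rintegral fineK; last first.
    exact: (integrable_fin_num measurableT (integrable_dominated cv bv)).
  by apply: eq_integral => t _; exact: inner_s.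
have b1 : `|rint v| <= J * pi ^+ N.
  rewrite -lee_fin; have -> : (`|rint v|%:E = `|(rint v)%:E|)%E by [].
  rewrite -E1; have mF := measurable_fubini_F (integrable_kernel x e0).
  have mF' : measurable_fun setT (fun s => (tuple_damp eps s * costrans (- dotrv x (row s)) u (row s))%:E).
    move: mF; congr measurable_fun; apply/funext => s; rewrite /fubini_F; exact: inner_t.
  apply: le_trans (le_abse_integral _ _ mF') _ => //.
  have iJ := integrableZl measurableT J (@integrable_cauchy R N).
  have -> : (J * pi ^+ N)%:E = (\int[mu]_s (J%:E * (cauchy (row s))%:E))%E.
    rewrite (integralZl measurableT (@integrable_cauchy R N)) EFinM -rint_cauchy.
    by rewrite /rint /Rintegral fineK// (integrable_fin_num measurableT (@integrable_cauchy R N)).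
  apply: ge0_le_integral => //.
  - exact: measurableT_comp.
  - exact: measurable_int iJ.
  - move=> s _; rewrite -EFinM /= lee_fin normrM ger0_norm//.
    by apply: le_trans (bF (- dotrv x (row s)) _); rewrite ler_piMl// damp_le1.
move: b1; rewrite (rint_affine x e0 cv bv).
have -> : rint (fun z => v (eps *: z + x)) =
    (2 / eps) ^+ N * rint (fun z => u (eps *: z + x) * cauchy z).
  have Ev z : v (eps *: z + x) = (2 / eps) ^+ N * (u (eps *: z + x) * cauchy z).
    rewrite /v mulrCA -ppE; congr (_ * _); apply: eq_bigr => i _; congr (poisson _ _).
    by rewrite !mxE addrK.
  rewrite (_ : (fun z => v _) = fun z => (2 / eps) ^+ N * (u (eps *: z + x) * cauchy z)); last exact/funext.
  have cw : continuous (fun z => u (eps *: z + x) * cauchy z).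
    apply: fun_continuousM; last exact: continuous_cauchy.
    by apply: (fun_continuous_comp (f := fun z : RN => eps *: z + x)) => //; exact: affine_continuous.
  have bw z : `|u (eps *: z + x) * cauchy z| <= C * cauchy z.
    rewrite normrM [`|cauchy z|]ger0_norm; last exact/ltW/cauchy_gt0.
    apply: ler_wpM2r; first exact/ltW/cauchy_gt0.
    by apply: le_trans (bu _) _; rewrite ler_piMr// cauchy_le1.
  by rewrite /rint RintegralZl//; exact: integrable_dominated cw bw.
rewrite mulrA -exprMn mulrCA divff// mulr1 normrM ger0_norm//.
Qed.

(* Integrating the transform against [tuple_damp eps] and exchanging the
   integrals gives the Poisson mean of [u] at [x], which tends to [pi ^+ N * u x]
   as [eps] tends to 0; no inversion formula is needed. *)
Lemma fourier_bound x : `|u x| <= J.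
Proof.
pose eps (k : nat) : R := k.+1%:R^-1.
have e0 k : 0 < eps k by rewrite invr_gt0.
pose f k (t : TN) := (u (eps k *: row t + x) * cauchy (row t))%:E.
pose g (t : TN) := (u x * cauchy (row t))%:E.
have mf k : measurable_fun setT (f k).
  apply/measurable_EFinP; apply: (continuous_measurable_row (g := fun z => u (eps k *: z + x) * cauchy z)).
  apply: fun_continuousM; last exact: continuous_cauchy.
  by apply: (fun_continuous_comp (f := fun z : RN => eps k *: z + x)) => //; exact: affine_continuous.
have mg : measurable_fun setT g.
  apply/measurable_EFinP; apply: (continuous_measurable_row (g := fun z => u x * cauchy z)).
  by apply: fun_continuousZ; exact: continuous_cauchy.
have fg : {ae mu, forall t, setT t -> f ^~ t @ \oo --> g t}.
  apply/aeW => t _; apply: cvg_EFin; first exact: nearW.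
  apply: (@cvgM _ _ _ _ (fun k => u (eps k *: row t + x)) (fun=> cauchy (row t))); last exact: cvg_cst.
  have ce : (fun k => eps k *: row t + x) @ \oo --> x.
    have xE : 0 *: row t + x = x by rewrite scale0r add0r.
    have : (fun k => eps k *: row t + x) @ \oo --> 0 *: row t + x.
      apply: (@cvgD _ RN _ _ _ (fun k => eps k *: row t) (fun=> x)); last exact: cvg_cst.
      by apply: (@cvgZ _ RN _ _ _ eps (fun=> row t)); [exact: cvg_harmonic|exact: cvg_cst].
    by rewrite xE.
  exact: (@cvg_comp _ _ _ (fun k => eps k *: row t + x) u \oo (nbhs x) (nbhs (u x)) ce (@cu x)).
have iC := integrableZl measurableT C (@integrable_cauchy R N).
have dom : {ae mu, forall t k, setT t -> (`|f k t| <= C%:E * (cauchy (row t))%:E)%E}.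
  apply/aeW => t k _; rewrite -EFinM lee_fin normrM [`|cauchy _|]ger0_norm; last exact/ltW/cauchy_gt0.
  apply: ler_wpM2r; first exact/ltW/cauchy_gt0.
  by apply: le_trans (bu _) _; rewrite ler_piMr// cauchy_le1.
have [ig _ cvgf] := dominated_convergence measurableT mf mg fg iC dom.
have pN : 0 < pi ^+ N :> R by rewrite exprn_gt0// pi_gt0.
have Eg : (\int[mu]_t g t = (u x * pi ^+ N)%:E)%E.
  rewrite EFinM -rint_cauchy /rint /Rintegral fineK; last first.
    by rewrite (integrable_fin_num measurableT (@integrable_cauchy R N)).
  by rewrite -(integralZl measurableT (@integrable_cauchy R N)).
have cvgr : (fun k => rint (fun z => u (eps k *: z + x) * cauchy z)) @ \oo --> u x * pi ^+ N.
  by apply: fine_cvg; rewrite -Eg; exact: cvgf.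
have J0 : 0 <= J by have := le_trans (normr_ge0 _) (bF 0 0); rewrite pmulr_lge0// cauchy_gt0.
suff : `|u x * pi ^+ N| <= J * pi ^+ N.
  by rewrite normrM (ger0_norm (ltW pN)) ler_pM2r.
have cn : (fun k => `|rint (fun z => u (eps k *: z + x) * cauchy z)|) @ \oo --> `|u x * pi ^+ N|.
  exact: cvg_norm cvgr.
rewrite -(cvg_lim (@Rhausdorff R) cn).
apply: limr_le; first by apply/cvg_ex; exists (`|u x * pi ^+ N|).
(* The factor [2 ^ N] is at least 1 and is dropped. *)
apply: nearW => k; apply: le_trans (poisson_mean x (e0 k)).
by rewrite ler_peMl// exprn_ege1// ler1n.
Qed.

End FourierBound.

(** * Weighted bounds on all derivatives *)

Section WeightOnSpace.
Context {R : realType} (omega : nqa_weight R) {N : nat}.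
Local Notation RN := 'rV[R]_N.
Local Notation W := (weightN omega).
Local Notation G := (decay omega).
Implicit Types (x y : RN) (u v : RN -> R) (s : seq 'I_N).

Lemma euclid_norm_ge0 x : 0 <= euclid_norm x. Proof. exact: sqrtr_ge0. Qed.

Lemma sqr_euclid_norm x : euclid_norm x ^+ 2 = \sum_i x 0 i ^+ 2.
Proof. by rewrite sqr_sqrtr// sumr_ge0// => i _; exact: sqr_ge0. Qed.

Lemma coord_le_euclid x i : `|x 0 i| <= euclid_norm x.
Proof.
rewrite -sqrtr_sqr ler_sqrt ?sumr_ge0// => [|j _]; last exact: sqr_ge0.
by rewrite (bigD1 i)//= lerDl sumr_ge0// => j _; exact: sqr_ge0.
Qed.

Lemma weightN_ge0 x : 0 <= W x.
Proof. exact/weight_ge0/euclid_norm_ge0. Qed.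

Lemma weightN_monotone x y : (forall i, x 0 i ^+ 2 <= y 0 i ^+ 2) -> W x <= W y.
Proof.
move=> xy; apply: weight_nondecreasing; first exact: euclid_norm_ge0.
by rewrite ler_sqrt ?ler_sum// sumr_ge0// => i _; exact: sqr_ge0.
Qed.

Lemma weightN_sqr x y : (forall i, x 0 i ^+ 2 = y 0 i ^+ 2) -> W x = W y.
Proof.
move=> xy; apply/eqP; rewrite eq_le !weightN_monotone// => i.
  by rewrite xy.
by rewrite xy.
Qed.

(** [|x + y|] is at most twice the larger of the two norms, and (alpha) controls the doubled
    argument. *)
Lemma weightN_add : exists L : nat, forall x y, W (x + y) <= L%:R * (1 + W x + W y).
Proof.
have [L L0 HL] := weight_dilation omega (ler1n R 2 : 1 <= 2%:R).
exists L => x y.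
pose M := Num.max (euclid_norm x) (euclid_norm y).
have M0 : 0 <= M by rewrite le_max euclid_norm_ge0.
have h : euclid_norm (x + y) <= 2 * M.
  rewrite -ler_sqr ?nnegrE ?euclid_norm_ge0 ?mulr_ge0// sqr_euclid_norm.
  apply: (@le_trans _ _ (\sum_i (2 * x 0 i ^+ 2 + 2 * y 0 i ^+ 2))).
    apply: ler_sum => i _; rewrite mxE; have := sqr_ge0 (x 0 i - y 0 i); nra.
  rewrite big_split /= -!mulr_sumr -!sqr_euclid_norm.
  have h1 : euclid_norm x ^+ 2 <= M ^+ 2 by rewrite ler_sqr ?nnegrE ?euclid_norm_ge0// le_max lexx.
  have h2 : euclid_norm y ^+ 2 <= M ^+ 2 by rewrite ler_sqr ?nnegrE ?euclid_norm_ge0// le_max lexx orbT.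
  rewrite exprMn; lra.
apply: le_trans (weight_nondecreasing _ (euclid_norm_ge0 _) h) _.
apply: le_trans (HL M M0) _; rewrite ler_wpM2l// -addrA lerD2l.
have := weightN_ge0 x; have := weightN_ge0 y; rewrite /M /weightN.
by case: (leP (euclid_norm x) (euclid_norm y)) => _; lra.
Qed.

Lemma norm_le_weight : exists (n : nat) (C : R), 0 < C /\
  forall t, 0 <= t -> 1 + t <= C * expR (n%:R * omega t).
Proof.
have [a [b [b0 H]]] := weight_gamma omega.
exists (Num.truncn b^-1).+1, (expR (- a / b)); split=> [|t t0]; first exact: expR_gt0.
have t1 : 0 < 1 + t by rewrite ltr_pwDl.
rewrite -[leLHS](@lnK _ (1 + t)) ?posrE// -expRD ler_expR.
have h1 : ln (1 + t) <= (omega t - a) / b by rewrite ler_pdivlMr// mulrC; have := H t t0; lra.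
have h2 : omega t * b^-1 <= omega t * (Num.truncn b^-1).+1%:R.
  by rewrite ler_wpM2l ?weight_ge0// ltW// truncnS_gt.
lra.
Qed.

(** By (gamma) the exponential of a multiple of the weight absorbs any power of the norm, and
    [(1 + |x|) ^ (2 N) cauchy x >= 1]. Integrability is thus bought by enlarging the index. *)
Lemma cauchy_weight (n : nat) : exists (m : nat) (C : R), 0 < C /\
  forall x, 1 <= C * expR (m%:R * W x) * cauchy x ^+ n.
Proof.
have [k [C [C0 HC]]] := norm_le_weight.
have c1 x : 1 <= (1 + euclid_norm x) ^+ 2 ^+ N * cauchy x.
  rewrite -[N in _ ^+ N]card_ord -prodr_const -big_split /=.
  apply: (big_ind (fun a : R => 1 <= a)) => // [a b a1 b1|i _]; first exact: mulr_ege1.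
  have d0 : 0 < 1 + x 0 i ^+ 2 by rewrite ltr_pwDl// sqr_ge0.
  rewrite ler_pdivlMr// mul1r.
  have h1 : x 0 i ^+ 2 <= euclid_norm x ^+ 2.
    by rewrite -real_normK ?num_real// ler_sqr ?nnegrE ?euclid_norm_ge0// coord_le_euclid.
  have := euclid_norm_ge0 x; nra.
exists (k * (2 * N * n))%N, (C ^+ (2 * N * n)); split; first exact: exprn_gt0.
move=> x; have := exprn_ege1 n (c1 x); rewrite exprMn => /le_trans; apply.
rewrite ler_wpM2r ?exprn_ge0 ?(ltW (cauchy_gt0 _))//.
rewrite -!exprM [(k * _)%N]mulnC natrM -mulrA expRM_natl -exprMn.
rewrite lerXn2r ?nnegrE ?addr_ge0 ?euclid_norm_ge0//.
  by rewrite mulr_ge0 ?expR_ge0 ?ltW.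
exact: HC (euclid_norm_ge0 x).
Qed.

Definition young_factor (m k : nat) x : R := expR (m%:R * W x) * G m k.

Lemma young_factor_ge0 m k x : 0 <= young_factor m k x.
Proof. by rewrite mulr_ge0 ?expR_ge0 ?decay_ge0. Qed.

Lemma young_factor_mono m m' k x : (m <= m')%N -> young_factor m k x <= young_factor m' k x.
Proof.
move=> mm; apply: ler_pM; rewrite ?expR_ge0 ?decay_ge0 ?decay_mono//.
by rewrite ler_expR ler_wpM2r ?weightN_ge0// ler_nat.
Qed.

(* The description of S_omega without the Fourier transform; it is applied to the
   real and the imaginary part of a function. *)
Definition young_bounded u := smooth_real u /\ forall m : nat, exists C : R,
  forall s x, `|partials s u x| * young_factor m (size s) x <= C.

Lemma young_bounded_pos u (m : nat) : young_bounded u -> exists2 C : R, 0 < C &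
  forall s x, `|partials s u x| * young_factor m (size s) x <= C.
Proof.
move=> [_ /(_ m)[C HC]]; exists (`|C| + 1); first by rewrite ltr_wpDl.
by move=> s x; apply: le_trans (HC s x) _; apply: le_trans (ler_norm C) _; rewrite lerDl.
Qed.

(** [decayM_le] separates the varying order from the fixed factor [G M (size s)], which is positive
    once [M] is large. *)
Lemma young_bounded_partials u s : young_bounded u -> young_bounded (partials s u).
Proof.
move=> bu; have [su _] := bu; split=> [|m]; first exact: smooth_partials.
have [m1 _ g0] := decay_gt0 omega (size s).
pose M := maxn m m1.
have gM : 0 < G M (size s) by apply: lt_le_trans g0 _; rewrite decay_mono// leq_maxr.
have [C C0 HC] := young_bounded_pos (M * 2) bu.
exists (C / G M (size s)) => s' x; rewrite ler_pdivlMr//.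
rewrite -partials_cat; apply: le_trans (HC (s' ++ s) x); rewrite -mulrA ler_wpM2l//.
rewrite size_cat /young_factor -mulrA; apply: ler_pM; rewrite ?expR_ge0 ?mulr_ge0 ?decay_ge0//.
  by rewrite ler_expR ler_wpM2r ?weightN_ge0// ler_nat muln2 -addnn (leq_trans (leq_maxl m m1)) ?leq_addr.
apply: le_trans (decayM_le omega M _ _); apply: ler_wpM2r; first exact: decay_ge0.
by rewrite decay_mono// leq_maxl.
Qed.

Lemma young_bounded_cauchy u (n : nat) : young_bounded u -> forall m : nat, exists2 C : R, 0 < C &
  forall s x, `|partials s u x| * young_factor m (size s) x <= C * cauchy x ^+ n.
Proof.
move=> bu m; have [p [D [D0 HD]]] := cauchy_weight n.
have [C C0 HC] := young_bounded_pos (m + p) bu.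
exists (C * D); first exact: mulr_gt0.
move=> s x; set A := `|_|.
have h := ler_wpM2l (mulr_ge0 (normr_ge0 (partials s u x)) (young_factor_ge0 m (size s) x)) (HD x).
rewrite mulr1 -/A in h; apply: le_trans h _.
set Y := young_factor m _ x; set c := cauchy x ^+ n; set e := expR _.
have c0 : 0 <= c by rewrite exprn_ge0// ltW// cauchy_gt0.
have -> : A * Y * (D * e * c) = D * (A * (Y * e) * c) by ring.
have -> : C * D * c = D * (C * c) by ring.
apply: ler_wpM2l; first exact: ltW.
apply: ler_wpM2r => //; apply: le_trans (HC s x); apply: ler_wpM2l; first exact: normr_ge0.
rewrite /Y /e /young_factor mulrAC -expRD -mulrDl -natrD ler_wpM2l ?expR_ge0//.
by rewrite decay_mono// leq_addr.
Qed.

Lemma young_bounded_schwartz u : young_bounded u -> schwartz u.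
Proof.
move=> bu; have [su _] := bu; split=> // s; split; first by case: (su s).
move=> n; have [m _ g0] := decay_gt0 omega (size s).
have [C C0 HC] := young_bounded_cauchy n bu m.
exists (C / G m (size s)) => x; rewrite mulrAC ler_pdivlMr//.
apply: le_trans (HC s x); rewrite ler_wpM2l// /young_factor ler_peMl ?(ltW g0)//.
by rewrite -expR0 ler_expR mulr_ge0// weightN_ge0.
Qed.

Lemma is_derive_coord i j x : is_derive x (delta_mx 0 j) (fun y : RN => y 0 i) ((j == i)%:R : R).
Proof.
apply: (@is_derive_quadratic _ _ _ _ _ _ 0) => h _.
by rewrite !mxE eqxx /= eq_sym addrK subrr normr0 mul0r.
Qed.

(** Indexes the Leibniz rule for [y_i u]: the lists left over when one direction [i] of [s] has been
    used on the factor [y_i], with multiplicity. *)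
Fixpoint deletions (i : 'I_N) s : seq (seq 'I_N) :=
  if s is j :: s' then (if j == i then [:: s'] else [::]) ++ map (cons j) (deletions i s')
  else [::].

Lemma size_deletions i s : (size (deletions i s) <= size s)%N.
Proof.
elim: s => //= j s IHs; rewrite size_cat size_map.
by case: eqP => _ /=; rewrite ?add0n ?add1n ?ltnS// ltnW.
Qed.

Lemma size_mem_deletions i s r : r \in deletions i s -> size s = (size r).+1.
Proof.
elim: s r => //= j s IHs r; rewrite mem_cat => /orP[|/mapP[r' /IHs E ->]]; last by rewrite E.
by case: eqP => // _; rewrite inE => /eqP ->.
Qed.

Lemma is_derive_sum_seq (I : Type) (r : seq I) (f df : I -> RN -> R) x (v : RN) :
  (forall k, is_derive x v (f k) (df k x)) ->
  is_derive x v (fun y => \sum_(k <- r) f k y) (\sum_(k <- r) df k x).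
Proof.
move=> d; elim: r => [|k r IHr].
  rewrite big_nil (_ : (fun y => _) = cst 0); first exact: is_derive_cst.
  by apply/funext => y; rewrite big_nil.
rewrite big_cons (_ : (fun y => _) = f k + (fun y => \sum_(k <- r) f k y)).
  exact: is_deriveD.
by apply/funext => y; rewrite big_cons.
Qed.

Lemma partials_coordM i u s : smooth_real u ->
  partials s (fun y => y 0 i * u y) =
    (fun y => y 0 i * partials s u y + \sum_(r <- deletions i s) partials r u y) /\
  forall x j, derivable (partials s (fun y => y 0 i * u y)) x (delta_mx 0 j).
Proof.
move=> su.
have d s' x j : is_derive x (delta_mx 0 j)
    (fun y => y 0 i * partials s' u y + \sum_(r <- deletions i s') partials r u y)
    ((j == i)%:R * partials s' u x + x 0 i * partials (j :: s') u x +
     \sum_(r <- deletions i s') partials (j :: r) u x).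
  have d1 : is_derive x (delta_mx 0 j) (fun y : RN => y 0 i * partials s' u y) _ :=
    is_deriveM (is_derive_coord i j x) (smooth_is_derive s' x j su).
  have d2 := @is_derive_sum_seq _ (deletions i s') (fun r => partials r u)
    (fun r => partials (j :: r) u) x (delta_mx 0 j) (fun r => smooth_is_derive r x j su).
  have d3 := is_deriveD d1 d2; apply: is_derive_eq d3 _.
  by rewrite /GRing.scale /=; congr (_ + _); ring.
have E : partials s (fun y => y 0 i * u y) =
    (fun y => y 0 i * partials s u y + \sum_(r <- deletions i s) partials r u y).
  elim: s => [|j s IHs] /=; first by apply/funext => y; rewrite big_nil addr0.
  rewrite -/(partials _ _) IHs; apply/funext => x; have [_ ->] := d s x j.
  rewrite big_cat /= big_map addrA; congr (_ + _).
  rewrite [LHS]addrC -/(partials _ _); congr (_ + _).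
  by case: eqP => _; rewrite ?big_seq1 ?big_nil ?mul1r ?mul0r.
by split=> // x j; rewrite E; case: (d s x j).
Qed.

Lemma smooth_coordM i u : smooth_real u -> smooth_real (fun y => y 0 i * u y).
Proof.
move=> su s; have [E ds] := partials_coordM i s su; split=> //; rewrite E.
apply: fun_continuousD; first apply: fun_continuousM.
- exact: continuous_coord.
- by case: (su s).
- by apply: fun_continuous_sum => r; case: (su r).
Qed.

(** The Leibniz rule has at most [1 + k] terms in order [k]. The factor [1 + k <= 2 ^ k] is absorbed
    by [decay_geometric], the coordinate by the exponential of the weight. *)
Lemma young_bounded_coordM i u : young_bounded u -> young_bounded (fun y => y 0 i * u y).
Proof.
move=> bu; have [su _] := bu; split=> [|m]; first exact: smooth_coordM.
have [m' mm' [A A0 HA]] := decay_geometric omega m (ler1n R 2 : 1 <= 2%:R).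
have [n [D [D0 HD]]] := norm_le_weight.
have [C C0 HC] := young_bounded_pos (m' + n) bu.
exists (C * (A * D)) => s x; have [-> _] := partials_coordM i s su.
set k := size s.
pose V := expR (m%:R * W x) * (A * G m' k).
have V0 : 0 <= V by rewrite mulr_ge0 ?expR_ge0// mulr_ge0 ?decay_ge0// ltW.
have V2 : (1 + k%:R) * young_factor m k x <= V.
  rewrite mulrCA; apply: ler_wpM2l; first exact: expR_ge0.
  apply: le_trans (HA k); apply: ler_wpM2r; first exact: decay_ge0.
  by rewrite -natrX -[1]/1%:R -natrD ler_nat add1n ltn_expl.
have yV (r : seq 'I_N) : (size r <= k)%N -> `|partials r u x| * (1 + euclid_norm x) * V <= C * (A * D).
  move=> rk; have h := ler_wpM2r (mulr_ge0 (ltW A0) (ltW D0)) (HC r x); apply: le_trans h.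
  rewrite -[in leLHS]mulrA -[in leRHS]mulrA; apply: ler_wpM2l => //.
  apply: (@le_trans _ _ (D * expR (n%:R * W x) * (expR (m'%:R * W x) * (A * G m' (size r))))); last first.
    rewrite /young_factor.
    have -> : D * expR (n%:R * W x) * (expR (m'%:R * W x) * (A * G m' (size r))) =
        expR ((m' + n)%:R * W x) * G m' (size r) * (A * D).
      by rewrite natrD mulrDl expRD; ring.
    apply: ler_wpM2r; first by rewrite mulr_ge0 ?ltW.
    by apply: ler_wpM2l; [exact: expR_ge0|rewrite decay_mono// leq_addr].
  apply: ler_pM => //; first by rewrite addr_ge0// euclid_norm_ge0.
    exact: HD (euclid_norm_ge0 x).
  rewrite /V; apply: ler_pM; rewrite ?expR_ge0 ?mulr_ge0 ?decay_ge0 ?(ltW A0)//.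
    by rewrite ler_expR ler_wpM2r ?weightN_ge0// ler_nat.
  apply: ler_wpM2l; first exact: ltW.
  (* [G] decreases in the order: the excess [k - size r] splits off as a factor at most 1. *)
  rewrite -(subnKC rk); apply: le_trans (decayD_le _ _ _ _) _.
  by rewrite ler_piMr ?decay_ge0// decay_le1.
pose B := C * (A * D).
have B0 : 0 <= B by rewrite !mulr_ge0// ltW.
have yV' (r : seq 'I_N) : (size r <= k)%N -> `|x 0 i| * `|partials r u x| * V <= B.
  move=> rk; apply: le_trans (yV r rk); apply: ler_wpM2r => //; rewrite mulrC; apply: ler_wpM2l => //.
  by apply: le_trans (coord_le_euclid x i) _; rewrite lerDr.
have yV'' (r : seq 'I_N) : (size r <= k)%N -> `|partials r u x| * V <= B.
  move=> rk; apply: le_trans (yV r rk); apply: ler_wpM2r => //.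
  by rewrite ler_peMr// lerDl euclid_norm_ge0.
have k0 : 0 < 1 + k%:R :> R by rewrite ltr_pwDl.
have : `|x 0 i * partials s u x + \sum_(r <- deletions i s) partials r u x| * V <= (1 + k%:R) * B.
  apply: le_trans (ler_wpM2r V0 (ler_normD _ _)) _; rewrite [leLHS]mulrDl [leRHS]mulrDl mul1r.
  apply: lerD; first by rewrite normrM yV'.
  apply: le_trans (ler_wpM2r V0 (ler_norm_sum _ _ _)) _; rewrite mulr_suml.
  apply: (@le_trans _ _ (\sum_(r <- deletions i s) B)).
    rewrite big_seq [leRHS]big_seq; apply: ler_sum => r /size_mem_deletions E.
    by apply: yV''; rewrite /k E.
  have -> : \sum_(r <- deletions i s) B = (size (deletions i s))%:R * B.
    by rewrite big_const_seq count_predT iter_addr_0 mulr_natl.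
  by rewrite ler_wpM2r// ler_nat size_deletions.
rewrite -ler_pdivrMl//; apply: le_trans.
rewrite [leRHS]mulrCA; apply: ler_wpM2l => //.
by rewrite ler_pdivlMl.
Qed.

Lemma young_bounded_monomial s u : young_bounded u -> young_bounded (fun x => monomial s x * u x).
Proof.
move=> bu; elim: s => [|i s IHs].
  by rewrite (_ : (fun x => _) = u)//; apply/funext => x; rewrite /monomial big_nil mul1r.
rewrite (_ : (fun x => _) = fun x => x 0 i * (monomial s x * u x)); first exact: young_bounded_coordM.
by apply/funext => x; rewrite /monomial big_cons mulrA.
Qed.

Lemma is_derive_affine u (sg : R) (a : RN) x i l :
  is_derive (sg *: x + a) (delta_mx 0 i) u l ->
  is_derive x (delta_mx 0 i) (fun y => u (sg *: y + a)) (sg * l).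
Proof.
move=> [du lE].
have := @is_derive_line R RN u (sg *: x + a) (delta_mx 0 i) 0 l.
rewrite scale0r addr0 => /(_ (DeriveDef du lE)) d1.
have d2 : is_derive (0 : R) (1 : R) (fun h : R => u (sg *: x + a + (sg * h) *: delta_mx 0 i)) (l * sg).
  have d0 : is_derive (0 : R) (1 : R) (fun h : R => sg * h) sg.
    have := @is_deriveZ _ _ _ (id : R -> R) sg 0 1 1 (is_derive_id _ _).
    by rewrite /GRing.scale /= mulr1.
  pose f (s : R) := u (sg *: x + a + s *: delta_mx 0 i).
  have d1' : is_derive (sg * 0) (1 : R) f l by rewrite mulr0.
  have d3 := @is_derive1_comp R f (fun h => sg * h) 0 l sg d1' d0.
  exact: d3.
rewrite mulrC; move: d2 => [D2 V2].
have E : (fun h : R => h^-1 *: (((fun h : R => u (sg *: x + a + (sg * h) *: delta_mx 0 i)) \o shift 0) (h *: 1) -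
           (fun h : R => u (sg *: x + a + (sg * h) *: delta_mx 0 i)) 0)) =
         (fun h => h^-1 *: (((fun y => u (sg *: y + a)) \o shift x) (h *: delta_mx 0 i) - u (sg *: x + a))).
  apply/funext => h /=; rewrite mulr0 scale0r !addr0; congr (_ *: (u _ - _)).
  by rewrite [h%:A]mulr1 scalerDr scalerA [LHS]addrC addrA.
by split; rewrite /derivable /derive -E.
Qed.

Lemma partials_affine u (sg : R) (a : RN) s : smooth_real u ->
  partials s (fun y => u (sg *: y + a)) = (fun y => sg ^+ size s * partials s u (sg *: y + a)).
Proof.
move=> su; elim: s => [|i s IHs] /=; first by apply/funext => y; rewrite expr0 mul1r.
rewrite -/(partials _ _) IHs; apply/funext => x.
have := is_deriveZ (sg ^+ size s) (is_derive_affine (smooth_is_derive s (sg *: x + a) i su)).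
by move=> [_ E]; rewrite [LHS]E /GRing.scale /= exprS mulrCA mulrA.
Qed.

Lemma smooth_affine u (sg : R) (a : RN) : smooth_real u -> smooth_real (fun y => u (sg *: y + a)).
Proof.
move=> su s; rewrite partials_affine//; split.
  apply: fun_continuousZ; apply: (fun_continuous_comp (f := fun y : RN => sg *: y + a)).
    exact: affine_continuous.
  by case: (su s).
move=> x i.
by have [] := is_deriveZ (sg ^+ size s) (is_derive_affine (smooth_is_derive s (sg *: x + a) i su)).
Qed.

(** [sg] is 1 or -1, so translations and reflections are covered at once. The reflection preserves
    the weight; the translation costs the constant of [weightN_add]. *)
Lemma young_bounded_affine u (sg : R) (a : RN) : sg ^+ 2 = 1 -> young_bounded u ->
  young_bounded (fun y => u (sg *: y + a)).
Proof.
move=> s1 bu; have [su _] := bu; split=> [|m]; first exact: smooth_affine.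
have [L HL] := weightN_add.
have [C C0 HC] := young_bounded_pos (m * L + m) bu.
exists (C * expR (m%:R * (L%:R * (1 + W a)))) => s x; rewrite partials_affine// normrM normrX.
have -> : `|sg| = 1.
  by move/eqP: s1; rewrite sqrf_eq1 => /orP[] /eqP ->; rewrite ?normrN normr1.
rewrite expr1n mul1r; set y := sg *: x + a.
have h1 : W x <= L%:R * (1 + W y + W a).
  have -> : W x = W (y - a).
    by apply: weightN_sqr => i; rewrite /y addrK mxE exprMn s1 mul1r.
  have -> : W a = W (- a) by apply: weightN_sqr => i; rewrite mxE sqrrN.
  exact: HL.
have := ler_wpM2r (expR_ge0 (m%:R * (L%:R * (1 + W a)))) (HC s y); apply: le_trans.
rewrite -mulrA; apply: ler_wpM2l => //.
rewrite /young_factor mulrAC -expRD; apply: ler_pM; rewrite ?expR_ge0 ?decay_ge0//.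
  rewrite ler_expR; have := ler_wpM2l (ler0n R m) h1.
  have := mulr_ge0 (ler0n R m) (weightN_ge0 y); rewrite natrD natrM; lra.
by rewrite decay_mono// leq_addl.
Qed.

End WeightOnSpace.

(** * Weighted bounds on derivatives by interpolation *)

Section Interpolation.
Context {R : realType} (omega : nqa_weight R) {N : nat}.
Local Notation RN := 'rV[R]_N.
Local Notation W := (weightN omega).
Local Notation G := (decay omega).
Local Notation e_ i := (delta_mx 0 i : RN).
Implicit Types (x y : RN) (u v : RN -> R) (s : seq 'I_N).

Lemma is_derive_line_scaled u x (w : RN) (sg t : R) l :
  is_derive (x + (sg * t) *: w) w u l ->
  is_derive t (1 : R) (fun h : R => u (x + (sg * h) *: w)) (sg * l).
Proof.
move=> /is_derive_line d1.
have d0 : is_derive t (1 : R) (fun h : R => sg * h) sg.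
  have := @is_deriveZ _ _ _ (id : R -> R) sg t 1 1 (is_derive_id _ _).
  by rewrite /GRing.scale /= mulr1.
pose f (h : R) := u (x + h *: w).
rewrite mulrC; exact: (@is_derive1_comp R f (fun h => sg * h) t l sg d1 d0).
Qed.

Lemma weightN_outward x i : exists2 sg : R, sg ^+ 2 = 1 &
  forall t, 0 <= t -> W x <= W (x + (sg * t) *: e_ i).
Proof.
exists (if 0 <= x 0 i then 1 else -1); first by case: ifP; rewrite ?sqrrN expr1n.
move=> t t0.
apply: weightN_monotone => j; rewrite !mxE eqxx /=; case: eqP => [->|_]; last by rewrite mulr0 addr0.
rewrite [true%:R](_ : _ = 1)// mulr1.
by case: (leP 0 (x 0 i)) => x0; rewrite ?mul1r ?mulN1r; nra.
Qed.

(** Interpolation bounds a square; any finite bound on the quantity itself is enough, so no root is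
    taken. *)
Lemma sqr_le_bound (y c : R) : y ^+ 2 <= c -> y <= c + 1.
Proof. by move=> h; have := sqr_ge0 (y - 1); have := sqr_ge0 y; nra. Qed.

(** Matches one interpolation step: order [k + j], squared, lies between order [j], whose weighted
    bound is known, and order [2 k + j], for which the unweighted bound is used. The factor
    [(16 ^ 4) ^ k] is the constant of [interpolation_halfline]. *)
Lemma decay_split m : exists2 m' : nat, (m <= m')%N & exists2 C : R, 0 < C & forall j k,
  (16 ^+ 4) ^+ k * G m (k + j) ^+ 2 <= C * (G m j * G m' (k * 2 + j)).
Proof.
have A1 : (1 : R) <= 16 ^+ 4 by apply: exprn_ege1; lra.
have [m' mm' [C C0 HC]] := decay_geometric omega m A1.
exists (m' * 2)%N; first by rewrite muln2 -addnn (leq_trans mm') ?leq_addr.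
exists C => // j k; set A := 16 ^+ 4 in A1 HC *.
have h1 : A ^+ k * G m (k + j) <= C * G m' (k + j).
  apply: le_trans (HC _); apply: ler_wpM2r; first exact: decay_ge0.
  by rewrite ler_weXn2l ?leq_addr.
have h2 : G m (k + j) <= G m k * G m j by exact: decayD_le.
have h3 : G m k * G m' (k + j) <= G (m' * 2) (k * 2 + j).
  rewrite (_ : k * 2 + j = k + (k + j))%N; last by lia.
  apply: le_trans (decayM_le _ _ _ _).
  by rewrite ler_wpM2r ?decay_ge0 ?decay_mono.
rewrite expr2 mulrA.
apply: (@le_trans _ _ (C * G m' (k + j) * (G m k * G m j))).
  apply: ler_pM => //; rewrite ?decay_ge0// mulr_ge0 ?decay_ge0// exprn_ge0//; lra.
have -> : C * G m' (k + j) * (G m k * G m j) = C * (G m j * (G m k * G m' (k + j))) by ring.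
by rewrite ler_wpM2l ?(ltW C0)// ler_wpM2l ?decay_ge0.
Qed.

Let block (a : 'I_N -> nat) (r : seq 'I_N) : seq 'I_N := flatten [seq nseq (a i) i | i <- r].

Variable u : RN -> R.
Hypothesis su : smooth_real u.
Hypothesis derivatives : forall m : nat, exists C : R, forall s x, `|partials s u x| * G m (size s) <= C.
Hypothesis weighted : forall l : nat, exists C : R, forall x, expR (l%:R * W x) * `|u x| <= C.

(* One coordinate at a time: along the half line from [x] on which the modulus of
   the i-th coordinate increases the weight does not decrease, so the decay of
   the lower derivatives is available on the whole half line. *)
Let weighted_block (r : seq 'I_N) : forall l m : nat, exists C : R, forall a x,
  expR (l%:R * W x) * `|partials (block a r) u x| * G m (size (block a r)) <= C.
Proof.
elim: r => [|i r IHr] l m.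
  by have [C HC] := weighted l; exists C => a x; rewrite decay_m0 mulr1.
have [m' mm' [C' C'0 HC']] := decay_split m.
(* Only one of the two interpolated factors carries the weight, and the result is squared: hence the
   doubled exponent. *)
have [C1 HC1] := IHr (l * 2)%N m; have [C2 HC2] := derivatives m'.
exists (C' * (4 * (C1 * C2)) + 1) => a x.
rewrite /block /= -/(block a r) size_cat size_nseq.
set j := size (block a r); set k := a i; set v := partials (block a r) u.
rewrite partials_cat -/v; apply: sqr_le_bound.
have C10 : 0 <= C1.
  by apply: le_trans (HC1 a x); rewrite !mulr_ge0 ?expR_ge0 ?decay_ge0.
have C20 : 0 <= C2.
  by apply: le_trans (HC2 [::] x); rewrite !mulr_ge0 ?expR_ge0 ?decay_ge0.
have [sg sg1 out] := weightN_outward x i.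
pose g n t := sg ^+ n * partials (nseq n i) v (x + (sg * t) *: e_ i).
set p := G m j; set q := G m' (k * 2 + j); set E := expR ((l * 2)%:R * W x).
have E0 : 0 < E by exact: expR_gt0.
have pos := HC' j k; rewrite -/p -/q in pos.
have sgn n : `|sg ^+ n| = 1.
  move/eqP: sg1; rewrite sqrf_eq1 => /orP[] /eqP ->; rewrite normrX ?normrN normr1 expr1n //.
have dg n t : is_derive t (1 : R) (g n) (g n.+1 t).
  have := @is_derive_line_scaled (partials (nseq n i) v) x (e_ i) sg t _
     (smooth_is_derive (nseq n i) _ i (smooth_partials (block a r) su)).
  move=> /(is_deriveZ (sg ^+ n)) d; apply: is_derive_eq d _.
  by rewrite /g /GRing.scale /= exprSr mulrA.
have bF t : 0 <= t -> E * p * `|g 0%N t| <= C1.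
  move=> t0; rewrite /g expr0 mul1r /=; apply: le_trans (HC1 a (x + (sg * t) *: e_ i)).
  rewrite mulrAC; apply: ler_wpM2r; first exact: decay_ge0.
  apply: ler_wpM2r; first exact: normr_ge0.
  by rewrite ler_expR ler_wpM2l// out.
have bM t : 0 <= t -> q * `|g (k * 2)%N t| <= C2.
  move=> t0; rewrite /g normrM sgn mul1r -partials_cat mulrC.
  by have := HC2 (nseq (k * 2) i ++ block a r) (x + (sg * t) *: e_ i); rewrite size_cat size_nseq.
have p0 : 0 <= p := decay_ge0 _ _ _; have q0 : 0 <= q := decay_ge0 _ _ _.
set Z := G m (k + j) in pos *.
have B0 : 0 < (16 ^+ 4 : R) ^+ k by rewrite !exprn_gt0//; lra.
have rhs0 : 0 <= C' * (4 * (C1 * C2)) by rewrite !mulr_ge0// ltW.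
(* The bounds [C1 / (E p)] and [C2 / q] need positive denominators. Otherwise [decay_split] forces
   [Z = 0], and the claim is trivial. *)
have [pq0|pq0] := eqVneq (p * q) 0.
  have Z0 : Z ^+ 2 = 0.
    apply/eqP; rewrite eq_le sqr_ge0 andbT.
    by move: pos; rewrite pq0 mulr0 pmulr_rle0.
  by rewrite exprMn Z0 mulr0.
have p1 : 0 < p by rewrite lt_neqAle p0 andbT eq_sym; apply: contra_neq pq0 => ->; rewrite mul0r.
have q1 : 0 < q by rewrite lt_neqAle q0 andbT eq_sym; apply: contra_neq pq0 => ->; rewrite mulr0.
have Ep : 0 < E * p by exact: mulr_gt0.
have := @interpolation_halfline R k g (C1 / (E * p)) (C2 / q) dg.
rewrite !divr_ge0 ?(ltW Ep) ?(ltW q1)// => /(_ isT isT).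
have -> : g k 0 ^+ 2 = `|partials (nseq k i) v x| ^+ 2.
  by rewrite real_normK ?num_real// /g mulr0 scale0r addr0 exprMn -[sg ^+ k ^+ 2]exprM mulnC exprM sg1 expr1n mul1r.
move=> H0.
have {H0} H : `|partials (nseq k i) v x| ^+ 2 <= 4 * (16 ^+ 4) ^+ k * (C1 / (E * p) * (C2 / q)).
  by apply: H0 => t t0; rewrite ler_pdivlMr// mulrC; [exact: bF|exact: bM].
set X := `|_| in H *.
have -> : (expR (l%:R * W x) * X * Z) ^+ 2 = E * X ^+ 2 * Z ^+ 2.
  by rewrite !exprMn -expRM_natl mulrA -natrM mulnC.
have -> : C' * (4 * (C1 * C2)) = E * (4 * (C1 / (E * p) * (C2 / q))) * (C' * (p * q)).
  by field; rewrite ?gt_eqF.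
apply: (@le_trans _ _ (E * (4 * (C1 / (E * p) * (C2 / q))) * ((16 ^+ 4) ^+ k * Z ^+ 2))).
  rewrite mulrA; apply: ler_wpM2r; first exact: sqr_ge0.
  rewrite -mulrA; apply: ler_wpM2l; first exact: ltW.
  by apply: le_trans H _; rewrite mulrAC.
apply: ler_wpM2l => //.
apply: mulr_ge0; first exact: ltW.
by rewrite mulr_ge0// mulr_ge0// divr_ge0// ltW.
Qed.

(** The blocks over all coordinates are the sorted lists [mi_seq], and every list of directions is
    one of them up to a permutation. *)
Lemma young_bounded_interpolation : young_bounded omega u.
Proof.
split=> // m; have [C HC] := weighted_block (enum 'I_N) m m.
exists C => s x; rewrite (partials_count_index s su).
have := HC (count_index s) x; rewrite -/(mi_seq _) size_mi_seq mi_order_count_index.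
by rewrite /young_factor mulrA [`|_| * _]mulrC.
Qed.

End Interpolation.

(** * Derivatives of a function versus decay of its transform *)

Section Characterization.
Context {R : realType} (omega : nqa_weight R) {N : nat}.
Local Notation RN := 'rV[R]_N.
Local Notation W := (weightN omega).
Local Notation G := (decay omega).
Implicit Types (x y xi : RN) (u v : RN -> R) (s : seq 'I_N) (f : RN -> R[i]^o).

Lemma young_bounded_decay u m : young_bounded omega u -> exists2 C : R, 0 < C &
  forall s x, `|partials s u x| * G m (size s) <= C * cauchy x.
Proof.
move=> bu; have [C C0 HC] := young_bounded_cauchy 1 bu m; exists C => // s x.
apply: le_trans (HC s x); rewrite ler_wpM2l// /young_factor ler_peMl ?decay_ge0//.
by rewrite -expR0 ler_expR mulr_ge0// weightN_ge0.
Qed.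

Lemma costrans_young u m : young_bounded omega u -> exists2 C : R, 0 < C &
  forall s th xi, `|costrans th (partials s u) xi| * G m (size s) <= C.
Proof.
move=> bu; have [C C0 HC] := young_bounded_decay m bu; have [su _] := bu.
exists (C * pi ^+ N) => [|s th xi]; first by rewrite mulr_gt0 ?exprn_gt0 ?pi_gt0.
have [->|g0] := eqVneq (G m (size s)) 0.
  by rewrite mulr0 mulr_ge0 ?exprn_ge0 ?pi_ge0// ltW.
have g1 : 0 < G m (size s) by rewrite lt_neqAle eq_sym g0 decay_ge0.
rewrite -ler_pdivlMr// mulrAC; apply: costrans_bound => [|x]; first by case: (su s).
by rewrite mulrAC ler_pdivlMr.
Qed.

(** For [|xi| >= 1] the infimum defining [G] is tested at [ln |xi|], which cancels the power; inside
    the unit ball both factors are at most 1. *)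
Lemma monomial_decay m s xi : `|monomial s xi| * G m (size s) <= expR (m%:R * W xi).
Proof.
have [r1|r1] := leP 1 (euclid_norm xi).
  have bm : `|monomial s xi| <= euclid_norm xi ^+ size s.
    rewrite /monomial normr_prod; elim: s => [|i s IHs]; first by rewrite big_nil expr0.
    by rewrite big_cons exprS ler_pM// ?prodr_ge0// coord_le_euclid.
  apply: le_trans (ler_wpM2r (decay_ge0 _ _ _) bm) _.
  have r0 : 0 < euclid_norm xi by exact: lt_le_trans r1.
  have t0 : 0 <= ln (euclid_norm xi) by exact: ln_ge0.
  apply: le_trans (ler_wpM2l _ (decay_le omega m (size s) t0)) _; first exact: exprn_ge0 (ltW r0).
  rewrite lnK ?posrE// -/(weightN omega xi) -{1}[euclid_norm xi]lnK ?posrE// -expRM_natl -expRD.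
  by rewrite ler_expR; lra.
apply: (@le_trans _ _ 1); last by rewrite -expR0 ler_expR mulr_ge0// weightN_ge0.
apply: mulr_ile1; rewrite ?decay_ge0 ?decay_le1//.
rewrite /monomial normr_prod; apply: prodr_ile1 => i _; rewrite normr_ge0 /=.
by apply: ltW; apply: le_lt_trans r1; exact: coord_le_euclid.
Qed.

(** A derivative of [u] multiplies the transform by a monomial, which [monomial_decay] trades for a
    weight. The additional index [p] supplies the factor [cauchy] that [fourier_bound] asks for. *)
Lemma fourier_derivatives u : schwartz u ->
  (forall l : nat, exists C : R, forall th xi, expR (l%:R * W xi) * `|costrans th u xi| <= C) ->
  forall m : nat, exists C : R, forall s x, `|partials s u x| * G m (size s) <= C.
Proof.
move=> su decr m; have [p [D [D0 HD]]] := cauchy_weight omega (N := N) 1.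
have [C HC] := decr (m + p)%N.
exists (C * D) => s x.
have C0 : 0 <= C by apply: le_trans (HC 0 x); rewrite mulr_ge0 ?expR_ge0.
have [->|g0] := eqVneq (G m (size s)) 0; first by rewrite mulr0 mulr_ge0// ltW.
have g1 : 0 < G m (size s) by rewrite lt_neqAle eq_sym g0 decay_ge0.
rewrite -ler_pdivlMr//.
have [smu ru] := su; have [B HB] := rapid_dominated (ru s).
apply: (fourier_bound _ HB) => [|th xi]; first by case: (ru s).
rewrite mulrAC ler_pdivlMr// costrans_partials//.
set th' := th + _; have h1 := HC th' xi; have h2 := HD xi; have h3 := monomial_decay m s xi.
rewrite expr1 in h2; set c := cauchy xi in h2 *; set F := `|costrans _ _ _| in h1 *.
have c0 : 0 < c := cauchy_gt0 _.
move: h1; rewrite natrD mulrDl expRD; set e1 := expR _ in h3 *; set e2 := expR _ in h2 *.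
move=> h1; have F0 : 0 <= F := normr_ge0 _.
have -> : `|monomial s xi| * F * G m (size s) = F * (`|monomial s xi| * G m (size s)) by ring.
apply: le_trans (ler_wpM2l F0 h3) _.
apply: (@le_trans _ _ (F * e1 * (D * e2 * c))).
  by rewrite ler_peMr// mulr_ge0 ?expR_ge0.
have -> : F * e1 * (D * e2 * c) = (e1 * e2 * F) * (D * c) by ring.
by rewrite -[leRHS]mulrA ler_wpM2r// mulr_ge0// ltW.
Qed.

Lemma max_coord xi : (0 < N)%N -> exists j, euclid_norm xi <= N%:R * `|xi 0 j|.
Proof.
move=> N0; pose j := [arg max_(j > Ordinal N0 | true) `|xi 0 j|]%O.
exists j.
have jmax i : `|xi 0 i| <= `|xi 0 j| by rewrite /j; case: arg_maxP => // k _; apply.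
rewrite -ler_sqr ?nnegrE ?euclid_norm_ge0 ?mulr_ge0// sqr_euclid_norm.
apply: (@le_trans _ _ (\sum_(i < N) `|xi 0 j| ^+ 2)).
  by apply: ler_sum => i _; rewrite -[xi 0 i ^+ 2]real_normK ?num_real// ler_sqr ?nnegrE.
rewrite sumr_const card_ord -[leLHS]mulr_natl [leRHS]exprMn ler_wpM2r ?sqr_ge0//.
by rewrite expr2 -natrM ler_nat leq_pmulr.
Qed.

(** With [t] the largest modulus of a coordinate of [xi], [k] integrations by parts in that
    coordinate gain [t ^ k]. [decay_biconj] chooses [k] so that this gain and the bound on the
    derivatives together reach the exponential of the weight at [t]. Passing from [|xi|] to [t] is a
    dilation by [N]; a coordinate exists because [N] is positive. *)
Lemma costrans_weight u : (0 < N)%N -> young_bounded omega u ->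
  forall l : nat, exists C : R, forall th xi, expR (l%:R * W xi) * `|costrans th u xi| <= C.
Proof.
move=> N0 bu l.
have N1 : 1 <= N%:R :> R by rewrite ler1n.
have [L L0 HL] := weight_dilation omega N1.
have [n [Cn [Cn0 HCn]]] := norm_le_weight omega.
have e1 : 1 <= expR 1 :> R by rewrite -expR0 ler_expR.
(* [decay_biconj] loses a factor [t] and a factor [e ^ k]. The summand [n] of the index pays for the
   first through [norm_le_weight], the passage to [m2] for the second. *)
have [m2 m12 [Cg Cg0 HCg]] := decay_geometric omega (l * L + n) e1.
have [C C0 HC] := costrans_young m2 bu.
exists (expR (l * L)%:R * (Num.max C (Cn * Cg * C))) => th xi.
have [j Hj] := max_coord xi N0; set t := `|xi 0 j| in Hj.
have t0 : 0 <= t := normr_ge0 _.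
have hW : l%:R * W xi <= (l * L)%:R + (l * L)%:R * omega t.
  apply: (@le_trans _ _ (l%:R * omega (N%:R * t))).
    by rewrite ler_wpM2l// weight_nondecreasing// euclid_norm_ge0.
  apply: le_trans (ler_wpM2l (ler0n _ _) (HL t t0)) _.
  by rewrite natrM mulrA mulrDr mulr1.
have le_e : expR (l%:R * W xi) <= expR (l * L)%:R * expR ((l * L)%:R * omega t).
  by rewrite -expRD ler_expR.
apply: le_trans (ler_wpM2r (normr_ge0 _) le_e) _; rewrite -[leLHS]mulrA ler_wpM2l ?expR_ge0//.
set F := `|_|; have F0 : 0 <= F := normr_ge0 _.
(* Below 1 the weight vanishes and order 0 suffices; [ln t] is nonnegative in the other case. *)
rewrite le_max; have [t1|t1] := leP 1 t; last first.
  rewrite weight_01 ?t0 ?(ltW t1)// mulr0 expR0 mul1r.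
  by have := HC [::] th xi; rewrite decay_m0 mulr1 /= => ->.
apply/orP; right.
have tp : 0 < t := lt_le_trans ltr01 t1.
have [k Hk] := decay_biconj omega (l * L + n) (ln_ge0 t1).
move: Hk; rewrite expRB lnK ?posrE// ler_pdivrMr// => Hk.
have hn := HCn t t0.
rewrite -(ler_pM2l tp).
set m1 := (l * L + n)%N in Hk HCg m12.
have E1 : t * expR ((l * L)%:R * omega t) <= Cn * expR (m1%:R * omega t).
  rewrite /m1 natrD mulrDl expRD mulrCA mulrC.
  by rewrite ler_wpM2l ?expR_ge0// (le_trans _ hn)// lerDr.
rewrite mulrA; apply: le_trans (ler_wpM2r F0 E1) _.
rewrite -[leLHS]mulrA (_ : t * (Cn * Cg * C) = Cn * (t * (Cg * C))); last by ring.
apply: ler_wpM2l; first exact: ltW.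
have E2 : `|costrans (th - (size (nseq k j))%:R * (pi / 2)) (partials (nseq k j) u) xi| = t ^+ k * F.
  rewrite costrans_partials ?subrK//; last exact: young_bounded_schwartz bu.
  congr (_ * _); rewrite /monomial normr_prod big_nseq /t.
  by elim: (k) => //= k' ->; rewrite exprS.
have H2 := HC (nseq k j) (th - (size (nseq k j))%:R * (pi / 2)) xi.
rewrite E2 size_nseq in H2.
apply: (@le_trans _ _ (expR (k%:R * (ln t + 1)) * G m1 k * t * F)).
  by rewrite ler_wpM2r.
have -> : expR (k%:R * (ln t + 1)) = t ^+ k * expR 1 ^+ k.
  by rewrite mulrDr expRD !expRM_natl lnK ?posrE.
have -> : t ^+ k * expR 1 ^+ k * G m1 k * t * F = t * (expR 1 ^+ k * G m1 k * (t ^+ k * F)) by ring.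
rewrite ler_pM2l//; apply: (@le_trans _ _ (Cg * G m2 k * (t ^+ k * F))).
  by rewrite ler_wpM2r ?mulr_ge0 ?exprn_ge0.
by rewrite -mulrA ler_wpM2l ?(ltW Cg0)// mulrC.
Qed.

End Characterization.

(** * Membership in S_omega through real and imaginary parts *)

Section SpaceS.
Context {R : realType} (omega : nqa_weight R) {N : nat}.
Local Notation RN := 'rV[R]_N.
Local Notation W := (weightN omega).
Local Notation G := (decay omega).
Local Notation Re := (@complex.Re R).
Local Notation Im := (@complex.Im R).
Local Notation normc := (@Normc.normc R).
Implicit Types (x y xi : RN) (u v : RN -> R) (s : seq 'I_N) (f : RN -> R[i]^o).

Lemma norm_Re_le (z : R[i]) : `|Re z| <= normc z.
Proof. by case: z => a b /=; rewrite -sqrtr_sqr ler_sqrt ?addr_ge0 ?sqr_ge0// lerDl sqr_ge0. Qed.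

Lemma norm_Im_le (z : R[i]) : `|Im z| <= normc z.
Proof. by case: z => a b /=; rewrite -sqrtr_sqr ler_sqrt ?addr_ge0 ?sqr_ge0// lerDr sqr_ge0. Qed.

Lemma normc_le (z : R[i]) : normc z <= `|Re z| + `|Im z|.
Proof.
case: z => a b /=; rewrite -ler_sqr ?nnegrE ?sqrtr_ge0 ?addr_ge0// sqr_sqrtr ?addr_ge0 ?sqr_ge0//.
have := normr_ge0 a; have := normr_ge0 b.
rewrite -[a ^+ 2]real_normK ?num_real// -[b ^+ 2]real_normK ?num_real//; nra.
Qed.

Lemma norm_halves (a b B : R) : `|a + b| <= B -> `|a - b| <= B -> `|a| <= B /\ `|b| <= B.
Proof.
rewrite !ler_norml => /andP[h1 h2] /andP[h3 h4].
by split; apply/andP; split; lra.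
Qed.

Lemma costrans_phase u C th xi : continuous u -> (forall x, `|u x| <= C * cauchy x) ->
  costrans th u xi = cos th * costrans 0 u xi + - sin th * costrans (- (pi / 2)) u xi.
Proof.
move=> cu bu; have bc p x : `|u x * cos (dotrv x xi + p)| <= C * cauchy x.
  by rewrite normrM; apply: le_trans (bu x); rewrite ler_piMr// norm_cos_le1.
have cc p : continuous (fun x => u x * cos (dotrv x xi + p)).
  by apply: fun_continuousM => //; exact: continuous_cos_phase.
rewrite /costrans -(rint_comb _ _ (cc _) (bc _) (cc _) (bc _)); congr rint.
by apply/funext => x; rewrite addr0 cosBpihalf cosD; ring.
Qed.

Lemma costransN th u xi : costrans th u (- xi) = costrans (- th) u xi.
Proof.
rewrite /costrans; congr rint; apply/funext => x; congr (_ * _).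
have -> : dotrv x (- xi) = - dotrv x xi.
  by rewrite /dotrv -sumrN; apply: eq_bigr => i _; rewrite mxE mulrN.
by rewrite -cosN opprD opprK.
Qed.

Section FourierParts.
Variables (f : RN -> R[i]^o) (C : R).
Hypotheses (cu : continuous (Re \o f)) (bu : forall x, `|Re (f x)| <= C * cauchy x).
Hypotheses (cv : continuous (Im \o f)) (bv : forall x, `|Im (f x)| <= C * cauchy x).

Let bound (w : RN -> R) p xi : (forall x, `|w x| <= C * cauchy x) ->
  forall x, `|w x * cos (dotrv x xi + p)| <= C * cauchy x.
Proof. by move=> bw x; rewrite normrM; apply: le_trans (bw x); rewrite ler_piMr// norm_cos_le1. Qed.

Let cont (w : RN -> R) p xi : continuous w -> continuous (fun x => w x * cos (dotrv x xi + p)).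
Proof. by move=> cw; apply: fun_continuousM => //; exact: continuous_cos_phase. Qed.

Lemma Re_fourier xi :
  Re (fourier f xi) = 1 * costrans 0 (Re \o f) xi + 1 * costrans (- (pi / 2)) (Im \o f) xi.
Proof.
rewrite /costrans -(rint_comb _ _ (@cont _ _ xi cu) (@bound _ _ xi bu) (@cont _ _ xi cv) (@bound _ _ xi bv)).
rewrite /fourier /cintegral /rint /=; congr Rintegral; apply/funext => t.
rewrite cosBpihalf addr0 /cis cosN sinN; case: (f _) => a b /=; ring.
Qed.

Lemma Im_fourier xi :
  Im (fourier f xi) = 1 * costrans 0 (Im \o f) xi + (- 1) * costrans (- (pi / 2)) (Re \o f) xi.
Proof.
rewrite /costrans -(rint_comb _ _ (@cont _ _ xi cv) (@bound _ _ xi bv) (@cont _ _ xi cu) (@bound _ _ xi bu)).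
rewrite /fourier /cintegral /rint /=; congr Rintegral; apply/funext => t.
rewrite cosBpihalf addr0 /cis cosN sinN; case: (f _) => a b /=; ring.
Qed.

(** The Fourier transform mixes the real and the imaginary part of [f]. Cosine transforms are even
    and sine transforms odd in [xi], so the values at [xi] and [- xi] separate them. *)
Lemma costrans_le_fourier th xi (B : R) :
  normc (fourier f xi) <= B -> normc (fourier f (- xi)) <= B ->
  `|costrans th (Re \o f) xi| <= 2 * B /\ `|costrans th (Im \o f) xi| <= 2 * B.
Proof.
move=> b1 b2.
have hpi w : `|costrans th w xi| <= `|costrans 0 w xi| + `|costrans (- (pi / 2)) w xi| ->
    `|costrans 0 w xi| <= B -> `|costrans (- (pi / 2)) w xi| <= B -> `|costrans th w xi| <= 2 * B.
  by move=> h h1 h2; lra.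
have odd (w : RN -> R) : continuous w -> (forall x, `|w x| <= C * cauchy x) ->
    costrans (- (pi / 2)) w (- xi) = - costrans (- (pi / 2)) w xi.
  move=> cw bw; rewrite costransN opprK (costrans_phase _ _ cw bw).
  by rewrite cos_pihalf sin_pihalf mul0r add0r mulN1r.
have even w : costrans 0 w (- xi) = costrans 0 w xi by rewrite costransN oppr0.
have r1 := le_trans (norm_Re_le _) b1; have r2 := le_trans (norm_Re_le _) b2.
have i1 := le_trans (norm_Im_le _) b1; have i2 := le_trans (norm_Im_le _) b2.
rewrite Re_fourier in r1; rewrite Re_fourier even (odd _ cv bv) mulrN in r2.
rewrite Im_fourier in i1; rewrite Im_fourier even (odd _ cu bu) in i2.
have phase w : continuous w -> (forall x, `|w x| <= C * cauchy x) ->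
    `|costrans th w xi| <= `|costrans 0 w xi| + `|costrans (- (pi / 2)) w xi|.
  move=> cw bw; rewrite (costrans_phase th xi cw bw); apply: le_trans (ler_normD _ _) _.
  rewrite !normrM normrN; apply: lerD; rewrite ler_piMl// ?norm_cos_le1//.
  by rewrite ler_norml sin_geN1 sin_le1.
have [u0 v1] := norm_halves r1 r2.
rewrite mulrN in i2; have [v0 u1] := norm_halves i1 i2; rewrite mulN1r normrN in u1.
by rewrite !mul1r in u0 v0 v1; split; apply: hpi => //; exact: phase.
Qed.

End FourierParts.

Lemma mderiv_partials s f x : smooth f ->
  mderiv (count_index s) f x = (partials s (Re \o f) x +i* partials s (Im \o f) x)%C.
Proof. by move=> [su sv]; rewrite /mderiv -!partials_count_index. Qed.

Lemma weighted_bounded_partials f (l : nat) s : smooth f -> weighted_bounded omega f ->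
  exists2 C : R, 0 <= C & forall x, expR (l%:R * W x) * `|partials s (Re \o f) x| <= C /\
                         expR (l%:R * W x) * `|partials s (Im \o f) x| <= C.
Proof.
(* [weighted_bounded] asks for a positive rate, hence [l.+1], which also serves [l = 0]. *)
move=> sf wf; have [C HC] := wf l.+1%:R (count_index s) (ltr0Sn _ _).
have n0 z : 0 <= normc z by case: z => a b; rewrite sqrtr_ge0.
exists C => [|x]; first by apply: le_trans (HC 0); rewrite mulr_ge0// expR_ge0.
have e1 : expR (l%:R * W x) <= expR (l.+1%:R * W x).
  by rewrite ler_expR ler_wpM2r ?weightN_ge0// ler_nat.
have := HC x; rewrite mderiv_partials// => h.
by split; apply: le_trans h; apply: ler_pM; rewrite ?expR_ge0//;
  [exact: norm_Re_le (_ +i* _)%C | exact: norm_Im_le (_ +i* _)%C].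
Qed.

Lemma weighted_rapid u : continuous u ->
  (forall l : nat, exists C : R, forall x, expR (l%:R * W x) * `|u x| <= C) -> rapid u.
Proof.
move=> cu H; split=> // n; have [m [D [D0 HD]]] := cauchy_weight omega (N := N) n.
have [C HC] := H m; exists (C * D) => x.
have c0 : 0 <= cauchy x ^+ n by rewrite exprn_ge0// ltW// cauchy_gt0.
apply: le_trans (_ : `|u x| * (D * expR (m%:R * W x) * cauchy x ^+ n) <= _).
  by rewrite ler_peMr.
have -> : `|u x| * (D * expR (m%:R * W x) * cauchy x ^+ n) =
    (expR (m%:R * W x) * `|u x|) * (D * cauchy x ^+ n) by ring.
by rewrite -[leRHS]mulrA ler_wpM2r// mulr_ge0// ltW.
Qed.

Lemma in_S_young f : f \in @in_S R omega N ->
  young_bounded omega (Re \o f) /\ young_bounded omega (Im \o f).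
Proof.
rewrite inE => -[_ sf _ wf wF]; have [su sv] := sf.
have wb s l := weighted_bounded_partials l s sf wf.
have schu : schwartz (Re \o f).
  split=> // s; apply: weighted_rapid => [|l]; first by case: (su s).
  by have [C _ HC] := wb s l; exists C => x; case: (HC x).
have schv : schwartz (Im \o f).
  split=> // s; apply: weighted_rapid => [|l]; first by case: (sv s).
  by have [C _ HC] := wb s l; exists C => x; case: (HC x).
have [Cu HCu] := rapid_dominated (schu.2 [::]); have [Cv HCv] := rapid_dominated (schv.2 [::]).
pose C := Num.max Cu Cv.
have bu x : `|Re (f x)| <= C * cauchy x.
  by apply: le_trans (HCu x) _; rewrite ler_wpM2r ?(ltW (cauchy_gt0 _))// le_max lexx.
have bv x : `|Im (f x)| <= C * cauchy x.
  by apply: le_trans (HCv x) _; rewrite ler_wpM2r ?(ltW (cauchy_gt0 _))// le_max lexx orbT.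
have decr (l : nat) : exists B : R, forall th xi,
    expR (l%:R * W xi) * `|costrans th (Re \o f) xi| <= B /\
    expR (l%:R * W xi) * `|costrans th (Im \o f) xi| <= B.
  have [B HB] := wF l.+1%:R [ffun=> 0%N] (ltr0Sn _ _).
  have WN xi : W (- xi) = W xi by apply: weightN_sqr => i; rewrite mxE sqrrN.
  have HB' xi : normc (fourier f xi) <= B / expR (l%:R * W xi).
    rewrite ler_pdivlMr ?expR_gt0// mulrC; apply: le_trans (HB xi).
    have E0 : mi_seq [ffun=> 0%N] = [::] :> seq 'I_N.
      by rewrite /mi_seq; elim: (enum _) => //= i r ->; rewrite ffunE.
    rewrite /mderiv E0.
    have -> : (partials [::] (Re \o fourier f) xi +i* partials [::] (Im \o fourier f) xi)%C = fourier f xi.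
      by [].
    rewrite ler_wpM2r//; first by case: (fourier f xi) => a b; rewrite sqrtr_ge0.
    by rewrite ler_expR ler_wpM2r ?weightN_ge0// ler_nat.
  exists (2 * B) => th xi.
  have b2 := HB' (- xi); rewrite WN in b2.
  have [h1 h2] := costrans_le_fourier (smooth_continuous su) bu (smooth_continuous sv) bv th (HB' xi) b2.
  by rewrite mulrA in h1 h2; split; rewrite mulrC -ler_pdivlMr ?expR_gt0.
split; apply: young_bounded_interpolation => //.
- by apply: fourier_derivatives => // l; have [B HB] := decr l; exists B => th xi; case: (HB th xi).
- by move=> l; have [B _ HB] := wb [::] l; exists B => x; case: (HB x).
- by apply: fourier_derivatives => // l; have [B HB] := decr l; exists B => th xi; case: (HB th xi).
- by move=> l; have [B _ HB] := wb [::] l; exists B => x; case: (HB x).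
Qed.

Lemma young_bounded_weighted u (l : R) s : young_bounded omega u ->
  exists C : R, forall x, expR (l * W x) * `|partials s u x| <= C.
Proof.
move=> bu; have [m _ g0] := decay_gt0 omega (size s).
pose M := maxn m (Num.truncn l).+1.
have gM : 0 < G M (size s) by apply: lt_le_trans g0 _; rewrite decay_mono// leq_maxl.
have [C C0 HC] := young_bounded_pos M bu.
exists (C / G M (size s)) => x; rewrite ler_pdivlMr//.
apply: le_trans (HC s x); rewrite mulrAC mulrC ler_wpM2l// /young_factor ler_wpM2r ?(ltW gM)//.
rewrite ler_expR ler_wpM2r ?weightN_ge0//.
apply: le_trans (ltW (truncnS_gt l)) _.
by rewrite ler_nat leq_maxr.
Qed.

Lemma young_weighted_bounded f :
  (forall (l : R) s, exists C : R, forall x, expR (l * W x) * `|partials s (Re \o f) x| <= C) ->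
  (forall (l : R) s, exists C : R, forall x, expR (l * W x) * `|partials s (Im \o f) x| <= C) ->
  weighted_bounded omega f.
Proof.
move=> hu hv l a l0; have [C HC] := hu l (mi_seq a); have [D HD] := hv l (mi_seq a).
exists (C + D) => x; apply: le_trans (lerD (HC x) (HD x)); rewrite -mulrDr.
by rewrite ler_wpM2l ?expR_ge0//; exact: normc_le.
Qed.

(** The derivatives of the transform are transforms of monomial multiples, and these are again
    [young_bounded]; so [costrans_weight] covers all of them. *)
Lemma young_in_S f : (0 < N)%N ->
  young_bounded omega (Re \o f) -> young_bounded omega (Im \o f) -> f \in @in_S R omega N.
Proof.
move=> N0 yu yv; have [su _] := yu; have [sv _] := yv.
have schu := young_bounded_schwartz yu; have schv := young_bounded_schwartz yv.
have [Cu HCu] := rapid_dominated (schu.2 [::]); have [Cv HCv] := rapid_dominated (schv.2 [::]).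
pose C := Num.max Cu Cv.
have bu x : `|Re (f x)| <= C * cauchy x.
  by apply: le_trans (HCu x) _; rewrite ler_wpM2r ?(ltW (cauchy_gt0 _))// le_max lexx.
have bv x : `|Im (f x)| <= C * cauchy x.
  by apply: le_trans (HCv x) _; rewrite ler_wpM2r ?(ltW (cauchy_gt0 _))// le_max lexx orbT.
have cu := smooth_continuous su; have cv := smooth_continuous sv.
have sc w th : young_bounded omega w -> smooth_real (costrans th w).
  move=> yw; have [[rw _] _] := (young_bounded_schwartz yw, tt).
  exact: (smooth_costrans ((young_bounded_schwartz yw).2 [::]) th).1.
have EuR : Re \o fourier f = 1 *: costrans 0 (Re \o f) + 1 *: costrans (- (pi / 2)) (Im \o f).
  by apply/funext => xi; exact: Re_fourier.
have EuI : Im \o fourier f = 1 *: costrans 0 (Im \o f) + (- 1) *: costrans (- (pi / 2)) (Re \o f).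
  by apply/funext => xi; exact: Im_fourier.
have wc w w' th th' (c : R) : young_bounded omega w -> young_bounded omega w' ->
    forall (l : R) s, exists B : R, forall x, expR (l * W x) *
      `|partials s (1 *: costrans th w + c *: costrans th' w') x| <= B.
  move=> yw yw' l s; rewrite smooth_real_comb; [|exact: sc|exact: sc].
  have one (v : RN -> R) p : young_bounded omega v ->
      exists B : R, forall x, expR (l * W x) * `|partials s (costrans p v) x| <= B.
    move=> yv'; have [p' ->] := (smooth_costrans ((young_bounded_schwartz yv').2 [::]) p).2 s.
    have [B HB] := costrans_weight N0 (young_bounded_monomial s yv') (Num.truncn l).+1.
    exists B => x; apply: le_trans (HB p' x); rewrite ler_wpM2r// ler_expR ler_wpM2r ?weightN_ge0//.
    exact/ltW/truncnS_gt.
  have [B HB] := one w th yw; have [B' HB'] := one w' th' yw'.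
  exists (B + `|c| * B') => x.
  change (expR (l * W x) * `|1 * partials s (costrans th w) x + c * partials s (costrans th' w') x| <= B + `|c| * B').
  apply: le_trans (ler_wpM2l (expR_ge0 _) (ler_normD _ _)) _.
  rewrite mul1r normrM mulrDr; apply: lerD => //.
  by rewrite mulrCA ler_wpM2l.
rewrite inE; split.
- by split; [exact: integrable_dominated cu bu|exact: integrable_dominated cv bv].
- by [].
- by split; rewrite (EuR, EuI); apply: smooth_realD; exact: sc.
- by apply: young_weighted_bounded => l s; exact: young_bounded_weighted.
- by apply: young_weighted_bounded => l s; rewrite (EuR, EuI); exact: wc.
Qed.

End SpaceS.

(** * Continuous functionals and convolution *)

Section FunctionalBound.
Context {R : realType} (omega : nqa_weight R) (N : nat).
Local Notation RN := 'rV[R]_N.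
Local Notation W := (weightN omega).
Local Notation G := (decay omega).
Local Notation Re := (@complex.Re R).
Local Notation Im := (@complex.Im R).
Local Notation normc := (@Normc.normc R).
Implicit Types (x y : RN) (u v : RN -> R) (s : seq 'I_N) (f g : RN -> R[i]^o).

(** For positive indices, [young_le] and [growth_le] express the balls of [q_norm m] and of
    [r_norm k n] for one real component, free of extended reals. *)
Definition young_le m (A : R) u := forall s x, `|partials s u x| * young_factor omega m (size s) x <= A.

Definition growth_le n k (B : R) u := forall s y,
  `|partials s u y| * (expR (- (n%:R * W y)) * G k (size s)) <= B.

Lemma weighted_sup_le (l : int) m f (A A' : R) : (0 < m)%N -> smooth f ->
  (forall s x, `|partials s (Re \o f) x| * (expR (l%:~R * W x) * G m (size s)) <= A) ->
  (forall s x, `|partials s (Im \o f) x| * (expR (l%:~R * W x) * G m (size s)) <= A') ->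
  (weighted_sup omega l m f <= (A + A')%:E)%E.
Proof.
move=> m0 sf bu bv; apply: ge_ereal_sup => _ [[a x] _ <-] /=.
rewrite young_weightE// -EFinM lee_fin -size_mi_seq.
apply: le_trans (lerD (bu (mi_seq a) x) (bv (mi_seq a) x)); rewrite -mulrDl.
apply: ler_wpM2r; first by rewrite mulr_ge0 ?expR_ge0 ?decay_ge0.
exact: (normc_le (_ +i* _)%C).
Qed.

Lemma weighted_sup_ge (l : int) m f (A : R) : (0 < m)%N -> smooth f ->
  (weighted_sup omega l m f <= A%:E)%E ->
  (forall s x, `|partials s (Re \o f) x| * (expR (l%:~R * W x) * G m (size s)) <= A) /\
  (forall s x, `|partials s (Im \o f) x| * (expR (l%:~R * W x) * G m (size s)) <= A).
Proof.
move=> m0 sf wA.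
have H s x : normc (mderiv (count_index s) f x) * (expR (l%:~R * W x) * G m (size s)) <= A.
  rewrite -lee_fin; apply: le_trans wA; apply: ereal_sup_ubound; exists (count_index s, x) => //=.
  by rewrite young_weightE// -EFinM mi_order_count_index.
split=> s x; apply: le_trans (H s x); apply: ler_wpM2r; rewrite ?mulr_ge0 ?expR_ge0 ?decay_ge0//;
  rewrite mderiv_partials//; [exact: (norm_Re_le (_ +i* _)%C) | exact: (norm_Im_le (_ +i* _)%C)].
Qed.

Lemma in_S_OCn n f : f \in @in_S R omega N -> in_OCn omega n f.
Proof.
move=> fS; have [yu yv] := in_S_young fS; have sf : smooth f by split; [case: yu|case: yv].
split=> // m m0; have [C C0 HC] := young_bounded_pos m yu; have [D D0 HD] := young_bounded_pos m yv.
apply: le_lt_trans (ltry (C + D)).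
have le_f s x : expR ((- n%:Z)%:~R * W x) * G m (size s) <= young_factor omega m (size s) x.
  rewrite /young_factor ler_wpM2r ?decay_ge0// ler_expR ler_wpM2r ?weightN_ge0//.
  by rewrite (le_trans _ (ler0n _ m))// rmorphN /= oppr_le0 ler0z.
apply: weighted_sup_le => // s x; [apply: le_trans (HC s x) | apply: le_trans (HD s x)];
  exact: ler_wpM2l.
Qed.

Lemma in_S_OC f : f \in @in_S R omega N -> f \in @in_OC R omega N.
Proof. by move=> fS; rewrite inE; exists 1%N => //; exact: in_S_OCn. Qed.

Lemma norm_complexE (z : R[i]) : `|z| = (normc z)%:C%C.
Proof. by []. Qed.

Lemma dual_linear (E : preTopologicalLmodType R[i]) (T : dual E) : linear T.
Proof. by case: T => u /=; rewrite inE => -[]. Qed.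

Lemma dual_continuous (E : preTopologicalLmodType R[i]) (T : dual E) : continuous T.
Proof. by case: T => u /=; rewrite inE => -[]. Qed.

Lemma linear_map0 (E : lmodType R[i]) (F : lmodType R[i]) (T : E -> F) : linear T -> T 0 = 0.
Proof. by move=> lT; have := lT (-1) 0 0; rewrite scaleN1r oppr0 addr0 => ->; rewrite scaleN1r addNr. Qed.

Lemma linear_mapZ (E : lmodType R[i]) (F : lmodType R[i]) (T : E -> F) (c : R[i]) (e : E) :
  linear T -> T (c *: e) = c *: T e.
Proof. by move=> lT; have := lT c e 0; rewrite (linear_map0 lT) !addr0. Qed.

Lemma smooth_scale (c : R[i]) f : smooth f -> smooth (c *: f).
Proof. by move=> sf; have := smooth_comb c sf (@smooth0 R N); rewrite addr0. Qed.

(** A neighbourhood of 0 on which [|T| < 1] contains, within the step [n], a ball for finitely many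
    norms. Since [G] increases with its index, a bound at the last index [k] controls all of
    them. *)
Lemma OC_dual_bound (T : dual (OC omega N)) n : (0 < n)%N ->
  exists (k : nat) (C : R), 0 < C /\ forall (g : OC omega N) (B : R), 0 < B ->
    in_OCn omega n g -> growth_le n k B (Re \o g) -> growth_le n k B (Im \o g) ->
    normc (T g) <= C * B.
Proof.
move=> n0; have lT := dual_linear T.
have T0 : T 0 = 0 := linear_map0 lT.
have : nbhs (0 : OC omega N) [set g | `|T g| < 1].
  have := @dual_continuous (OC omega N) T 0; rewrite /continuous_at T0 => cT.
  exact: (@cvgr0_norm_lt _ _ _ _ _ _ cT 1 ltr01).
rewrite nbhsE => -[U [oU U0] UT].
have [V [_ /(_ n n0)[k [e [e0 HV]]]] VO] := oU 0 U0.
exists k, (4 / e); split; first by rewrite divr_gt0.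
move=> g B B0 gn gu gv.
(* After scaling by [c] each component is bounded by [e / 4], so the norms of [c g] are at most
   [e / 2 < e]. *)
pose c : R := e / (4 * B); have c0 : 0 < c by rewrite divr_gt0// mulr_gt0.
have sg : smooth g by case: gn.
have : `|T ((c%:C)%C *: g)| < 1.
  apply: UT; rewrite -[X in U X]add0r; apply/VO/HV.
    have [sg' rg] := gn; split.
      exact: (smooth_scale (c%:C)%C sg').
    move=> m m0; have := r_norm_comb (n := n) (c%:C)%C sg' (@smooth0 R N) (rg m m0).
    rewrite addr0; apply.
    apply/weighted_sup_lty; exists 0 => a x.
    by rewrite mderiv0 Normc.normc0 mul0e.
  move=> m /andP[m0 mk].
  apply: (@le_lt_trans _ _ ((c * B + c * B)%:E)); last first.
    rewrite lte_fin /c; have -> : e / (4 * B) * B + e / (4 * B) * B = e / 2.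
      by field; rewrite gt_eqF.
    lra.
  have sc w s x : smooth_real w -> growth_le n k B w ->
      `|partials s (c *: w + 0 *: (0 : RN -> R)) x| * (expR ((- n%:Z)%:~R * W x) * G m (size s)) <= c * B.
    move=> sw gw; rewrite smooth_real_comb//; last exact: smooth_real0.
    rewrite scale0r addr0 [(c *: _) x](_ : _ = c * partials s w x)// normrM (gtr0_norm c0) -mulrA.
    apply: ler_wpM2l; first exact: ltW.
    apply: le_trans (gw s x); apply: ler_wpM2l => //.
    by rewrite rmorphN /= mulNr ler_wpM2l ?expR_ge0// decay_mono.
  have [su sv] := sg.
  have ER : Re \o ((c%:C)%C *: (g : RN -> R[i]^o)) = c *: (Re \o g) + 0 *: (0 : RN -> R).
    apply/funext => x /=; rewrite scale0r addr0 [RHS](_ : _ = c * Re (g x))//.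
    by change (Re ((c%:C)%C * g x) = c * Re (g x)); case: (g x) => a b /=; rewrite mul0r subr0.
  have EI : Im \o ((c%:C)%C *: (g : RN -> R[i]^o)) = c *: (Im \o g) + 0 *: (0 : RN -> R).
    apply/funext => x /=; rewrite scale0r addr0 [RHS](_ : _ = c * Im (g x))//.
    by change (Im ((c%:C)%C * g x) = c * Im (g x)); case: (g x) => a b /=; rewrite mul0r addr0.
  apply: (weighted_sup_le m0) => [|s x|s x].
  - exact: (smooth_scale (c%:C)%C sg).
  - by have := sc _ s x su gu; rewrite -ER.
  - by have := sc _ s x sv gv; rewrite -EI.
rewrite (linear_mapZ _ _ lT) normrM !norm_complexE -rmorphM ltcR => h.
have {}h : c * normc (T g) < 1.
  by move: h; rewrite /= expr0n /= addr0 sqrtr_sqr gtr0_norm.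
move: h; rewrite /c mulrC -ltr_pdivlMr// => /ltW; congr (_ <= _).
by field; rewrite ?gt_eqF.
Qed.

End FunctionalBound.

(** * Convolution of a test function with the reflected functional *)

Section Averaging.
Context {R : realType} (omega : nqa_weight R) (N : nat) (N_gt0 : (0 < N)%N).
Variable T : dual (OC omega N).
Local Notation RN := 'rV[R]_N.
Local Notation W := (weightN omega).
Local Notation G := (decay omega).
Local Notation Re := (@complex.Re R).
Local Notation Im := (@complex.Im R).
Local Notation normc := (@Normc.normc R).
Local Notation F := (RN -> R[i]^o).
Local Notation S_ := (@in_S R omega N).
Implicit Types (x y : RN) (u v : RN -> R) (s : seq 'I_N) (f g : F).

Lemma OC_pairing_linear (c : R[i]) f g : f \in @in_OC R omega N -> g \in @in_OC R omega N ->
  OC_pairing T (c *: f + g) = c * OC_pairing T f + OC_pairing T g.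
Proof.
move=> fO gO; have -> : c * OC_pairing T f + OC_pairing T g =
    T (c *: insubd 0 f + insubd 0 g) by rewrite (dual_linear T).
congr (T _); apply: val_inj.
have cO : c *: f + g \in @in_OC R omega N by apply: rpredD => //; exact: rpredZ.
change (val (insubd (0 : OC omega N) (c *: f + g)) =
  c *: val (insubd (0 : OC omega N) f) + val (insubd (0 : OC omega N) g)).
by rewrite !insubdK.
Qed.

(** The factor 1 gives translations the form [sg *: y + a] of the affine lemmas. *)
Definition translate x f : F := fun y => f (1 *: y + x).

Lemma in_S_translate x f : f \in S_ -> translate x f \in S_.
Proof.
move=> fS; have [yu yv] := in_S_young fS; have s1 : (1 : R) ^+ 2 = 1 by rewrite expr1n.
apply: young_in_S => //; [exact: (young_bounded_affine x s1 yu)|exact: (young_bounded_affine x s1 yv)].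
Qed.

Lemma in_S_reflect x f : f \in S_ -> (fun y => f (- 1 *: y + x)) \in S_.
Proof.
move=> fS; have [yu yv] := in_S_young fS; have s1 : (- 1 : R) ^+ 2 = 1 by rewrite sqrrN expr1n.
by apply: young_in_S => //; [exact: (young_bounded_affine x s1 yu)|exact: (young_bounded_affine x s1 yv)].
Qed.

(* [average f x] is the value at [x] of the convolution of [f] with the
   reflection of [T]. *)
Definition average f : F := fun x => OC_pairing T (translate x f).

Lemma average_linear (c : R[i]) f g : f \in S_ -> g \in S_ ->
  average (c *: f + g) = c *: average f + average g.
Proof.
move=> fS gS; apply/funext => x.
have := OC_pairing_linear c (in_S_OC (in_S_translate x fS)) (in_S_OC (in_S_translate x gS)).
exact.
Qed.

Lemma pairing_bound n : (0 < n)%N -> exists (k : nat) (C : R), 0 < C /\ forall f (B : R), 0 < B ->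
  f \in S_ -> growth_le omega n k B (Re \o f) -> growth_le omega n k B (Im \o f) ->
  normc (OC_pairing T f) <= C * B.
Proof.
move=> n0; have [k [C [C0 HC]]] := OC_dual_bound T n0; exists k, C; split=> // f B B0 fS fu fv.
have E : OC_fun (insubd (0 : OC omega N) f) = f := insubdK _ (in_S_OC fS).
by have := HC (insubd 0 f) B B0; rewrite E; apply => //; exact: in_S_OCn.
Qed.

Definition pderiv i f : F := fun x => (partials [:: i] (Re \o f) x +i* partials [:: i] (Im \o f) x)%C.

Lemma in_S_pderiv i f : f \in S_ -> pderiv i f \in S_.
Proof.
move=> fS; have [yu yv] := in_S_young fS.
by apply: young_in_S => //; [exact: (young_bounded_partials [:: i] yu)|
  exact: (young_bounded_partials [:: i] yv)].
Qed.

Lemma growth_le_young n k (B : R) x u : 0 <= B -> young_le omega k B u -> smooth_real u ->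
  growth_le omega n k B (fun y => u (1 *: y + x)).
Proof.
move=> B0 uB su s y; rewrite partials_affine// expr1n mul1r.
apply: le_trans (uB s (1 *: y + x)); apply: ler_wpM2l => //.
apply: ler_wpM2r; first exact: decay_ge0.
by rewrite ler_expR (@le_trans _ _ 0)// ?oppr_le0 mulr_ge0// weightN_ge0.
Qed.

Lemma young_le_bound u m : young_bounded omega u -> exists2 C : R, 0 < C & young_le omega m C u.
Proof. by move=> yu; have [C C0 HC] := young_bounded_pos m yu; exists C. Qed.

Lemma young_leW m (A A' : R) u : A <= A' -> young_le omega m A u -> young_le omega m A' u.
Proof. by move=> AA uA s x; exact: le_trans (uA s x) AA. Qed.

Lemma average_bounded f : f \in S_ -> exists B, forall x, normc (average f x) <= B.
Proof.
move=> fS; have [yu yv] := in_S_young fS; have [k [C [C0 HC]]] := pairing_bound (ltn0Sn 0).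
have [A A0 HA] := young_le_bound k yu; have [D D0 HD] := young_le_bound k yv.
have AD0 : 0 < A + D by rewrite addr_gt0.
exists (C * (A + D)) => x; apply: (HC _ _ AD0); first exact: in_S_translate.
  apply: (@growth_le_young _ _ _ _ (Re \o f)); [exact: ltW|apply: young_leW HA; rewrite lerDl ltW//|by case: yu].
apply: (@growth_le_young _ _ _ _ (Im \o f)); [exact: ltW|apply: young_leW HD; rewrite lerDr ltW//|by case: yv].
Qed.

(** Taylor's formula is applied to each derivative of [u] separately, so the increment of the
    translate minus its linear part is of order [h ^ 2] in a norm of the step [n], to which the
    bound on [T] applies. *)
Lemma growth_remainder n k i x (h : R) u (C : R) : smooth_real u ->
  young_le omega k C (partials [:: i; i] u) ->
  growth_le omega n k (C * h ^+ 2) (1 *: (1 *: (fun y => u (1 *: y + (x + h *: delta_mx 0 i))) +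
    (-1) *: (fun y => u (1 *: y + x))) + (- h) *: (fun y => partials [:: i] u (1 *: y + x))).
Proof.
move=> su uC s y.
have su1 := smooth_partials [:: i] su.
rewrite smooth_real_comb; last 2 first.
- by apply: smooth_realD; exact: smooth_affine.
- exact: (smooth_affine _ _ su1).
rewrite smooth_real_comb; [|exact: smooth_affine..].
rewrite !partials_affine// !expr1n.
set z := 1 *: y + x.
have E1 : partials s (partials [:: i] u) = partials (i :: s) u.
  by rewrite -partials_cat; apply: partials_perm => //; rewrite cats1 perm_rcons.
have E2 : partials s (partials [:: i; i] u) = partials [:: i, i & s] u.
  by rewrite -partials_cat; apply: partials_perm => //; rewrite -[[:: i, i & s]]/([:: i; i] ++ s) perm_catC.
change (`|1 * (1 * (1 * partials s u (1 *: y + (x + h *: delta_mx 0 i))) + - 1 * (1 * partials s u z)) +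
   - h * (1 * partials s (partials [:: i] u) z)| * (expR (- (n%:R * W y)) * G k (size s)) <= C * h ^+ 2).
have -> : 1 *: y + (x + h *: delta_mx 0 i) = z + h *: delta_mx 0 i :> RN by rewrite /z addrA.
rewrite !mul1r mulN1r mulNr E1.
have [->|g0] := eqVneq (G k (size s)) 0.
  by rewrite !mulr0 mulr_ge0 ?sqr_ge0//; apply: le_trans (uC s y); rewrite mulr_ge0 ?young_factor_ge0.
have g1 : 0 < G k (size s) by rewrite lt_neqAle eq_sym g0 decay_ge0.
have b2 w : `|partials [:: i, i & s] u w| <= C / G k (size s).
  rewrite ler_pdivlMr// -E2; apply: le_trans (uC s w); apply: ler_wpM2l => //.
  by rewrite /young_factor ler_peMl ?(ltW g1)// -expR0 ler_expR mulr_ge0// weightN_ge0.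
have := @second_order_bound R RN (partials s u) (partials (i :: s) u) (partials [:: i, i & s] u)
  (delta_mx 0 i) z h _ (fun y => smooth_is_derive s y i su) (fun y => smooth_is_derive (i :: s) y i su)
  (fun c _ => b2 (z + c *: delta_mx 0 i)).
rewrite mulrAC ler_pdivlMr//; apply: le_trans; apply: ler_wpM2l => //.
by rewrite ler_piMl ?(ltW g1)// -[leRHS]expR0 ler_expR oppr_le0 mulr_ge0// weightN_ge0.
Qed.

(** Nested as combinations [c *: f + g], the shape that [OC_pairing_linear] accepts. *)
Definition remainder i x (h : R) f : F := (- h%:C)%C *: translate x (pderiv i f) +
  ((- 1) *: translate x f + translate (x + h *: delta_mx 0 i) f).

Lemma average_remainder i x (h : R) f : f \in S_ ->
  OC_pairing T (remainder i x h f) =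
  average f (x + h *: delta_mx 0 i) - average f x - (h%:C)%C * average (pderiv i f) x.
Proof.
move=> fS; have fO y := in_S_OC (in_S_translate y fS).
rewrite /remainder OC_pairing_linear; first 1 last.
- exact/in_S_OC/in_S_translate/in_S_pderiv.
- by apply: rpredD => //; exact: rpredZ.
rewrite OC_pairing_linear// mulN1r mulNr addrC; congr (_ + _).
by rewrite addrC.
Qed.

Lemma remainder_bound i f : f \in S_ -> exists C : R, forall x (h : R),
  normc (average f (x + h *: delta_mx 0 i) - average f x - (h%:C)%C * average (pderiv i f) x)
    <= C * h ^+ 2.
Proof.
move=> fS; have [yu yv] := in_S_young fS; have [k [C [C0 HC]]] := pairing_bound (ltn0Sn 0).
have [A A0 HA] := young_le_bound k (young_bounded_partials [:: i; i] yu).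
have [D D0 HD] := young_le_bound k (young_bounded_partials [:: i; i] yv).
have AD0 : 0 < A + D by rewrite addr_gt0.
exists (C * (A + D)) => x h; have [->|h0] := eqVneq h 0.
  rewrite scale0r addr0 subrr sub0r mul0r oppr0 Normc.normc0 mulr_ge0 ?sqr_ge0//.
  by rewrite mulr_ge0 ?ltW.
have h1 : 0 < h ^+ 2 by rewrite lt_neqAle eq_sym sqrf_eq0 h0 sqr_ge0.
rewrite -(average_remainder _ _ _ fS) -mulrA; apply: HC; first by rewrite mulr_gt0.
- apply: rpredD; first exact/rpredZ/in_S_translate/in_S_pderiv.
  by apply: rpredD; [exact/rpredZ/in_S_translate|exact: in_S_translate].
- have HA' : young_le omega k (A + D) (partials [:: i; i] (Re \o f)).
    by apply: young_leW HA; rewrite lerDl ltW.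
  have := growth_remainder 1 x h yu.1 HA'; congr growth_le; apply/funext => y.
  rewrite /remainder /translate /pderiv.
  change (1 * (1 * Re (f (1 *: y + (x + h *: delta_mx 0 i))) + -1 * Re (f (1 *: y + x))) +
    - h * partials [:: i] (Re \o f) (1 *: y + x) =
    Re ((- h%:C)%C * (partials [:: i] (Re \o f) (1 *: y + x) +i* partials [:: i] (Im \o f) (1 *: y + x))%C +
    ((- 1) * f (1 *: y + x) + f (1 *: y + (x + h *: delta_mx 0 i))))).
  case: (f (1 *: y + x)) (f (1 *: y + (x + _))) => a b [c d] /=; ring.
- have HD' : young_le omega k (A + D) (partials [:: i; i] (Im \o f)).
    by apply: young_leW HD; rewrite lerDr ltW.
  have := growth_remainder 1 x h yv.1 HD'; congr growth_le; apply/funext => y.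
  rewrite /remainder /translate /pderiv.
  change (1 * (1 * Im (f (1 *: y + (x + h *: delta_mx 0 i))) + -1 * Im (f (1 *: y + x))) +
    - h * partials [:: i] (Im \o f) (1 *: y + x) =
    Im ((- h%:C)%C * (partials [:: i] (Re \o f) (1 *: y + x) +i* partials [:: i] (Im \o f) (1 *: y + x))%C +
    ((- 1) * f (1 *: y + x) + f (1 *: y + (x + h *: delta_mx 0 i))))).
  case: (f (1 *: y + x)) (f (1 *: y + (x + _))) => a b [c d] /=; ring.
Qed.

Lemma Re_increment (z w t : R[i]) (h : R) : Re (z - w - (h%:C)%C * t) = Re z - Re w - h * Re t.
Proof. by case: z w t => a b [c d] [p q] /=; ring. Qed.

Lemma Im_increment (z w t : R[i]) (h : R) : Im (z - w - (h%:C)%C * t) = Im z - Im w - h * Im t.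
Proof. by case: z w t => a b [c d] [p q] /=; ring. Qed.

Lemma is_derive_average i f x : f \in S_ ->
  is_derive x (delta_mx 0 i) (Re \o average f) (Re (average (pderiv i f) x)) /\
  is_derive x (delta_mx 0 i) (Im \o average f) (Im (average (pderiv i f) x)).
Proof.
move=> fS; have [C HC] := remainder_bound i fS.
split; apply: (@is_derive_quadratic _ _ _ _ _ _ C) => h _; rewrite [h *: _ + x]addrC /=;
  apply: le_trans (HC x h).
- by rewrite -Re_increment norm_Re_le.
- by rewrite -Im_increment norm_Im_le.
Qed.

Definition Sw_pderiv i (f : Sw omega N) : Sw omega N := MkSw (in_S_pderiv i (valP f)).

Lemma foldr_pderiv s (f : Sw omega N) :
  Re \o (foldr Sw_pderiv f s) = partials s (Re \o f) /\
  Im \o (foldr Sw_pderiv f s) = partials s (Im \o f).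
Proof. by elim: s => [|i s [IHr IHi]]//=; rewrite -/(partials _ _) -IHr -IHi. Qed.

Lemma smooth_average (f : Sw omega N) : smooth (average f) /\
  forall s, partials s (Re \o average f) = Re \o average (foldr Sw_pderiv f s) /\
            partials s (Im \o average f) = Im \o average (foldr Sw_pderiv f s).
Proof.
have /choice[B HB] : forall g : Sw omega N, exists B, forall x, normc (average g x) <= B.
  by move=> g; exact: average_bounded (valP g).
have dr (g : Sw omega N) i x := (is_derive_average i x (valP g)).1.
have di (g : Sw omega N) i x := (is_derive_average i x (valP g)).2.
have br (g : Sw omega N) x := le_trans (norm_Re_le _) (HB g x).
have bi (g : Sw omega N) x := le_trans (norm_Im_le _) (HB g x).
have [sr pr] := @smooth_family R N _ (fun g : Sw omega N => Re \o average g) Sw_pderiv B dr br f.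
have [si pi] := @smooth_family R N _ (fun g : Sw omega N => Im \o average g) Sw_pderiv B di bi f.
by split=> // s; split.
Qed.

(** With [z = y + x], the weight at [x = z - y] splits: the part at [z] is paid by the decay of [u],
    the part at [y] by the growth that the step [n >= m L] admits. The doubled index comes from
    [decayM_le], which merges the orders of [r] and [s]. *)
Lemma young_translate n k m L x s (A : R) u : smooth_real u ->
  (forall x y, W (x + y) <= L%:R * (1 + W x + W y)) -> (m * L <= n)%N -> 0 < young_factor omega m (size s) x ->
  young_le omega (maxn k (m * L + m) * 2) A u ->
  growth_le omega n k (expR (m * L)%:R * A / young_factor omega m (size s) x)
    (fun y => partials s u (1 *: y + x)).
Proof.
move=> su HL mLn g0 uA r y; rewrite partials_affine; last exact: smooth_partials.
rewrite expr1n mul1r -partials_cat ler_pdivlMr//.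
set z := 1 *: y + x; set M := maxn _ _ in uA.
have WN : W (- y) = W y by apply: weightN_sqr => i; rewrite mxE sqrrN.
have hW : m%:R * W x <= (m * L)%:R + (m * L)%:R * W z + (m * L)%:R * W y.
  have -> : x = z + (- y) by rewrite /z scale1r addrAC subrr add0r.
  have := ler_wpM2l (ler0n R m) (HL z (- y)); rewrite WN natrM; lra.
have kM : (k <= M)%N by exact: leq_maxl.
have mM : (m <= M)%N by rewrite (leq_trans _ (leq_maxr _ _))// leq_addl.
have gM : G k (size r) * G m (size s) <= G (M * 2) (size (r ++ s)).
  rewrite size_cat; apply: le_trans (decayM_le _ _ _ _).
  by apply: ler_pM; rewrite ?decay_ge0 ?decay_mono.
have eM : expR (- (n%:R * W y)) * expR (m%:R * W x) <= expR (m * L)%:R * expR ((M * 2)%:R * W z).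
  rewrite -!expRD ler_expR.
  have h1 : (m * L)%:R * W y <= n%:R * W y by rewrite ler_wpM2r ?weightN_ge0// ler_nat.
  have h2 : (m * L)%:R * W z <= (M * 2)%:R * W z.
    rewrite ler_wpM2r ?weightN_ge0// ler_nat muln2 -addnn.
    by rewrite (leq_trans _ (leq_addr _ _))// (leq_trans _ (leq_maxr _ _))// leq_addr.
  lra.
set X := `|_|; have X0 : 0 <= X := normr_ge0 _.
have -> : X * (expR (- (n%:R * W y)) * G k (size r)) * young_factor omega m (size s) x =
  X * ((expR (- (n%:R * W y)) * expR (m%:R * W x)) * (G k (size r) * G m (size s))).
  by rewrite /young_factor; ring.
apply: (@le_trans _ _ (X * ((expR (m * L)%:R * expR ((M * 2)%:R * W z)) * G (M * 2) (size (r ++ s))))).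
  by apply: ler_wpM2l => //; apply: ler_pM; rewrite ?mulr_ge0 ?expR_ge0 ?decay_ge0.
rewrite -mulrA mulrCA; apply: ler_wpM2l; first exact: expR_ge0.
exact: uA.
Qed.

Lemma average_young m : exists (M : nat) (C : R), 0 < C /\ forall (f : Sw omega N) (A : R), 0 < A ->
  young_le omega M A (Re \o f) -> young_le omega M A (Im \o f) ->
  young_le omega m (C * A) (Re \o average f) /\ young_le omega m (C * A) (Im \o average f).
Proof.
have [L HL] := @weightN_add R omega N.
(* The index [m] fixes the step [m L + 1], continuity of [T] on this step yields [k], and [k]
   determines the index required of [f]. The successor keeps the step positive. *)
have [k [C [C0 HC]]] := pairing_bound (ltn0Sn (m * L)).
exists (maxn k (m * L + m) * 2)%N, (C * expR (m * L)%:R); split; first by rewrite mulr_gt0 ?expR_gt0.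
move=> f A A0 fu fv; have [yu yv] := in_S_young (valP f).
have key s x : normc (average (foldr Sw_pderiv f s) x) * young_factor omega m (size s) x <=
    C * expR (m * L)%:R * A.
  have [->|g0] := eqVneq (young_factor omega m (size s) x) 0.
    by rewrite mulr0 !mulr_ge0 ?expR_ge0// ltW.
  have g1 : 0 < young_factor omega m (size s) x by rewrite lt_neqAle eq_sym g0 young_factor_ge0.
  rewrite -ler_pdivlMr// -!mulrA; have [Er Ei] := foldr_pderiv s f.
  rewrite [expR _ * (A / _)]mulrA; apply: HC.
  - by rewrite divr_gt0// mulr_gt0// expR_gt0.
  - exact: in_S_translate (valP _).
  - have := young_translate yu.1 HL (leqnSn _) g1 fu; congr growth_le; apply/funext => y.
    by rewrite -Er.
  - have := young_translate yv.1 HL (leqnSn _) g1 fv; congr growth_le; apply/funext => y.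
    by rewrite -Ei.
have [_ pE] := smooth_average f.
split=> s x; have [Er Ei] := pE s; rewrite (Er, Ei); apply: le_trans (key s x);
  apply: ler_wpM2r; rewrite ?young_factor_ge0//; [exact: norm_Re_le|exact: norm_Im_le].
Qed.

Lemma in_S_average (f : Sw omega N) : average f \in S_.
Proof.
have [yu yv] := in_S_young (valP f); have [[su sv] _] := smooth_average f.
have bd m : exists C : R, young_le omega m C (Re \o average f) /\ young_le omega m C (Im \o average f).
  have [M [C [C0 HC]]] := average_young m.
  have [A A0 HA] := young_le_bound M yu; have [D D0 HD] := young_le_bound M yv.
  exists (C * (A + D)); apply: HC; first by rewrite addr_gt0.
    by apply: young_leW HA; rewrite lerDl ltW.
  by apply: young_leW HD; rewrite lerDr ltW.
apply: young_in_S => //; split=> // m; have [C [h1 h2]] := bd m; exists C.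
  exact: h1.
exact: h2.
Qed.

End Averaging.

(** * Strong duals and transposes *)

Section StrongDual.
Context {R : realType} {E : preTopologicalLmodType R[i]}.
Local Notation K := (R[i]).

(** An open set of the dual is the preimage of an open set of functions, where the topology is that
    of uniform convergence on bounded sets; convergence can thus be tested on entourages.
    [dual_near] is the converse direction for the neighbourhood filter. *)
Lemma dual_cvg (S0 : dual E) (F : set_system (dual E)) : Filter F ->
  (forall (B : set E) (D : set (K^o * K^o)), vn_bounded B -> entourage D ->
    F [set S : dual E | forall y, B y -> D (S0 y, S y)]) -> F --> S0.
Proof.
move=> FF H U /=; rewrite nbhsE => -[V [oV V0] VU].
apply: filterS VU _; case: oV => O oO OV.
have O0 : O (dual_fun S0) by have : V S0 by []; rewrite -OV.
have nO : nbhs (dual_fun S0 : {family (@vn_bounded K E), E -> K^o}) O by apply: open_nbhs_nbhs; split.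
have : {family (@vn_bounded K E), (@dual_fun K E) @ F --> (S0 : E -> K^o)}.
  apply/fam_cvgP => B bB Y /uniform_nbhs[D [eD DY]].
  change (F (@dual_fun K E @^-1` Y)).
  by apply: (filterS _ (H B D bB eD)) => S HS; exact: (DY (dual_fun S) HS).
by move=> /(_ O nO); rewrite /fmap /= -OV.
Qed.

Lemma dual_near (S0 : dual E) (B : set E) (D : set (K^o * K^o)) : vn_bounded B -> entourage D ->
  nbhs S0 [set S : dual E | forall y, B y -> D (S0 y, S y)].
Proof.
move=> bB eD.
have c : {for S0, continuous (@dual_fun K E : dual E -> {family (@vn_bounded K E), E -> K^o})}.
  exact: initial_continuous.
exact: (c _ (@fam_nbhs E K^o (@vn_bounded K E) B D _ eD bB)).
Qed.

Lemma vn_bounded_image (E' : preTopologicalLmodType R[i]) (h : E -> E') (B : set E) :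
  linear h -> {for 0, continuous h} -> vn_bounded B -> vn_bounded (h @` B).
Proof.
move=> lh ch bB U nU; have h0 : h 0 = 0 := linear_map0 lh.
have [|r r0 Hr] := bB (h @^-1` U); first by apply: ch; rewrite h0.
exists r => // a ra _ [x Bx <-]; have [y Uy <-] := Hr a ra x Bx.
by exists (h y) => //; rewrite (linear_mapZ _ _ lh).
Qed.

Variables (h : E -> E).
Hypotheses (lh : linear h) (ch : continuous h).

Lemma transpose_is_dual (S : dual E) : (fun f => S (h f)) \in @is_dual K E.
Proof.
rewrite inE; split=> [c f g|f]; first by rewrite lh (dual_linear S).
by apply: (@continuous_comp _ _ _ h S); [exact: ch|exact: dual_continuous].
Qed.

Definition transpose (S : dual E) : dual E := Dual (transpose_is_dual S).

Lemma transpose_linear : linear transpose.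
Proof. by move=> c S S'; apply: val_inj. Qed.

HB.instance Definition _ := GRing.isLinear.Build K (dual E) (dual E) _ transpose transpose_linear.

Lemma transpose_continuous : continuous transpose.
Proof.
move=> S0.
have FS : Filter (nbhs S0) by exact: (@nbhs_filter (dual E) S0).
have FT : Filter (transpose @ S0) by exact: (fmap_filter transpose FS).
apply: (@dual_cvg (transpose S0) _ FT) => B D bB eD.
have bh := vn_bounded_image lh (@ch 0) bB.
apply: filterS (dual_near S0 bh eD) => S HS y By.
by apply: HS; exists y.
Qed.

End StrongDual.

(** * The convolution operator as a transpose *)

Section Convolution.
Context {R : realType} (omega : nqa_weight R) (N : nat) (N_gt0 : (0 < N)%N).
Variable T : dual (OC omega N).
Local Notation RN := 'rV[R]_N.
Local Notation S_ := (@in_S R omega N).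
Local Notation Re := (@complex.Re R).
Local Notation Im := (@complex.Im R).
Implicit Types (f g : Sw omega N).

Definition averaging f : Sw omega N := MkSw (in_S_average N_gt0 T f).

(** The reflections in [star] and in [reflect_dual] cancel. Both insertions into [Sw] meet functions
    of S_omega, so the default value 0 of [insubd] does not occur. *)
Lemma star_reflect_restrict f : star (reflect_dual (OC_restrict T)) f = average T f.
Proof.
apply/funext => x; rewrite /star /Sw_pairing /reflect_dual /OC_restrict /average.
have E1 : (fun y : RN => f (x - y)) \in S_.
  rewrite (_ : (fun y => _) = fun y : RN => f (-1 *: y + x)); first exact: in_S_reflect (valP f).
  by apply/funext => y; rewrite scaleN1r addrC.
have E2 : (fun y : RN => Sw_fun (insubd (0 : Sw omega N) (fun y : RN => f (x - y))) (- y)) = translate x f.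
  have -> : Sw_fun (insubd (0 : Sw omega N) (fun y : RN => f (x - y))) = (fun y : RN => f (x - y)) := insubdK _ E1.
  by apply/funext => y; rewrite /translate scale1r opprK addrC.
rewrite E2 /Sw_pairing; congr (OC_pairing T _).
exact: insubdK _ (in_S_translate N_gt0 x (valP f)).
Qed.

Lemma convolutionE (S : dual (Sw omega N)) f : convolution T S f = S (averaging f).
Proof.
rewrite /convolution star_reflect_restrict /Sw_pairing; congr (S _).
by apply: val_inj; rewrite insubdK//; exact: (in_S_average N_gt0 T f).
Qed.

Lemma averaging_linear : linear averaging.
Proof.
move=> c f g; apply: val_inj.
exact: (average_linear N_gt0 T c (valP f) (valP g)).
Qed.

Lemma averaging_continuous : continuous averaging.
Proof.
apply/continuousP => U oU; change (Sw_open (averaging @^-1` U)) => f Uf.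
have [k [e [e0 HU]]] := oU (averaging f) Uf.
(* One index serves all norms up to [k], because [young_factor] increases with its index. The ball
   in the source uses [M.+1], since [multiball] only involves positive indices; with [A = e / (4 C)]
   each component contributes [e / 4]. *)
have [M [C [C0 HC]]] := average_young N_gt0 T k.+1.
pose A := e / (4 * C); have A0 : 0 < A by rewrite divr_gt0// mulr_gt0.
exists M.+1, A; split=> // g Hg; apply: HU => m /andP[m0 mk].
have -> : averaging g - averaging f = averaging (g - f).
  by have := averaging_linear (-1) f g; rewrite !scaleN1r ![- _ + _]addrC.
have sS (p : Sw omega N) : smooth p by have [[su _] [sv _]] := in_S_young (valP p).
have := Hg M.+1; rewrite ltnSn => /(_ isT) /ltW.
have sgf : smooth (Sw_fun (g - f)) := sS (g - f).
move=> /(weighted_sup_ge (ltn0Sn M) sgf)[hu hv].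
have young (w : RN -> R) : (forall s x, `|partials s w x| * (expR ((M.+1%:Z)%:~R * weightN omega x) *
    decay omega M.+1 (size s)) <= A) -> young_le omega M A w.
  move=> hw s x; apply: le_trans (hw s x); apply: ler_wpM2l => //.
  exact: young_factor_mono (leqnSn M).
have [bu bv] := HC (g - f) A A0 (young _ hu) (young _ hv).
apply: (@le_lt_trans _ _ ((C * A + C * A)%:E)); last first.
  rewrite lte_fin /A; have -> : C * (e / (4 * C)) + C * (e / (4 * C)) = e / 2.
    by field; rewrite gt_eqF.
  lra.
apply: (weighted_sup_le m0) => [|s x|s x]; first exact: sS.
  apply: le_trans (bu s x); apply: ler_wpM2l => //.
  exact: young_factor_mono (leq_trans mk (leqnSn k)).
apply: le_trans (bv s x); apply: ler_wpM2l => //.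
exact: young_factor_mono (leq_trans mk (leqnSn k)).
Qed.

End Convolution.

Theorem proposition5p6 (R : realType) (N : nat) (hN : (0 < N)%N)
    (omega : nqa_weight R) (T : dual (OC omega N)) :
  (forall S : dual (Sw omega N), convolution T S \in is_dual) /\
  exists C : {linear dual (Sw omega N) -> dual (Sw omega N)},
    (forall (S : dual (Sw omega N)) (f : Sw omega N),
       C S f = convolution T S f) /\
    continuous C.
Proof.
have lA := averaging_linear hN T; have cA := @averaging_continuous R omega N hN T.
split=> [S|].
  rewrite (_ : convolution T S = fun f => S (averaging hN T f)); first exact: transpose_is_dual.
  by apply/funext => f; exact: convolutionE.
exists (transpose lA cA); split=> [S f|]; last exact: transpose_continuous.
by rewrite (convolutionE hN).
Qed.
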